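(* Equip $\mathcal{P}(D_n)$ with the pointwise operations and the locally convex topology defined by the norms $\|\cdot\|_{D_n,\rho}$ for all $\rho>0$. Then the Fréchet $*$-algebra $\mathcal{A}(D_n)$ (pointwise operations, seminorms $\|\cdot\|_{D_n,K}$) is the completion of $\mathcal{P}(D_n)$: the subspace topology that $\mathcal{P}(D_n)$ inherits from $\mathcal{A}(D_n)$ is the topology of the norms $\|\cdot\|_{D_n,\rho}$, $\rho>0$, and $\mathcal{P}(D_n)$ is dense in $\mathcal{A}(D_n)$. Moreover, the functions $f_{r,P,Q}$, $P,Q\in\mathbb{N}_0^n$, form an absolute Schauder basis of $\mathcal{A}(D_n)$: every $a\in\mathcal{A}(D_n)$ equals the absolutely convergent series $$a=\sum_{P,Q\in\mathbb{N}_0^n} c_{P,Q}(a)\, f_{r,P,Q},\qquad c_{P,Q}(a)=\frac{1}{(2\pi i)^{2n}}\oint_{|x^1|=r}\!\!\cdots\oint_{|x^n|=r}\oint_{|y^1|=r}\!\!\cdots\oint_{|y^n|=r}\frac{\hat a\big((\hat\phi^{\mathrm{std}})^{-1}(x,y)\big)\,(1-x\cdot y)^{\max\{|P|,|Q|\}-1}}{x^{P+1}\,y^{Q+1}}\,dx^1\cdots dx^n\,dy^1\cdots dy^n,$$ where $r\in\,]0,1/\sqrt n[$ is arbitrary, the circles are positively oriented, $x^{P+1}=\prod_{i=1}^n (x^i)^{P_i+1}$, $y^{Q+1}=\prod_{i=1}^n(y^i)^{Q_i+1}$, and the coefficients in such an expansion are unique.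
   Context: Fix an integer $n\ge1$. Indices $\mu,\nu$ run over $\{0,\dots,n\}$; $h_{\mu\nu}$ is diagonal with $h_{00}=-1$, $h_{ii}=1$ for $i\ge1$. For a multi-index $P$, $|P|=\sum_i P_i$. For $P\in\mathbb{N}_0^{1+n}$ write $P'=(P_1,\dots,P_n)$. Let $Z=\{r\in\mathbb{C}^{1+n}: -|r^0|^2+\sum_{i=1}^n|r^i|^2=-1\}$, let $U(1)$ act by scalar multiplication, and $D_n=Z/U(1)$; via $[r]\mapsto w=(r^1/r^0,\dots,r^n/r^0)$, $D_n$ is identified with the open unit ball $\{w\in\mathbb{C}^n:\ w\cdot\bar w:=\sum_i|w^i|^2<1\}$. Let $\hat Z=\{(p,q)\in\mathbb{C}^{1+n}\times\mathbb{C}^{1+n}: -p^0q^0+\sum_{i=1}^n p^iq^i=-1\}$ with the free proper holomorphic $\mathbb{C}^*$-action $z\cdot(p,q)=(zp,q/z)$, and $\hat D_n=\hat Z/\mathbb{C}^*$ (a complex manifold of dimension $2n$). Let $\Delta_D:D_n\to\hat D_n$, $[r]\mapsto[r,\bar r]$. The standard chart $\hat\phi^{\mathrm{std}}=(u^1,\dots,u^n,v^1,\dots,v^n)$ of $\hat D_n$ is defined on $\{[p,q]: p^0\neq0,\ q^0\neq0\}$ by $u^i=p^i/p^0$, $v^i=q^i/q^0$; it is biholomorphic onto $\{(x,y)\in\mathbb{C}^n\times\mathbb{C}^n: x\cdot y:=\sum_i x^iy^i\neq1\}$. $\mathcal{A}(D_n)=\{\hat a\circ\Delta_D:\hat a\in\mathcal{O}(\hat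 D_n)\}$; for each $a\in\mathcal{A}(D_n)$ the holomorphic $\hat a$ with $a=\hat a\circ\Delta_D$ is unique. It is a $*$-algebra under pointwise operations and pointwise complex conjugation, and a Fréchet space with seminorms $\|a\|_{D_n,K}=\sup_{x\in K}|\hat a(x)|$, $K\subseteq\hat D_n$ compact. For $P,Q\in\mathbb{N}_0^{1+n}$ with $|P|=|Q|$, $f_{P,Q}\in\mathcal{A}(D_n)$ is $f_{P,Q}([r])=r^P\bar r^Q$, i.e. $f_{P,Q}=w^{P'}\bar w^{Q'}/(1-w\cdot\bar w)^{|P|}$; $\mathcal{P}(D_n)$ is their linear span. For $P,Q\in\mathbb{N}_0^n$ the fundamental monomial is $f_{r,P,Q}=w^P\bar w^Q/(1-w\cdot\bar w)^{\max\{|P|,|Q|\}}\in\mathcal{P}(D_n)$; these form a basis of $\mathcal{P}(D_n)$. For $\rho>0$ the norm $\|\cdot\|_{D_n,\rho}$ on $\mathcal{P}(D_n)$ is $\|\sum_{P,Q}a_{P,Q}f_{r,P,Q}\|_{D_n,\rho}=\sum_{P,Q}|a_{P,Q}|\rho^{|P+Q|}$. ''Absolutely convergent'' means that for every continuous seminorm $p$ on $\mathcal{A}(D_n)$, $\sum_{P,Q}|c_{P,Q}(a)|\,p(f_{r,P,Q})<\infty$. *)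

(* Defs.v *)
From HB Require Import structures.
From mathcomp Require Import all_boot all_order all_algebra.
From mathcomp Require Import all_classical all_reals all_analysis.
From mathcomp Require Import complex.
Set Implicit Arguments. Unset Strict Implicit. Unset Printing Implicit Defensive.
Import Order.TTheory GRing.Theory Num.Theory.
Import numFieldNormedType.Exports.
Local Open Scope classical_set_scope.
Local Open Scope ring_scope.

(* The complex numbers C = R[i] over a real type R.  We use the regular
   alias (_)^o so that MathComp-Analysis finds the normed/topological
   structure of C as a normed space over itself. *)
Notation CC R := ((R[i])^o).

Section Defs.
Variable R : realType.
Local Notation C := (CC R).

Definition cabs (z : C) : R := ComplexField.Normc.normc z.
Definition cexpi (t : R) : C := (cos t +i* sin t)%C.
Definition cI : C := ('i)%C.

Variable n : nat.

Definition mindex := 'I_n -> nat.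
Definition msize (P : mindex) : nat := (\sum_(i < n) P i)%N.

Definition pt := ('rV[C]_n.+1 * 'rV[C]_n.+1)%type.

Definition hsgn (mu : 'I_n.+1) : C := if mu == ord0 then -1 else 1.
Definition hform (p q : 'rV[C]_n.+1) : C := \sum_(mu < n.+1) hsgn mu * p 0 mu * q 0 mu.

Definition Zhat : set pt := [set pq | hform pq.1 pq.2 = -1].

Definition cact (z : C) (pq : pt) : pt := (z *: pq.1, z^-1 *: pq.2).

(* functions on \hat D_n = \hat Z / C^* are C^*-invariant functions on \hat Z *)
Definition cstar_invariant (F : pt -> C) : Prop :=
  forall z, z != 0 -> forall pq, Zhat pq -> F (cact z pq) = F pq.

(* subsets of \hat Z which are unions of C^*-orbits (= preimages of subsets of \hat D_n) *)
Definition saturated (S : set pt) : Prop :=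
  S `<=` Zhat /\ forall z, z != 0 -> forall pq, S pq -> S (cact z pq).

(* open subsets of \hat D_n (quotient topology of the subspace \hat Z of
   C^{1+n} x C^{1+n}), represented by their saturated preimages in \hat Z *)
Definition qopen (O : set pt) : Prop :=
  saturated O /\ exists W : set pt, open W /\ O = W `&` Zhat.

(* compact subsets of \hat D_n (for the quotient topology), represented by
   their saturated preimages in \hat Z *)
Definition qcompact (K : set pt) : Prop :=
  saturated K /\
  forall Os : set (set pt), (forall O, Os O -> qopen O) ->
    K `<=` \bigcup_(O in Os) O ->
    exists s : seq (set pt), (forall O, O \in s -> Os O) /\
                             K `<=` \bigcup_(O in [set` s]) O.

(* Holomorphic charts of \hat D_n: for mu, nu in {0..n}, the chart on
   {[p,q] : p^mu <> 0, q^nu <> 0}; its inverse sends (u,v) in C^n x C^n with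
   h(u^,v^) <> 0 to [u^, -v^/h(u^,v^)], where u^ is u with 1 inserted at
   position mu.  For mu = nu = 0 this is the inverse of the standard chart
   \hat\phi^std. *)
Definition ins (mu : 'I_n.+1) (u : 'rV[C]_n) : 'rV[C]_n.+1 :=
  \row_j (if unlift mu j is Some k then u 0 k else 1).
Definition chart_dom (mu nu : 'I_n.+1) : set ('rV[C]_n * 'rV[C]_n) :=
  [set uv | hform (ins mu uv.1) (ins nu uv.2) != 0].
Definition chart_inv (mu nu : 'I_n.+1) (uv : 'rV[C]_n * 'rV[C]_n) : pt :=
  (ins mu uv.1, (- (hform (ins mu uv.1) (ins nu uv.2))^-1) *: ins nu uv.2).

Definition holomorphic_on (U : set ('rV[C]_n * 'rV[C]_n))
    (G : 'rV[C]_n * 'rV[C]_n -> C) : Prop :=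
  forall uv, U uv -> differentiable G uv.

Definition Ohat (F : pt -> C) : Prop :=
  cstar_invariant F /\
  forall mu nu, holomorphic_on (chart_dom mu nu) (F \o chart_inv mu nu).

Definition semiK (K : set pt) (F : pt -> C) : R := sup [set cabs (F pq) | pq in K].

(* \hat f_{r,P,Q}: with m = max(|P|,|Q|), f_{r,P,Q} = f_{P~,Q~} where
   P~ = (m - |P|, P), Q~ = (m - |Q|, Q); hence \hat f_{r,P,Q}[p,q] = p^{P~} q^{Q~}. *)
Definition fhat (P Q : mindex) (pq : pt) : C :=
  let m := maxn (msize P) (msize Q) in
  pq.1 0 ord0 ^+ (m - msize P) * pq.2 0 ord0 ^+ (m - msize Q) *
  \prod_(i < n) (pq.1 0 (lift ord0 i) ^+ P i * pq.2 0 (lift ord0 i) ^+ Q i).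

(* f_{r,P,Q} on D_n (the open unit ball of C^n), for reference *)
Definition fr (P Q : mindex) (w : 'rV[C]_n) : C :=
  (\prod_(i < n) (w 0 i ^+ P i * (w 0 i)^*%C ^+ Q i)) /
  (1 - \sum_(i < n) w 0 i * (w 0 i)^*%C) ^+ maxn (msize P) (msize Q).

Definition boxsum (N : nat) (V : nmodType) (g : mindex -> mindex -> V) : V :=
  \sum_(P : {ffun 'I_n -> 'I_N}) \sum_(Q : {ffun 'I_n -> 'I_N})
     g (fun i => nat_of_ord (P i)) (fun i => nat_of_ord (Q i)).

(* the (hat of the) element sum_{P,Q in box N} c_{P,Q} f_{r,P,Q} of P(D_n) *)
Definition psum (N : nat) (c : mindex -> mindex -> C) (pq : pt) : C :=
  boxsum N (fun P Q => c P Q * fhat P Q pq).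

Definition rnorm (rho : R) (N : nat) (c : mindex -> mindex -> C) : R :=
  boxsum N (fun P Q => cabs (c P Q) * rho ^+ (msize P + msize Q)).

Definition cint (g : R -> C) : C :=
  ((Rintegral lebesgue_measure `[0, pi *+ 2] (fun t => complex.Re (g t)))%:C +
   cI * (Rintegral lebesgue_measure `[0, pi *+ 2] (fun t => complex.Im (g t)))%:C)%C.

Fixpoint tint (k : nat) (g : (nat -> R) -> C) : C :=
  match k with
  | 0 => g (fun _ => 0)
  | k'.+1 => cint (fun t => tint k' (fun th => g (fun j => if j == k' then t else th j)))
  end.

(* the coefficient c_{P,Q}(a), via the parametrisations
   x^i = r e^{i theta_i}, y^i = r e^{i theta_{n+i}}, dx^i = i x^i dtheta_i, ... *)
Definition coef (r : R) (F : pt -> C) (P Q : mindex) : C :=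
  let m := maxn (msize P) (msize Q) in
  ((pi *+ 2)%:C%C * cI) ^- (2 * n) *
  tint (2 * n) (fun th =>
    let x : 'rV[C]_n := \row_i (r%:C%C * cexpi (th i)) in
    let y : 'rV[C]_n := \row_i (r%:C%C * cexpi (th (n + i)%N)) in
    let xy := \sum_(i < n) x 0 i * y 0 i in
    F (chart_inv ord0 ord0 (x, y)) * (1 - xy) ^ (Posz m - 1)
    / (\prod_(i < n) (x 0 i ^+ (P i).+1 * y 0 i ^+ (Q i).+1))
    * \prod_(i < n) (cI * x 0 i) * \prod_(i < n) (cI * y 0 i)).

Definition abs_conv (c : mindex -> mindex -> C) : Prop :=
  forall K, qcompact K -> exists B : R, forall N,
    boxsum N (fun P Q => cabs (c P Q) * semiK K (fhat P Q)) <= B.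

Definition series_to (c : mindex -> mindex -> C) (F : pt -> C) : Prop :=
  forall K, qcompact K -> forall eps : R, 0 < eps -> exists N0 : nat,
    forall N, (N0 <= N)%N -> semiK K (fun pq => F pq - psum N c pq) < eps.

End Defs.

(* Main.v *)
(* Each of the open sets {q^0 <> 0} and {p^0 <> 0} of \hat D_n is a copy of C^{2n}, and
   f_{r,P,Q} is a monomial on the first if |Q| <= |P|, on the second if |P| <= |Q|.  Let
   the coefficient of F at (P,Q) be the Taylor coefficient of F on the corresponding copy.
   Cauchy's estimates on arbitrarily large polydiscs make these coefficients decay faster
   than any geometric sequence, which gives absolute convergence, and also bounds the
   norms ||.||_rho by suprema over compact sets.

   That the series sums to F where p^0 and q^0 do not vanish is seen by letting C^* act by
   zeta.(x,y) = (x/zeta, zeta y): both Taylor series converge to F along the orbit, and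
   integrating their difference against 1/(zeta - 1) over |zeta| = 2 keeps exactly the terms
   with |P| < |Q|, so these may be exchanged between the two series.  Shears of \hat Z move
   any point to a nearby point with p^0 q^0 <> 0, so the error bound extends by continuity.

   Finally, integrated against the kernel of c_{P,Q}, the function f_{r,P',Q'} gives 1 if
   (P',Q') = (P,Q) and 0 otherwise; hence the coefficients of any convergent expansion are
   the integrals c_{P,Q}. *)

Require Import Defs.
From HB Require Import structures.
From mathcomp Require Import all_boot all_order all_algebra.
From mathcomp Require Import all_classical all_reals all_analysis.
From mathcomp Require Import complex.
From mathcomp Require Import ring lra zify.
Import Order.TTheory GRing.Theory Num.Theory.
Import numFieldNormedType.Exports.
Local Open Scope classical_set_scope.
Local Open Scope ring_scope.
Set Implicit Arguments. Unset Strict Implicit. Unset Printing Implicit Defensive.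

(** * Complex-valued integrals on intervals *)

(** The integrals c_{P,Q} cannot themselves supply the decay of the coefficients: their tori have
    radius below 1 / sqrt n, so that estimating them directly gives a geometric rate limited by that
    radius. The coefficients used throughout ([ecoef]) therefore live on the two copies of C^{2n},
    where every radius is allowed, and are identified with the integrals only at the end, through
    uniqueness.

    The price is a series that is a Taylor series of F on neither copy, its terms with |P| < |Q|
    being taken from the other one. The kernel 1/(zeta - 1) repairs this because x^P y^Q has weight
    |Q| - |P| under zeta; the circle |zeta| = 2 avoids the pole at 1, and both series still converge
    there since all radii are available.

    This argument is only pointwise. Uniformity comes from the tail of the series, which is
    controlled by a bound on the products |p^mu q^nu| alone. Such a bound survives small
    perturbations of the point, which is what lets the estimate pass to the locus p^0 q^0 = 0.

    The norm estimates of the first claim use uniqueness as well: a finite sum determines its own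
    coefficients. *)

Section Modulus.
Variable R : realType.
Local Notation C := (CC R).
Implicit Types (x y z : C) (a b : R).
Local Notation Re := (@complex.Re R).
Local Notation Im := (@complex.Im R).

Lemma cabs0 : cabs (0 : C) = 0.
Proof. exact: ComplexField.Normc.normc0. Qed.

Lemma cabs1 : cabs (1 : C) = 1.
Proof. exact: ComplexField.Normc.normc1. Qed.

Lemma cabsM x y : cabs (x * y) = cabs x * cabs y.
Proof. exact: ComplexField.Normc.normcM. Qed.

Lemma cabsV x : cabs x^-1 = (cabs x)^-1.
Proof. exact: ComplexField.Normc.normcV. Qed.

Lemma cabsN x : cabs (- x) = cabs x.
Proof. exact: normcN. Qed.

Lemma cabsD x y : cabs (x + y) <= cabs x + cabs y.
Proof. exact: le_normcD. Qed.

Lemma cabsB x y : cabs (x - y) = cabs (y - x).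
Proof. by rewrite -cabsN opprB. Qed.

Lemma cabs_ge0 x : 0 <= cabs x.
Proof. by case: x => p q; rewrite /cabs /= sqrtr_ge0. Qed.

Lemma cabs0P x : cabs x = 0 -> x = 0.
Proof. exact: ComplexField.Normc.eq0_normc. Qed.

Lemma cabs_gt0 x : (0 < cabs x) = (x != 0).
Proof.
rewrite lt_def cabs_ge0 andbT; congr (~~ _).
apply/eqP/eqP => [/cabs0P //|->]; exact: cabs0.
Qed.

Lemma cabsX x n : cabs (x ^+ n) = cabs x ^+ n.
Proof. by elim: n => [|n IH]; rewrite ?expr0 ?cabs1 // !exprS cabsM IH. Qed.

Lemma cabs_real a : cabs (a%:C%C : C) = `|a|.
Proof. by rewrite /cabs /= expr0n /= addr0 sqrtr_sqr. Qed.

Lemma cabs_realB a b : cabs (a%:C%C - b%:C%C : C) = `|a - b|.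
Proof. by rewrite -cabs_real rmorphB. Qed.

Lemma cabs_Re x : `|Re x| <= cabs x.
Proof. by have := normc_ge_Re x; rewrite normc_def lecR; case: x. Qed.

Lemma cabs_Im x : `|Im x| <= cabs x.
Proof.
case: x => p q; rewrite /cabs /= -sqrtr_sqr ler_sqrt ?addr_ge0 ?sqr_ge0//.
by rewrite lerDr sqr_ge0.
Qed.

Lemma cabs_ReIm x : cabs x <= `|Re x| + `|Im x|.
Proof.
rewrite {1}(complexE x); apply: (le_trans (cabsD _ _)).
have -> : cabs ('i%C * (Im x)%:C%C : C) = cabs ('i%C : C) * cabs ((Im x)%:C%C : C).
  exact: cabsM.
by rewrite !cabs_real /cabs /= expr0n expr1n add0r sqrtr1 mul1r.
Qed.

Lemma cabsI : cabs ('i%C : C) = 1.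
Proof. by rewrite /cabs /= expr0n expr1n add0r sqrtr1. Qed.

Lemma cabs_sum (I : Type) (s : seq I) (P : pred I) (f : I -> C) :
  cabs (\sum_(i <- s | P i) f i) <= \sum_(i <- s | P i) cabs (f i).
Proof.
elim/big_ind2: _ => [|u a v b ua vb|i _]; rewrite ?(cabs0 R) ?normcN //; first by rewrite cabs0.
by rewrite (le_trans (cabsD _ _))// lerD.
Qed.

Lemma cabs_prod (I : Type) (s : seq I) (P : pred I) (f : I -> C) :
  cabs (\prod_(i <- s | P i) f i) = \prod_(i <- s | P i) cabs (f i).
Proof. by elim/big_ind2: _ => [|u a v b <- <-|]; rewrite ?cabs1 ?cabsM. Qed.

Lemma cabs_cexpi a : cabs (cexpi a) = 1.
Proof. by rewrite /cabs /cexpi /= cos2Dsin2 sqrtr1. Qed.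

Lemma cexpi_neq0 a : cexpi a != 0 :> C.
Proof. by rewrite -cabs_gt0 cabs_cexpi. Qed.

Lemma cexpiD a b : cexpi (a + b) = cexpi a * cexpi b :> C.
Proof.
apply/eqP; rewrite eq_complex /cexpi /= cosD sinD eqxx /=.
by apply/eqP; ring.
Qed.

Lemma cexpi0 : cexpi 0 = 1 :> C.
Proof. by rewrite /cexpi cos0 sin0. Qed.

Lemma cexpi2pi : cexpi (pi *+ 2) = 1 :> C.
Proof. by rewrite /cexpi cos2pi sin2pi. Qed.

Lemma normE x : `|x : R[i]| = (cabs x)%:C%C.
Proof. by rewrite normc_def; case: x. Qed.

Lemma cabs_le_dist x y z : cabs (x - z) <= cabs (x - y) + cabs (y - z).
Proof. by rewrite (le_trans _ (cabsD _ _))// addrA subrK. Qed.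

End Modulus.

Section ComplexIntegral.
Variable R : realType.
Local Notation C := (CC R).
Local Notation Re := (@complex.Re R).
Local Notation Im := (@complex.Im R).
Local Notation mu := (@lebesgue_measure R).
Implicit Types (a b c : R) (f g : R -> C).

Definition cintab a b g : C :=
  ((Rintegral mu `[a, b] (fun t => Re (g t)))%:C +
   @cI R * (Rintegral mu `[a, b] (fun t => Im (g t)))%:C)%C.

Lemma cintE g : cint g = cintab 0 (pi *+ 2) g.
Proof. by []. Qed.

Lemma ccomplexP (x y : C) : Re x = Re y -> Im x = Im y -> x = y.
Proof. by case: x y => [p q] [r s] /= -> ->. Qed.

Lemma Re_cintab a b g : Re (cintab a b g) = Rintegral mu `[a, b] (fun t => Re (g t)).
Proof. by rewrite /cintab /cI; simpc. Qed.

Lemma Im_cintab a b g : Im (cintab a b g) = Rintegral mu `[a, b] (fun t => Im (g t)).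
Proof. by rewrite /cintab /cI; simpc. Qed.

Opaque cintab.

Lemma ReD (x y : C) : Re (x + y) = Re x + Re y.
Proof. by case: x y => [p q] [r s]. Qed.
Lemma ImD (x y : C) : Im (x + y) = Im x + Im y.
Proof. by case: x y => [p q] [r s]. Qed.
Lemma ReB (x y : C) : Re (x - y) = Re x - Re y.
Proof. by case: x y => [p q] [r s]. Qed.
Lemma ImB (x y : C) : Im (x - y) = Im x - Im y.
Proof. by case: x y => [p q] [r s]. Qed.
Lemma ReM (x y : C) : Re (x * y) = Re x * Re y - Im x * Im y.
Proof. by case: x y => [p q] [r s]. Qed.
Lemma ImM (x y : C) : Im (x * y) = Re x * Im y + Im x * Re y.
Proof. by case: x y => [p q] [r s]. Qed.

Definition icont a b g :=
  {within `[a, b], continuous (fun t => Re (g t))} /\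
  {within `[a, b], continuous (fun t => Im (g t))}.

Lemma icont_eps a b g :
  (forall x, a <= x <= b -> forall e, 0 < e -> exists2 d, 0 < d &
     forall y, a <= y <= b -> `|x - y| < d -> cabs (g x - g y) < e) ->
  icont a b g.
Proof.
move=> H; split; apply/subspace_continuousP => x /=; rewrite in_itv /= => xab;
  apply/cvgrPdist_lt => e e0; have [d d0 Hd] := H x xab e e0;
  rewrite near_withinE; near=> y; rewrite /= in_itv /= => yab.
- rewrite -ReB; have := Hd y yab; move=> /(_ _)/(le_lt_trans (cabs_Re _)); apply.
  by near: y; apply: cvgr_dist_lt.
- rewrite -ImB; have := Hd y yab; move=> /(_ _)/(le_lt_trans (cabs_Im _)); apply.
  by near: y; apply: cvgr_dist_lt.
Unshelve. all: by end_near. Qed.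

Lemma icont_cst a b (z : C) : icont a b (fun=> z).
Proof. by split; apply: cst_continuous. Qed.

Lemma icontD a b f g : icont a b f -> icont a b g -> icont a b (fun t => f t + g t).
Proof.
move=> [fr fi] [gr gi]; split.
- rewrite (_ : (fun t => _) = (fun t => Re (f t) + Re (g t))); last first.
    by apply/funext => u; rewrite ReD.
  move=> t; apply: cvgD; [exact: fr|exact: gr].
- rewrite (_ : (fun t => _) = (fun t => Im (f t) + Im (g t))); last first.
    by apply/funext => u; rewrite ImD.
  move=> t; apply: cvgD; [exact: fi|exact: gi].
Qed.

Lemma icontM a b f g : icont a b f -> icont a b g -> icont a b (fun t => f t * g t).
Proof.
move=> [fr fi] [gr gi]; split.
- rewrite (_ : (fun t => _) = (fun t => Re (f t) * Re (g t) - Im (f t) * Im (g t))); last first.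
    by apply/funext => u; rewrite ReM.
  move=> t; apply: cvgB; apply: cvgM; [exact: fr|exact: gr|exact: fi|exact: gi].
- rewrite (_ : (fun t => _) = (fun t => Re (f t) * Im (g t) + Im (f t) * Re (g t))); last first.
    by apply/funext => u; rewrite ImM.
  move=> t; apply: cvgD; apply: cvgM; [exact: fr|exact: gi|exact: fi|exact: gr].
Qed.

Lemma icontN a b f : icont a b f -> icont a b (fun t => - f t).
Proof.
move=> cf; under eq_fun do rewrite -mulN1r.
by apply: icontM => //; exact: icont_cst.
Qed.

Lemma icontB a b f g : icont a b f -> icont a b g -> icont a b (fun t => f t - g t).
Proof. by move=> cf cg; apply: icontD => //; exact: icontN. Qed.

Lemma icontX a b f n : icont a b f -> icont a b (fun t => f t ^+ n).
Proof.
move=> cf; elim: n => [|n IH]; first exact: icont_cst.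
by under eq_fun do rewrite exprS; exact: icontM.
Qed.

Lemma icont_sum a b (I : Type) (s : seq I) (f : I -> R -> C) :
  (forall i, icont a b (f i)) -> icont a b (fun t => \sum_(i <- s) f i t).
Proof.
move=> cf; elim: s => [|i s IH].
  by under eq_fun do rewrite big_nil; exact: icont_cst.
by under eq_fun do rewrite big_cons; exact: icontD.
Qed.

Lemma icont_integrable a b g : icont a b g ->
  mu.-integrable `[a, b] (EFin \o (fun t => Re (g t))) /\
  mu.-integrable `[a, b] (EFin \o (fun t => Im (g t))).
Proof.
move=> [gr gi]; split; apply: continuous_compact_integrable => //;
  exact: segment_compact.
Qed.

Lemma icont_cexpi a b : icont a b (@cexpi R).
Proof.
by split; apply: continuous_subspaceT; [exact: continuous_cos|exact: continuous_sin].
Qed.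

Lemma cintab_ext a b f g : (forall t, a <= t <= b -> f t = g t) ->
  cintab a b f = cintab a b g.
Proof.
move=> fg; apply: ccomplexP; rewrite ?Re_cintab ?Im_cintab;
by apply: eq_Rintegral => t; rewrite inE /= in_itv /= => /fg ->.
Qed.

Lemma cintabD a b f g : icont a b f -> icont a b g ->
  cintab a b (fun t => f t + g t) = cintab a b f + cintab a b g.
Proof.
move=> /icont_integrable[fr fi] /icont_integrable[gr gi].
apply: ccomplexP.
- rewrite (ReD (cintab a b f)) !Re_cintab; by under eq_Rintegral do rewrite ReD; rewrite RintegralD.
- rewrite (ImD (cintab a b f)) !Im_cintab; by under eq_Rintegral do rewrite ImD; rewrite RintegralD.
Qed.

Lemma cintabZ a b (z : C) f : icont a b f ->
  cintab a b (fun t => z * f t) = z * cintab a b f.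
Proof.
move=> cf; have [fr fi] := icont_integrable cf.
have iZ (x : R) (h : R -> R) : mu.-integrable `[a, b] (EFin \o h) ->
   mu.-integrable `[a, b] (EFin \o (fun t => x * h t)).
  move=> ih; have iZ := fun mD => @integrableZl _ _ R mu `[a, b] mD x (EFin \o h) ih.
  rewrite (_ : EFin \o _ = (fun t => x%:E * (h t)%:E)%E) //.
  by apply: iZ; exact: measurable_itv.
apply: ccomplexP.
- rewrite (ReM z (cintab a b f)) !(Re_cintab, Im_cintab); under eq_Rintegral do rewrite ReM.
  by rewrite RintegralB ?RintegralZl //; exact: iZ.
- rewrite (ImM z (cintab a b f)) !(Re_cintab, Im_cintab); under eq_Rintegral do rewrite ImM.
  by rewrite RintegralD ?RintegralZl //; exact: iZ.
Qed.

Lemma cintabN a b f : icont a b f -> cintab a b (fun t => - f t) = - cintab a b f.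
Proof.
by move=> cf; under eq_fun do rewrite -mulN1r; rewrite cintabZ // mulN1r.
Qed.

Lemma cintabB a b f g : icont a b f -> icont a b g ->
  cintab a b (fun t => f t - g t) = cintab a b f - cintab a b g.
Proof. by move=> cf cg; rewrite cintabD ?cintabN //; exact: icontN. Qed.

Lemma cintab0 a b : cintab a b (fun=> 0) = 0.
Proof.
have -> : (fun=> 0) = (fun t : R => (0 : C) * 0) by apply/funext => t; rewrite mul0r.
by rewrite cintabZ ?mul0r //; exact: icont_cst.
Qed.

Lemma cintab_sum a b (I : Type) (s : seq I) (f : I -> R -> C) :
  (forall i, icont a b (f i)) ->
  cintab a b (fun t => \sum_(i <- s) f i t) = \sum_(i <- s) cintab a b (f i).
Proof.
move=> cf; elim: s => [|i s IH].
  by under eq_fun do rewrite big_nil; rewrite cintab0 big_nil.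
under eq_fun do rewrite big_cons.
by rewrite cintabD ?IH ?big_cons //; exact: icont_sum.
Qed.

Lemma cintab_cst a b (z : C) : a <= b -> cintab a b (fun=> z) = (b - a)%:C%C * z.
Proof.
move=> ab; have E : fine (mu `[a, b]) = b - a.
  by rewrite lebesgue_measure_itv /= lte_fin; case: ltgtP ab => // -> _; rewrite subrr.
apply: ccomplexP; rewrite ?ReM ?ImM ?Re_cintab ?Im_cintab Rintegral_cst //= E;
by ring.
Qed.

(** The factor 2 comes from bounding real and imaginary parts separately. It is harmless, and is the
    source of the powers of 2 in all later integral estimates. *)
Lemma cintab_le a b f M : a <= b -> icont a b f ->
  (forall t, a <= t <= b -> cabs (f t) <= M) ->
  cabs (cintab a b f) <= 2 * (b - a) * M.
Proof.
move=> ab cf fM; have [fr fi] := icont_integrable cf.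
have E : fine (mu `[a, b]) = b - a.
  by rewrite lebesgue_measure_itv /= lte_fin; case: ltgtP ab => // -> _; rewrite subrr.
have key (h : R -> R) : mu.-integrable `[a, b] (EFin \o h) ->
    (forall t, a <= t <= b -> `|h t| <= M) -> `|Rintegral mu `[a, b] h| <= (b - a) * M.
  move=> ih hM; apply: (le_trans (le_normr_Rintegral _ ih)) => //.
  have -> : (b - a) * M = Rintegral mu `[a, b] (fun=> M) by rewrite Rintegral_cst ?E ?(mulrC M).
  apply: le_Rintegral => //.
  - exact: (integrable_norm ih).
  - by apply: continuous_compact_integrable; [exact: segment_compact|apply: cst_continuous].
apply: (le_trans (cabs_ReIm _)).
have -> : 2 * (b - a) * M = (b - a) * M + (b - a) * M by ring.
rewrite Re_cintab Im_cintab lerD //; apply: key => // t tab.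
- exact: (le_trans (cabs_Re _) (fM t tab)).
- exact: (le_trans (cabs_Im _) (fM t tab)).
Qed.

Lemma cintab_split a c b f : a <= c -> c <= b -> icont a b f ->
  cintab a b f = cintab a c f + cintab c b f.
Proof.
move=> ac cb cf; have [fr fi] := icont_integrable cf.
have key (h : R -> R) : mu.-integrable `[a, b] (EFin \o h) ->
   Rintegral mu `[a, b] h = Rintegral mu `[a, c] h + Rintegral mu `[c, b] h.
  move=> ih; apply/eqP; rewrite addrC -subr_eq; apply/eqP.
  rewrite Rintegral_itvB // ?bnd_simp // Rintegral_itv_obnd_cbnd //.
  apply: integrableS ih => //; move=> x /=; rewrite !in_itv /= => /andP[cx ->].
  by rewrite (le_trans ac (ltW cx)).
apply: ccomplexP.
- by rewrite (ReD (cintab a c f)) !Re_cintab key.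
- by rewrite (ImD (cintab a c f)) !Im_cintab key.
Qed.

(** The fundamental theorem of calculus for cos and sin. It serves m = 1, for the Lipschitz bound on
    [cexpi], and integral m, for the orthogonality of characters. *)
Lemma cintab_cexpiM_der (m a b : R) : a <= b ->
  cintab a b (fun t => m%:C%C * 'i%C * cexpi (m * t)) = cexpi (m * b) - cexpi (m * a).
Proof.
rewrite le_eqVlt => /predU1P[->|ab].
  apply: ccomplexP; rewrite ?ReB ?ImB subrr ?Re_cintab ?Im_cintab
    set_itv1 Rintegral_set1 //.
have FTC (f F : R -> R) : continuous f -> (forall x : R, is_derive x (1 : R) F (f x)) ->
    Rintegral mu `[a, b] f = F b - F a.
  move=> cf dF; rewrite /Rintegral (@continuous_FTC2 _ f F) //.
  - exact: continuous_subspaceT.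
  - have cF : continuous F.
      by move=> x; apply/differentiable_continuous/derivable1_diffP; case: (dF x).
    split; first by move=> x _; case: (dF x).
    + by apply: cvg_at_right_filter; exact: cF.
    + by apply: cvg_at_left_filter; exact: cF.
  - by move=> x _; rewrite derive1E; case: (dF x).
have dm (x : R) : is_derive x (1 : R) (fun t : R => m * t) m.
  have := @is_deriveZ R R^o R^o id m x 1 1 _; rewrite /GRing.scale /= mulr1; exact.
have cm : continuous (fun t : R => m * t) by move=> x; apply: cvgM; [exact: cvg_cst|exact: cvg_id].
apply: ccomplexP; rewrite ?ReB ?ImB ?Re_cintab ?Im_cintab.
- rewrite -[RHS](FTC (fun t => - sin (m * t) * m) (fun t => cos (m * t))) //.
  + by apply: eq_Rintegral => t _; rewrite !(ReM, ImM) /=; ring.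
  + move=> x; apply: cvgM; last exact: cvg_cst.
    by apply: cvgN; apply: (continuous_comp (cm x)); exact: continuous_sin.
- rewrite -[RHS](FTC (fun t => cos (m * t) * m) (fun t => sin (m * t))) //.
  + by apply: eq_Rintegral => t _; rewrite !(ReM, ImM) /=; ring.
  + move=> x; apply: cvgM; last exact: cvg_cst.
    by apply: (continuous_comp (cm x)); exact: continuous_cos.
Qed.

Lemma cintab_cexpi_der a b : a <= b ->
  cintab a b (fun t => 'i%C * cexpi t) = cexpi b - cexpi a.
Proof.
move=> ab; have := cintab_cexpiM_der 1 ab; rewrite !mul1r => <-.
by congr cintab; apply/funext => t; rewrite !mul1r.
Qed.

Lemma cexpiV (t : R) : (cexpi t)^-1 = cexpi (- t) :> C.
Proof.
apply: (mulfI (cexpi_neq0 t)); rewrite divff ?cexpi_neq0 //.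
by rewrite -cexpiD subrr cexpi0.
Qed.

Lemma cexpiMn (t : R) n : cexpi (n%:R * t) = cexpi t ^+ n :> C.
Proof.
elim: n => [|n IH]; first by rewrite mul0r cexpi0.
by rewrite exprS -IH -cexpiD; congr cexpi; rewrite -natr1; ring.
Qed.

Lemma cexpiMz (t : R) (m : int) : cexpi (m%:~R * t) = cexpi t ^ m :> C.
Proof.
case: m => n; first exact: cexpiMn.
by rewrite NegzE -exprz_inv -[in RHS]exprnP cexpiV -cexpiMn; congr cexpi; rewrite rmorphN /=; ring.
Qed.

(** For m <> 0 multiplication by i m turns the integrand into a derivative, and [cexpi] takes the
    same value at both ends. *)
Lemma cint_cexpiz (m : int) :
  cint (fun t => cexpi t ^ m) = if m == 0 then (pi *+ 2)%:C%C else 0 :> C.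
Proof.
have pi2 : 0 <= pi *+ 2 :> R by rewrite mulrn_wge0 // pi_ge0.
rewrite cintE; have [->|m0] := eqVneq m 0.
  by rewrite cintab_cst // subr0 mulr1.
have mi0 : (m%:~R : R)%:C%C * 'i%C != 0 :> C.
  by rewrite -cabs_gt0 cabsM cabs_real cabsI mulr1 normr_gt0 intr_eq0.
apply: (mulfI mi0); rewrite mulr0 -cintabZ; last first.
  under eq_fun do rewrite -cexpiMz.
  have cm : continuous (fun t : R => m%:~R * t) by move=> x; apply: cvgM; [exact: cvg_cst|exact: cvg_id].
  split; apply: continuous_subspaceT => x; apply: (continuous_comp (cm x)).
    exact: continuous_cos.
  exact: continuous_sin.
under eq_fun do rewrite -cexpiMz.
rewrite (cintab_cexpiM_der _ pi2) mulr0 cexpi0 cexpiMz cexpi2pi exp1rz.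
exact: subrr.
Qed.

End ComplexIntegral.

(** * Continuity of complex-valued functions, stated with the real modulus *)

Section ComplexContinuity.
Variable R : realType.
Local Notation C := (CC R).

Lemma cvgC_eps (T : Type) (F : set_system T) (FF : Filter F) (g : T -> C) (l : C) :
  (g @ F --> l) <-> (forall e : R, 0 < e -> \forall t \near F, cabs (l - g t) < e).
Proof.
split=> [/cvgrPdist_lt H e e0|H].
  have /H : (0 : R[i]) < e%:C%C by rewrite ltcR.
  by apply: filterS => t; rewrite normE ltcR.
apply/cvgrPdist_lt => e e0.
have eE : e = (complex.Re e)%:C%C by apply/esym/RRe_real; rewrite realE ltW.
move: e0; rewrite eE ltcR => /H; apply: filterS => t.
by rewrite normE ltcR.
Qed.

Lemma continuousC_eps (V : topologicalType) (g : V -> C) (x : V) :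
  {for x, continuous g} <->
  (forall e : R, 0 < e -> \forall t \near x, cabs (g x - g t) < e).
Proof. exact: cvgC_eps. Qed.

Lemma nearC_eps (z : C) (P : C -> Prop) :
  (\forall w \near z, P w) <->
  exists2 d : R, 0 < d & forall w, cabs (z - w) < d -> P w.
Proof.
split=> [/nbhs_ballP[e /= e0 He]|[d d0 Hd]].
  have eE : e = (complex.Re e)%:C%C by apply/esym/RRe_real; rewrite realE ltW.
  exists (complex.Re e); first by rewrite -ltcR -eE.
  by move=> w wz; apply: He; rewrite -ball_normE /= normE eE ltcR.
apply/nbhs_ballP; exists d%:C%C => /=; first by rewrite ltcR.
by move=> w; rewrite -ball_normE /= normE ltcR; apply: Hd.
Qed.

Lemma continuous_RtoC : continuous (fun t : R => t%:C%C : C).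
Proof.
move=> x; apply/continuousC_eps => e e0.
near=> t; rewrite -[X in cabs X](rmorphB (real_complex R)) cabs_real.
by near: t; apply: cvgr_dist_lt.
Unshelve. all: by end_near. Qed.

(** The difference is the integral of a derivative of modulus 1; the 2 is that of [cintab_le]. *)
Lemma cexpi_lip (a b : R) : cabs (cexpi a - cexpi b : C) <= 2 * `|a - b|.
Proof.
wlog ab : a b / a <= b.
  by move=> W; case: (leP a b) => [|/ltW] /W //; rewrite cabsB distrC.
rewrite cabsB distrC ger0_norm ?subr_ge0 // -cintab_cexpi_der //.
rewrite -[X in _ <= X]mulr1; apply: cintab_le => //.
  by apply: icontM; [exact: icont_cst|exact: icont_cexpi].
by move=> t _; rewrite cabsM cabs_cexpi mulr1 cabsI.
Qed.

Lemma continuous_cexpi : continuous (@cexpi R).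
Proof.
move=> x; apply/continuousC_eps => e e0; near=> t.
apply: (le_lt_trans (cexpi_lip _ _)); rewrite -ltr_pdivlMl //.
by near: t; apply: cvgr_dist_lt => //; rewrite mulr_gt0 // invr_gt0.
Unshelve. all: by end_near. Qed.

Lemma icont_continuous (a b : R) (g : R -> C) :
  (forall t, a <= t <= b -> {for t, continuous g}) -> icont a b g.
Proof.
move=> cg; apply: icont_eps => x xab e e0.
have /continuousC_eps/(_ e e0)/nbhs_ballP[d /= d0 Hd] := cg x xab.
by exists d => // y _ xy; apply: Hd; rewrite -ball_normE.
Qed.

Lemma continuousCV (V : topologicalType) (g : V -> C) (x : V) : g x != 0 ->
  {for x, continuous g} -> {for x, continuous (fun t => (g t)^-1 : C)}.
Proof.
move=> gx0 cg; apply/continuousC_eps => e e0.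
have m0 : 0 < cabs (g x) by rewrite cabs_gt0.
have d0 : 0 < Num.min (cabs (g x) / 2) (e * (cabs (g x) ^+ 2 / 2)).
  by rewrite lt_min !(mulr_gt0, divr_gt0, exprn_gt0).
have /continuousC_eps/(_ _ d0) := cg.
apply: filterS => t; rewrite lt_min => /andP[h1 h2].
have gt2 : cabs (g x) / 2 < cabs (g t).
  have := cabsD (g x - g t) (g t); rewrite subrK; lra.
have gt0 : g t != 0 by rewrite -cabs_gt0; apply: lt_trans gt2; rewrite divr_gt0.
have -> : (g x)^-1 - (g t)^-1 = (g t - g x) * ((g x)^-1 * (g t)^-1) :> C.
  by field; rewrite gx0 gt0.
have m1 : 0 < cabs (g t) by rewrite cabs_gt0.
rewrite !cabsM !cabsV cabsB -invfM ltr_pdivrMr ?mulr_gt0 //.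
apply: (lt_le_trans h2); rewrite ler_pM2l // expr2 -mulrA ler_pM2l //.
exact: ltW.
Qed.

End ComplexContinuity.

(* Goursat's bisection, for an arbitrary additive function [mu] of rectangles. *)
Section Goursat.
Variable R : realType.
Local Notation C := (CC R).
Variables (mu : R -> R -> R -> R -> C) (a b c d : R).
Hypotheses (ab : a <= b) (cd : c <= d).
Hypothesis muX : forall x1 x x2 y1 y2, a <= x1 -> x1 <= x -> x <= x2 -> x2 <= b ->
  c <= y1 -> y1 <= y2 -> y2 <= d -> mu x1 x2 y1 y2 = mu x1 x y1 y2 + mu x x2 y1 y2.
Hypothesis muY : forall x1 x2 y1 y y2, a <= x1 -> x1 <= x2 -> x2 <= b ->
  c <= y1 -> y1 <= y -> y <= y2 -> y2 <= d -> mu x1 x2 y1 y2 = mu x1 x2 y1 y + mu x1 x2 y y2.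
Hypothesis mu_small : forall x y, a <= x <= b -> c <= y <= d -> forall e, 0 < e ->
  exists2 del, 0 < del & forall x1 x2 y1 y2, a <= x1 -> x1 <= x -> x <= x2 -> x2 <= b ->
    c <= y1 -> y1 <= y -> y <= y2 -> y2 <= d -> x2 - x1 < del -> y2 - y1 < del ->
    cabs (mu x1 x2 y1 y2) <= e * ((x2 - x1) + (y2 - y1)) ^+ 2.

Let rect := (R * R * (R * R))%type.
Let val (q : rect) := cabs (mu q.1.1 q.1.2 q.2.1 q.2.2).
Let mid (u : R * R) := (u.1 + u.2) / 2.
Let lo (u : R * R) := (u.1, mid u).
Let hi (u : R * R) := (mid u, u.2).
Let next (q : rect) : rect :=
  if val q <= val (lo q.1, lo q.2) *+ 4 then (lo q.1, lo q.2) else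
  if val q <= val (lo q.1, hi q.2) *+ 4 then (lo q.1, hi q.2) else
  if val q <= val (hi q.1, lo q.2) *+ 4 then (hi q.1, lo q.2) else (hi q.1, hi q.2).
Let ok (q : rect) := [/\ a <= q.1.1, q.1.1 <= q.1.2, q.1.2 <= b &
                        [/\ c <= q.2.1, q.2.1 <= q.2.2 & q.2.2 <= d]].

Let next_ok q : ok q -> [/\ ok (next q), val q <= val (next q) *+ 4,
   [/\ q.1.1 <= (next q).1.1, (next q).1.2 <= q.1.2,
       q.2.1 <= (next q).2.1 & (next q).2.2 <= q.2.2],
   (next q).1.2 - (next q).1.1 = (q.1.2 - q.1.1) / 2 &
   (next q).2.2 - (next q).2.1 = (q.2.2 - q.2.1) / 2].
Proof.
case: q => [[x1 x2] [y1 y2]] [/= ax xx xb [cy yy yd]].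
rewrite /next; case: ifP => h1; last case: ifP => h2; last case: ifP => h3;
rewrite /ok /lo /hi /mid /=; split=> //; try (by repeat split => //=; lra); try lra.
(* Three quarters have failed the test. Were the fourth too small as well, additivity and the
   triangle inequality would make the value on the whole rectangle smaller than itself. *)
move: h1 h2 h3 => /negbT; rewrite -ltNge => h1 /negbT; rewrite -ltNge => h2 /negbT; rewrite -ltNge => h3.
rewrite leNgt; apply/negP => h4.
move: h1 h2 h3 h4; rewrite /val /lo /hi /mid /=.
rewrite (@muX x1 ((x1 + x2) / 2) x2 y1 y2) //; try lra.
rewrite (@muY x1 ((x1 + x2) / 2) y1 ((y1 + y2) / 2) y2) //; try lra.
rewrite (@muY ((x1 + x2) / 2) x2 y1 ((y1 + y2) / 2) y2) //; try lra.
set A := mu _ _ _ _; set B := mu _ _ _ _; set D := mu _ _ _ _; set E := mu _ _ _ _.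
have := cabsD (A + B) (D + E); have := cabsD A B; have := cabsD D E; lra.
Qed.

Let Q k : rect := iter k next ((a, b), (c, d)).

Let Q_ok k : [/\ ok (Q k), val (Q 0) <= val (Q k) * 4 ^+ k,
   (Q k).1.2 - (Q k).1.1 = (b - a) / 2 ^+ k & (Q k).2.2 - (Q k).2.1 = (d - c) / 2 ^+ k].
Proof.
elim: k => [|k [okk vk xk yk]].
  by rewrite !expr0 !divr1 mulr1; split.
have [okn v _ x y] := next_ok okk; change (Q k.+1) with (next (Q k)); split => //.
- apply: (le_trans vk); rewrite exprS mulrA ler_pM2r ?exprn_gt0 //.
  by rewrite mulr_natr.
- by rewrite x xk exprS invfM; ring.
- by rewrite y yk exprS invfM; ring.
Qed.

Let Q_mono k j : [/\ (Q k).1.1 <= (Q (k + j)).1.1, (Q (k + j)).1.2 <= (Q k).1.2,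
   (Q k).2.1 <= (Q (k + j)).2.1 & (Q (k + j)).2.2 <= (Q k).2.2].
Proof.
elim: j => [|j [h1 h2 h3 h4]]; first by rewrite addn0.
have [okk _ _ _] := Q_ok (k + j).
have [_ _ [g1 g2 g3 g4] _ _] := next_ok okk; rewrite addnS /Q iterS -/(Q (k + j)).
by split; [exact: le_trans h1 g1|exact: le_trans g2 h2|exact: le_trans h3 g3|exact: le_trans g4 h4].
Qed.

Let nested (l u : nat -> R) : (forall k j, l k <= l (k + j)%N /\ u (k + j)%N <= u k) ->
  (forall k, l k <= u k) -> exists x, forall k, l k <= x <= u k.
Proof.
move=> mono lu; have lu' i j : l i <= u j.
  have [h1 _] := mono i j; have [_ h2] := mono j i.
  by apply: (le_trans h1); apply: (le_trans (lu _)); rewrite addnC.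
exists (sup (range l)) => k; apply/andP; split.
  apply: ub_le_sup; last by exists k.
  by exists (u 0) => _ [j _ <-].
by apply: ge_sup; [exists (l 0), 0|move=> _ [j _ <-]].
Qed.

Lemma additive_rect_eq0 : mu a b c d = 0.
Proof.
have [x Hx] : exists x, forall k, (Q k).1.1 <= x <= (Q k).1.2.
  apply: (nested (l := fun k => (Q k).1.1)) => [k j|k].
    by have [? ? ? ?] := Q_mono k j.
  by have [[? ? ? [? ? ?]] _ _ _] := Q_ok k.
have [y Hy] : exists y, forall k, (Q k).2.1 <= y <= (Q k).2.2.
  apply: (nested (l := fun k => (Q k).2.1)) => [k j|k].
    by have [? ? ? ?] := Q_mono k j.
  by have [[? ? ? [? ? ?]] _ _ _] := Q_ok k.
apply: cabs0P; apply/eqP/negPn/negP => m0.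
have {}m0 : 0 < cabs (mu a b c d) by rewrite lt_def m0 cabs_ge0.
set m := cabs _ in m0; set L := (b - a) + (d - c).
have L0 : 0 <= L by rewrite /L addr_ge0 ?subr_ge0.
(* At step k the estimate gives m <= 4^k e (L / 2^k)^2 = e L^2, which this e makes less than m. The
   added 1 keeps the quotient meaningful when L = 0. *)
have e0 : 0 < m / (L ^+ 2 + 1) by rewrite divr_gt0 // ltr_wpDl ?sqr_ge0.
have [del del0 Hdel] := mu_small (Hx 0) (Hy 0) e0.
have [k kdel] : exists k, L / 2 ^+ k < del.
  have [k hk] : exists k : nat, L / del < k%:R.
    by exists (Num.bound (L / del)); apply: archi_boundP; rewrite divr_ge0 // ltW.
  exists k; rewrite ltr_pdivrMr ?exprn_gt0 // -ltr_pdivrMl // mulrC.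
  apply: (lt_trans hk); rewrite -natrX ltr_nat; exact: ltn_expl.
have [[h1 h2 h3 [h4 h5 h6]] hv hx hy] := Q_ok k.
have /andP[hx1 hx2] := Hx k; have /andP[hy1 hy2] := Hy k.
have p2 : (0 : R) < 2 ^+ k by rewrite exprn_gt0.
have Lx : (b - a) / 2 ^+ k <= L / 2 ^+ k.
  by rewrite ler_pM2r ?invr_gt0 // /L lerDl subr_ge0.
have Ly : (d - c) / 2 ^+ k <= L / 2 ^+ k.
  by rewrite ler_pM2r ?invr_gt0 // /L lerDr subr_ge0.
have := Hdel _ _ _ _ h1 hx1 hx2 h3 h4 hy1 hy2 h6.
rewrite hx hy => /(_ (le_lt_trans Lx kdel) (le_lt_trans Ly kdel)).
rewrite -mulrDl -/L expr_div_n => hm.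
have := le_lt_trans hv; rewrite -/m => /(_ m); rewrite ltxx => H; apply: notF; apply: H.
have -> : (4 : R) ^+ k = (2 ^+ k) ^+ 2 by rewrite -exprM mulnC exprM; congr (_ ^+ _); ring.
rewrite -ltr_pdivlMr ?exprn_gt0 //; apply: (le_lt_trans hm).
rewrite mulrA ltr_pM2r ?invr_gt0 ?exprn_gt0 // mulrAC ltr_pdivrMr; last first.
  by rewrite ltr_wpDl ?sqr_ge0.
by rewrite ltr_pM2l // ltrDl.
Qed.

End Goursat.

(** * Cauchy's integral formula *)

Section Cauchy.
Variable R : realType.
Local Notation C := (CC R).
Implicit Types (f : C -> C).

(** Complex differentiability at one point, with no continuity of the derivative: this is why
    Cauchy's theorem goes through Goursat's bisection. *)
Definition cdiff f (z : C) := exists l : C, forall e : R, 0 < e ->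
  exists2 d : R, 0 < d & forall w, cabs (z - w) < d ->
    cabs (f w - f z - l * (w - z)) <= e * cabs (w - z).

Lemma cdiff_continuous f z : cdiff f z -> {for z, continuous f}.
Proof.
move=> [l Hl]; apply/continuousC_eps => e e0.
have [d d0 Hd] := Hl 1 ltr01.
have l0 : 0 < cabs l + 1 by rewrite ltr_wpDl ?cabs_ge0.
apply/nearC_eps; exists (Num.min d (e / (cabs l + 1))); first by rewrite lt_min d0 divr_gt0.
move=> w; rewrite lt_min => /andP[/Hd h]; rewrite ltr_pdivlMr // => we.
apply: le_lt_trans we.
rewrite cabsB (_ : f w - f z = (f w - f z - l * (w - z)) + l * (w - z)); last by ring.
apply: (le_trans (cabsD _ _)); rewrite cabsM (cabsB z w).
by rewrite [X in _ <= X]mulrC mulrDl mul1r; move: h; rewrite mul1r; lra.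
Qed.

Lemma cauchy_kernel_bound (r : R) (a : C) (t : R) : cabs a < r ->
  r%:C%C * cexpi t - a != 0 :> C /\
  cabs (r%:C%C * cexpi t / (r%:C%C * cexpi t - a)) <= r / (r - cabs a).
Proof.
move=> ar; have r0 : 0 < r by exact: le_lt_trans (cabs_ge0 _) ar.
have wE : cabs (r%:C%C * cexpi t : C) = r by rewrite cabsM cabs_real cabs_cexpi mulr1 gtr0_norm.
have lb : r - cabs a <= cabs (r%:C%C * cexpi t - a : C).
  by rewrite lerBlDr -{1}wE; apply: (le_trans _ (cabsD _ _)); rewrite subrK.
have p0 : 0 < r - cabs a by rewrite subr_gt0.
split; first by rewrite -cabs_gt0; exact: lt_le_trans lb.
rewrite cabsM wE cabsV ler_pM2l // lef_pV2 // posrE //; exact: lt_le_trans lb.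
Qed.

Lemma icont_circle (r a b : R) : icont a b (fun t => r%:C%C * cexpi t : C).
Proof. by apply: icontM; [exact: icont_cst|exact: icont_cexpi]. Qed.

Lemma continuous_circle (r : R) : continuous (fun t => r%:C%C * cexpi t : C).
Proof. by move=> x; apply: cvgM; [exact: cvg_cst|exact: continuous_cexpi]. Qed.

Lemma continuous_kernel (r : R) (a : C) : cabs a < r ->
  continuous (fun t => r%:C%C * cexpi t / (r%:C%C * cexpi t - a) : C).
Proof.
move=> ar x; apply: cvgM; first exact: continuous_circle.
apply: (@continuousCV _ _ (fun t => r%:C%C * cexpi t - a)).
  by have [] := cauchy_kernel_bound x ar.
by apply: cvgB; [exact: continuous_circle|exact: cvg_cst].
Qed.

Section Homotopy.
Variables (f : C -> C) (r : R) (a : C).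
Hypotheses (fdiff : forall z, cdiff f z) (ar : cabs a < r).

Let r0 : 0 < r. Proof. exact: le_lt_trans (cabs_ge0 _) ar. Qed.
Let w (t : R) : C := r%:C%C * cexpi t.
Let z (x t : R) : C := a + x%:C%C * (w t - a).
Let beta (t : R) : C := w t / (w t - a).
Let B := r / (r - cabs a).

Let B0 : 0 <= B.
Proof. by rewrite divr_ge0 ?subr_ge0 // ltW. Qed.

Let cf : continuous f.
Proof. by move=> u; exact: cdiff_continuous. Qed.

Let czt x : continuous (z x).
Proof.
move=> t; apply: cvgD; first exact: cvg_cst.
apply: cvgM; first exact: cvg_cst.
by apply: cvgB; [exact: continuous_circle|exact: cvg_cst].
Qed.

Let czx t : continuous (z ^~ t).
Proof.
move=> x; apply: cvgD; first exact: cvg_cst.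
by apply: cvgM; [exact: continuous_RtoC|exact: cvg_cst].
Qed.

Let cfzt x : continuous (fun t => f (z x t)).
Proof. by move=> t; apply: (continuous_comp (@czt x t)); exact: cf. Qed.

Let cfzx t : continuous (fun x => f (z x t)).
Proof. by move=> x; apply: (continuous_comp (@czx t x)); exact: cf. Qed.

Let wa_le t : cabs (w t - a) <= 2 * r.
Proof.
apply: (le_trans (cabsD _ _)); rewrite cabsN cabsM cabs_real cabs_cexpi mulr1 gtr0_norm //.
by move: (ltW ar); lra.
Qed.

(* The integral of [f u / (u - a)] along the image under [z] of the boundary of the
   rectangle [x1, x2] * [y1, y2]: on it [du / (u - a)] is ['i * beta t] [dt] at fixed [x]
   and [dx / x] at fixed [t]. *)
Let K (x1 x2 y1 y2 : R) : C :=
  cintab y1 y2 (fun t => (f (z x2 t) - f (z x1 t)) * ('i%C * beta t)) -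
  cintab x1 x2 (fun x => (f (z x y2) - f (z x y1)) * (x^-1)%:C%C).

Let ic1 x1 x2 y1 y2 : icont y1 y2 (fun t => (f (z x2 t) - f (z x1 t)) * ('i%C * beta t)).
Proof.
apply: icontM; first by apply: icontB; apply: icont_continuous => t _; exact: cfzt.
by apply: icontM; [exact: icont_cst|apply: icont_continuous => t _; exact: continuous_kernel].
Qed.

Let icV x1 x2 : 0 < x1 -> icont x1 x2 (fun x => (x^-1)%:C%C : C).
Proof.
move=> x10; apply: icont_continuous => x /andP[x1x _].
have x0 : 0 < x by exact: lt_le_trans x1x.
rewrite (_ : (fun x => _) = (fun x : R => (x%:C%C)^-1 : C)); last first.
  by apply/funext => y; rewrite -[RHS]fmorphV.
apply: continuousCV; last exact: continuous_RtoC.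
by rewrite -cabs_gt0 cabs_real normr_gt0 gt_eqF.
Qed.

Let ic2 x1 x2 y1 y2 : 0 < x1 -> icont x1 x2 (fun x => (f (z x y2) - f (z x y1)) * (x^-1)%:C%C).
Proof.
move=> x10; apply: icontM; last exact: icV.
by apply: icontB; apply: icont_continuous => t _; exact: cfzx.
Qed.

(** Near a point of the rectangle f is replaced by its affine approximation, whose boundary integral
    is exactly 0; the remainder [g] is o(D), and so contributes o(D^2). Staying at x >= s keeps the
    factor 1/x bounded. *)
Let K_eq0 (s : R) : 0 < s -> s <= 1 -> K s 1 0 (pi *+ 2) = 0.
Proof.
move=> s0 s1; apply: additive_rect_eq0 => //; first by rewrite mulrn_wge0 // pi_ge0.
- move=> x1 x x2 y1 y2 sx1 x1x xx2 _ _ y12 _; rewrite /K.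
  rewrite (@cintab_split _ x1 x x2) //; last by apply: ic2; exact: lt_le_trans sx1.
  set I1 := cintab x1 x _; set I2 := cintab x x2 _.
  rewrite (_ : (fun t => (f (z x2 t) - f (z x1 t)) * _) =
    (fun t => (f (z x t) - f (z x1 t)) * ('i%C * beta t) +
              (f (z x2 t) - f (z x t)) * ('i%C * beta t))); last first.
    by apply/funext => t; ring.
  by rewrite cintabD //; ring.
- move=> x1 x2 y1 y y2 sx1 x12 _ _ y1y yy2 _; rewrite /K.
  have x10 : 0 < x1 by exact: lt_le_trans sx1.
  rewrite (@cintab_split _ y1 y y2) //.
  set I1 := cintab y1 y _; set I2 := cintab y y2 _.
  rewrite (_ : (fun x => (f (z x y2) - f (z x y1)) * _) =
    (fun x => (f (z x y) - f (z x y1)) * (x^-1)%:C%C +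
              (f (z x y2) - f (z x y)) * (x^-1)%:C%C)); last first.
    by apply/funext => t; ring.
  by rewrite cintabD //; [ring|exact: ic2|exact: ic2].
move=> x0 y0 /andP[sx0 x01] _ e e0.
have [l Hl] := fdiff (z x0 y0).
set M := 8 * r * (B + s^-1).
have M0 : 0 < M by rewrite /M !mulr_gt0 // ltr_wpDl // invr_gt0.
have [d d0 Hd] := Hl (e / M) (divr_gt0 e0 M0).
(* With both sides shorter than d / (4 r), 2 r D < d, so the whole image lies where the affine
   approximation is valid. *)
exists (d / (4 * r)); first by rewrite divr_gt0 // mulr_gt0.
move=> x1 x2 y1 y2 sx1 x1x0 x0x2 x21 _ y1y0 y0y2 _ hx hy.
have x10 : 0 < x1 by exact: lt_le_trans sx1.
have x12 := le_trans x1x0 x0x2; have y12 := le_trans y1y0 y0y2.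
set D := x2 - x1 + (y2 - y1).
have D0 : 0 <= D by rewrite addr_ge0 ?subr_ge0.
pose g x t := f (z x t) - f (z x0 y0) - l * (z x t - z x0 y0).
have zle x t : x1 <= x <= x2 -> y1 <= t <= y2 -> cabs (z x t - z x0 y0) <= 2 * r * D.
  move=> /andP[hx1 hx2] /andP[ht1 ht2].
  have -> : z x t - z x0 y0 = (x%:C%C - x0%:C%C) * (w t - a) + x0%:C%C * (r%:C%C * (cexpi t - cexpi y0)).
    by rewrite /z /w; ring.
  apply: (le_trans (cabsD _ _)); rewrite !cabsM cabs_realB !cabs_real /D mulrDr.
  have h1 : `|x - x0| <= x2 - x1 by rewrite ler_norml; lra.
  have h2 : `|t - y0| <= y2 - y1 by rewrite ler_norml; lra.
  apply: lerD.
    by rewrite mulrC ler_pM // ?cabs_ge0.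
  rewrite (gtr0_norm r0) (gtr0_norm (lt_le_trans s0 sx0)) (mulrC 2 r) -mulrA.
  rewrite -[X in _ <= X]mul1r ler_pM //; first exact: (ltW (lt_le_trans s0 sx0)).
    by rewrite mulr_ge0 ?cabs_ge0 // ltW.
  rewrite ler_pM2l //; apply: (le_trans (cexpi_lip _ _)).
  by rewrite ler_pM2l.
have gle x t : x1 <= x <= x2 -> y1 <= t <= y2 -> cabs (g x t) <= e / M * (2 * r * D).
  move=> hx' ht'; have zD := zle x t hx' ht'.
  have : cabs (z x0 y0 - z x t) < d.
    rewrite cabsB; apply: (le_lt_trans zD).
    move: hx hy; rewrite !ltr_pdivlMr ?mulr_gt0 // /D => hx hy.
    have -> : 2 * r * (x2 - x1 + (y2 - y1)) = ((x2 - x1) * (4 * r) + (y2 - y1) * (4 * r)) / 2 by field.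
    by rewrite ltr_pdivrMr //; lra.
  move=> /Hd h; apply: (le_trans h); rewrite ler_pM2l // divr_gt0 //.
have ew2 := @cintab_cexpi_der R y1 y2 y12.
have wa0 t : w t - a != 0 by have [] := cauchy_kernel_bound t ar.
have cg1 x : icont y1 y2 (g x).
  apply: icontB; first by apply: icontB; [apply: icont_continuous => t _; exact: cfzt|exact: icont_cst].
  apply: icontM; first exact: icont_cst.
  by apply: icontB; [apply: icont_continuous => t _; exact: czt|exact: icont_cst].
have cg2 t : icont x1 x2 (g ^~ t).
  apply: icontB; first by apply: icontB; [apply: icont_continuous => x _; exact: cfzx|exact: icont_cst].
  apply: icontM; first exact: icont_cst.
  by apply: icontB; [apply: icont_continuous => x _; exact: czx|exact: icont_cst].
have cb : icont y1 y2 beta.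
  by apply: icont_continuous => t _; exact: continuous_kernel.
have cib : icont y1 y2 (fun t => 'i%C * beta t) by apply: icontM => //; exact: icont_cst.
(* The linear part contributes the same term to both integrals of [K] (here and in [E2]), and these
   terms cancel. *)
have E1 : cintab y1 y2 (fun t => (f (z x2 t) - f (z x1 t)) * ('i%C * beta t)) =
  l * (x2 - x1)%:C%C * r%:C%C * (cexpi y2 - cexpi y1) +
  cintab y1 y2 (fun t => (g x2 t - g x1 t) * ('i%C * beta t)).
  rewrite -ew2 -cintabZ; last by apply: icontM; [exact: icont_cst|exact: icont_cexpi].
  rewrite -cintabD; first last.
  - by apply: icontM => //; exact: icontB.
  - apply: icontM; first exact: icont_cst.
    by apply: icontM; [exact: icont_cst|exact: icont_cexpi].
  congr cintab; apply/funext => t.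
  by have := wa0 t; rewrite rmorphB /g /beta /z /w /= => wa; field.
have E2 : cintab x1 x2 (fun x => (f (z x y2) - f (z x y1)) * (x^-1)%:C%C) =
  l * (x2 - x1)%:C%C * r%:C%C * (cexpi y2 - cexpi y1) +
  cintab x1 x2 (fun x => (g x y2 - g x y1) * (x^-1)%:C%C).
  have -> : l * (x2 - x1)%:C%C * r%:C%C * (cexpi y2 - cexpi y1) =
     cintab x1 x2 (fun=> l * r%:C%C * (cexpi y2 - cexpi y1)).
    by rewrite cintab_cst //; ring.
  rewrite -cintabD; first last.
  - by apply: icontM; [exact: icontB|exact: icV].
  - exact: icont_cst.
  apply: cintab_ext => x /andP[x1x _].
  have xn0 : x%:C%C != 0 :> C.
    by rewrite -cabs_gt0 cabs_real normr_gt0 gt_eqF // (lt_le_trans x10).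
  have -> : (x^-1)%:C%C = (x%:C%C)^-1 :> C by rewrite -[RHS]fmorphV.
  by rewrite /g /z /w; field.
rewrite /K E1 E2 opprD addrACA subrr add0r.
apply: (le_trans (cabsD _ _)); rewrite cabsN.
have y1i : y1 <= y1 <= y2 by rewrite lexx.
have y2i : y1 <= y2 <= y2 by rewrite lexx andbT.
have x1i : x1 <= x1 <= x2 by rewrite lexx.
have x2i : x1 <= x2 <= x2 by rewrite lexx andbT.
have c0 : 0 <= e / M * (2 * r * D) by apply: (le_trans (cabs_ge0 _) (gle _ _ x1i y1i)).
have b1 : cabs (cintab y1 y2 (fun t => (g x2 t - g x1 t) * ('i%C * beta t))) <=
    2 * (y2 - y1) * ((e / M * (2 * r * D) + e / M * (2 * r * D)) * B).
  apply: cintab_le => //; first by apply: icontM => //; exact: icontB.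
  move=> t ht; rewrite cabsM (cabsM 'i%C) cabsI mul1r; apply: ler_pM; rewrite ?cabs_ge0 //.
    by apply: (le_trans (cabsD _ _)); rewrite cabsN lerD // gle.
  by have [_] := cauchy_kernel_bound t ar.
have b2 : cabs (cintab x1 x2 (fun x => (g x y2 - g x y1) * (x^-1)%:C%C)) <=
    2 * (x2 - x1) * ((e / M * (2 * r * D) + e / M * (2 * r * D)) * s^-1).
  apply: cintab_le => //; first by apply: icontM; [exact: icontB|exact: icV].
  move=> x hx'; rewrite cabsM; apply: ler_pM; rewrite ?cabs_ge0 //.
    by apply: (le_trans (cabsD _ _)); rewrite cabsN lerD // gle.
  have /andP[x1x _] := hx'.
  rewrite cabs_real ger0_norm ?invr_ge0; last by rewrite ltW // (lt_le_trans x10).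
  by rewrite lef_pV2 ?posrE // ?(lt_le_trans x10) // (le_trans sx1).
apply: (le_trans (lerD b1 b2)).
have -> : e * D ^+ 2 = e / M * (2 * r * D) * (4 * (B + s^-1)) * D.
  rewrite /M; field; rewrite gt_eqF //= (gt_eqF r0) /=.
  have : 0 < B * s + 1 by rewrite ltr_wpDl // mulr_ge0 // ltW.
  by move=> /gt_eqF ->.
set Q := e / M * (2 * r * D).
have -> : 2 * (y2 - y1) * ((Q + Q) * B) + 2 * (x2 - x1) * ((Q + Q) * s^-1) =
   Q * 4 * ((y2 - y1) * B + (x2 - x1) * s^-1) by ring.
have -> : Q * (4 * (B + s^-1)) * D = Q * 4 * ((B + s^-1) * D) by ring.
apply: ler_wpM2l; first by rewrite mulr_ge0.
have si : 0 <= s^-1 by rewrite invr_ge0 ltW.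
have h1 : 0 <= (y2 - y1) * s^-1 by rewrite mulr_ge0 // subr_ge0.
have h2 : 0 <= (x2 - x1) * B by rewrite mulr_ge0 // subr_ge0.
by rewrite /D; lra.
Qed.

(** The circle is contracted onto a. The loop integral [J x] is constant on ]0, 1], because the two
    sides t = 0 and t = 2 pi of the rectangle have the same image, and by continuity of f it tends
    to f(a) times the integral of [beta] as x -> 0. *)
Lemma cauchy_circle_const :
  cint (fun t => f (w t) * beta t) = f a * cint beta.
Proof.
have pi2 : 0 <= pi *+ 2 :> R by rewrite mulrn_wge0 // pi_ge0.
have cb u v : icont u v beta.
  by apply: icont_continuous => t _; exact: continuous_kernel.
have cz x u v : icont u v (fun t => f (z x t)).
  by apply: icont_continuous => t _; exact: cfzt.
pose J x := cint (fun t => f (z x t) * beta t).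
have JE s : 0 < s -> s <= 1 -> J s = J 1.
  move=> s0 s1; have := K_eq0 s0 s1; rewrite /K.
  have -> : (fun x => (f (z x (pi *+ 2)) - f (z x 0)) * (x^-1)%:C%C) = (fun=> 0).
    by apply/funext => x; rewrite /z /w cexpi2pi cexpi0 subrr mul0r.
  rewrite cintab0 subr0.
  have -> : (fun t => (f (z 1 t) - f (z s t)) * ('i%C * beta t)) =
     (fun t => 'i%C * (f (z 1 t) * beta t - f (z s t) * beta t)).
    by apply/funext => t; ring.
  rewrite cintabZ; last by apply: icontB; apply: icontM.
  rewrite cintabB; try by apply: icontM.
  move=> /eqP; rewrite mulf_eq0 -[X in X || _]negbK -cabs_gt0 cabsI ltr01 /= subr_eq0.
  by rewrite /J !cintE => /eqP ->.
have J1 : J 1 = cint (fun t => f (w t) * beta t).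
  by congr cint; apply/funext => t; rewrite /z mul1r addrC subrK.
apply/eqP; rewrite -J1 -subr_eq0; apply/eqP; apply: cabs0P; apply/eqP.
rewrite eq_le cabs_ge0 andbT; apply/ler_addgt0Pl => e e0; rewrite addr0.
pose c := 2 * (pi *+ 2) * (B + 1) : R.
have c0 : 0 < c by apply: mulr_gt0; [apply: mulr_gt0 => //; rewrite pmulrn_lgt0 // pi_gt0|apply: ltr_wpDl].
have /continuousC_eps/(_ (e / c) (divr_gt0 e0 c0))/nearC_eps[d d0 Hd] := cf (x := a).
(* |z s t - a| = s |w t - a| <= 2 r s <= d / 2, so the whole loop lies where f is within e / c of
   f(a). *)
pose s := Num.min 1 (d / (4 * r)).
have s0 : 0 < s by rewrite lt_min ltr01 divr_gt0 // mulr_gt0.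
have s1 : s <= 1 by rewrite ge_min lexx.
rewrite -(JE s) //.
have -> : J s - f a * cint beta = cint (fun t => (f (z s t) - f a) * beta t).
  rewrite !cintE -cintabZ // -cintabB; last 2 first.
  - by apply: icontM.
  - by apply: icontM => //; exact: icont_cst.
  by congr cintab; apply/funext => t; ring.
have -> : e = 2 * (pi *+ 2 - 0) * (e / c * (B + 1)).
  rewrite subr0 [RHS](_ : _ = c * (e / c)); last by move: (e / c) => u; rewrite /c; ring.
  by rewrite mulrC divfK // gt_eqF.
apply: cintab_le => //.
  by apply: icontM => //; apply: icontB => //; exact: icont_cst.
move=> t _; rewrite cabsM; apply: ler_pM; rewrite ?cabs_ge0 //; last first.
  by have [_ h] := cauchy_kernel_bound t ar; apply: (le_trans h); rewrite lerDl.
rewrite cabsB; apply: ltW; apply: Hd.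
rewrite /z cabsB addrC addKr cabsM cabs_real gtr0_norm //.
have := wa_le t.
have : s <= d / (4 * r) by rewrite ge_min lexx orbT.
rewrite ler_pdivlMr ?mulr_gt0 // => h1 h2.
have : s * cabs (w t - a) <= s * (2 * r) by rewrite ler_pM2l.
have sr : 0 < s * r by rewrite mulr_gt0.
lra.
Qed.

End Homotopy.

(** Since (1 - a/w) w/(w - a) = 1, consecutive integrals [U N] and [U N.+1] differ by the integral
    of (a/w)^N, which is 2 pi for N = 0 and 0 otherwise. So [U] is constant from 1 on, and |a/w| < 1
    forces that constant to be 0. *)
Lemma cint_kernelX (r : R) (a : C) (N : nat) : cabs a < r ->
  cint (fun t => (a / (r%:C%C * cexpi t)) ^+ N *
                 (r%:C%C * cexpi t / (r%:C%C * cexpi t - a))) =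
  if N == 0%N then (pi *+ 2)%:C%C else 0.
Proof.
move=> ar; have r0 : 0 < r by exact: le_lt_trans (cabs_ge0 _) ar.
have pi2 : 0 <= pi *+ 2 :> R by rewrite mulrn_wge0 // pi_ge0.
pose w t : C := r%:C%C * cexpi t.
have wn0 t : w t != 0.
  by rewrite -cabs_gt0 cabsM cabs_real cabs_cexpi mulr1 normr_gt0 gt_eqF.
have wa0 t : w t - a != 0 by have [] := cauchy_kernel_bound t ar.
have cb u v : icont u v (fun t => w t / (w t - a)).
  by apply: icont_continuous => t _; exact: continuous_kernel.
have caw u v : icont u v (fun t => a / w t).
  apply: icontM; first exact: icont_cst.
  by apply: icont_continuous => t _; apply: continuousCV => //; exact: continuous_circle.
have cu N' u v : icont u v (fun t => (a / w t) ^+ N' * (w t / (w t - a))).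
  by apply: icontM => //; exact: icontX.
rewrite -/w; pose U N := cint (fun t => (a / w t) ^+ N * (w t / (w t - a))).
have step N' : U N' - U N'.+1 = if N' == 0%N then (pi *+ 2)%:C%C else 0.
  rewrite /U !cintE -cintabB //.
  transitivity (a ^+ N' / r%:C%C ^+ N' * cint (fun t => cexpi t ^ (- N'%:Z))).
    rewrite cintE -cintabZ.
      congr cintab; apply/funext => t; rewrite exprS -exprnN.
      have -> : (a / w t) ^+ N' = a ^+ N' / r%:C%C ^+ N' * (cexpi t ^- N').
        by rewrite /w expr_div_n exprMn invfM mulrA.
      move: (a ^+ N' / r%:C%C ^+ N' * cexpi t ^- N') => q.
      by field; rewrite wa0 wn0.
    have -> : (fun t => cexpi t ^ (- N'%:Z)) = (fun t : R => (cexpi t)^-1 ^+ N' : C).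
      by apply/funext => t; rewrite exprVn -exprnN.
    apply: icontX; apply: icont_continuous => t _.
    by apply: continuousCV; [exact: cexpi_neq0|exact: continuous_cexpi].
  rewrite cint_cexpiz oppr_eq0; case: N' => [|N'] /=; last by rewrite mulr0.
  by rewrite !expr0 divr1 mul1r.
have UN k : (0 < k)%N -> U k = 0.
  move=> k0; have Uk j : U k = U (k + j)%N.
    elim: j => [|j ->]; first by rewrite addn0.
    apply/eqP; rewrite addnS -subr_eq0 step.
    by case: k k0.
  apply: cabs0P; apply/eqP; rewrite eq_le cabs_ge0 andbT.
  apply/ler_addgt0Pl => e e0; rewrite addr0.
  pose q := cabs a / r; pose c := 2 * (pi *+ 2) * (r / (r - cabs a) + 1).
  have B0 : 0 <= r / (r - cabs a) by rewrite divr_ge0 ?subr_ge0 // ltW.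
  have c0 : 0 < c by apply: mulr_gt0; [apply: mulr_gt0 => //; rewrite pmulrn_lgt0 // pi_gt0|apply: ltr_wpDl].
  have q1 : `|q| < 1.
    by rewrite ger0_norm ?divr_ge0 ?cabs_ge0 ?(ltW r0) // ltr_pdivrMr // mul1r.
  have /cvgrPdist_lt/(_ (e / c) (divr_gt0 e0 c0))[j _ Hj] := cvg_expr q1.
  have {}Hj := Hj (k + j)%N (leq_addl _ _).
  rewrite (Uk j).
  have -> : e = 2 * (pi *+ 2 - 0) * (e / c * (r / (r - cabs a) + 1)).
    rewrite subr0 [RHS](_ : _ = c * (e / c)); last by move: (e / c) => u; rewrite /c; ring.
    by rewrite mulrC divfK // gt_eqF.
  apply: cintab_le => // t _; rewrite cabsM; apply: ler_pM; rewrite ?cabs_ge0 //; last first.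
    by have [_ h] := cauchy_kernel_bound t ar; apply: (le_trans h); rewrite lerDl.
  rewrite cabsX cabsM cabsV cabsM cabs_real cabs_cexpi mulr1 gtr0_norm //.
  move: Hj; rewrite /= distrC subr0 ger0_norm ?exprn_ge0 ?divr_ge0 ?cabs_ge0 ?(ltW r0) // => /ltW.
  exact.
case: N => [|N] /=; last exact: UN.
by have := step 0%N; rewrite (UN 1%N) // subr0.
Qed.

Lemma cauchy_circle f (r : R) (a : C) : (forall z, cdiff f z) -> cabs a < r ->
  cint (fun t => f (r%:C%C * cexpi t) * (r%:C%C * cexpi t / (r%:C%C * cexpi t - a))) =
  (pi *+ 2)%:C%C * f a.
Proof.
move=> fd ar; rewrite cauchy_circle_const // mulrC; congr (_ * _).
have := @cint_kernelX r a 0 ar => /= <-.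
by congr cint; apply/funext => t; rewrite expr0 mul1r.
Qed.

End Cauchy.

(** * Iterated integrals and Taylor expansion in several variables *)

Section Updates.
Variable T : Type.
Definition upd (x : nat -> T) (k : nat) (t : T) : nat -> T :=
  fun j => if j == k then t else x j.

Lemma updE x k t : upd x k t k = t.
Proof. by rewrite /upd eqxx. Qed.

Lemma upd_lt x k t j : (j < k)%N -> upd x k t j = x j.
Proof. by rewrite /upd; case: eqVneq => // ->; rewrite ltnn. Qed.

Definition merge (k : nat) (u v : nat -> T) : nat -> T :=
  fun j => if (j < k)%N then u j else v j.

Lemma merge0 u v : merge 0 u v = v.
Proof. by []. Qed.

Lemma merge_upd k u t v : merge k.+1 (upd u k t) v = merge k u (upd v k t).
Proof.
apply/funext => j; rewrite /merge /upd ltnS leq_eqVlt.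
by case: eqVneq => //= ->; rewrite ltnn.
Qed.

End Updates.

Section IteratedIntegral.
Variable R : realType.
Local Notation C := (CC R).
Implicit Types (g h : (nat -> R) -> C) (th : nat -> R).
Local Notation pi2 := (pi *+ 2 : R).

Lemma pi2_gt0 : 0 < pi2.
Proof. by rewrite pmulrn_lgt0 // pi_gt0. Qed.

Lemma pi2_ge0 : 0 <= pi2.
Proof. exact/ltW/pi2_gt0. Qed.

Definition inbox (k : nat) th := forall j, (j < k)%N -> 0 <= th j <= pi2.

(* Bounded and uniformly continuous in the first [k] variables: unlike plain continuity,
   this passes to the slices occurring in the definition of [tint]. *)
Definition tame (k : nat) g :=
  (forall e : R, 0 < e -> exists2 d : R, 0 < d & forall th th', inbox k th -> inbox k th' ->
     (forall j, (j < k)%N -> `|th j - th' j| < d) -> cabs (g th - g th') < e) /\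
  (exists M : R, forall th, inbox k th -> cabs (g th) <= M).

Lemma tame_bound k g : tame k g ->
  exists2 M : R, 0 < M & forall th, inbox k th -> cabs (g th) <= M.
Proof.
move=> [_ [M HM]]; exists (`|M| + 1); first by rewrite ltr_wpDl.
by move=> th /HM h; apply: (le_trans h); rewrite (le_trans (ler_norm _)) // lerDl.
Qed.

Lemma tame_cst k (c : C) : tame k (fun=> c).
Proof.
split; last by exists (cabs c).
by move=> e e0; exists 1 => // th th' _ _ _; rewrite subrr cabs0.
Qed.

Lemma tameD k g h : tame k g -> tame k h -> tame k (fun th => g th + h th).
Proof.
move=> [ug [M HM]] [uh [N HN]]; split; last first.
  by exists (M + N) => th b; rewrite (le_trans (cabsD _ _)) // lerD // ?HM ?HN.
move=> e e0; have e2 : 0 < e / 2 by rewrite divr_gt0.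
have [d d0 Hd] := ug _ e2; have [d' d'0 Hd'] := uh _ e2.
exists (Num.min d d'); first by rewrite lt_min d0.
move=> th th' b b' dist.
rewrite opprD addrACA (splitr e) (le_lt_trans (cabsD _ _)) // ltrD //.
- by apply: Hd => // j /dist; rewrite lt_min => /andP[].
- by apply: Hd' => // j /dist; rewrite lt_min => /andP[].
Qed.

Lemma tameM k g h : tame k g -> tame k h -> tame k (fun th => g th * h th).
Proof.
move=> tg th0; have [M M0 HM] := tame_bound tg; have [N N0 HN] := tame_bound th0.
move: tg th0 => [ug _] [uh _]; split; last first.
  by exists (M * N) => th b; rewrite cabsM ler_pM ?cabs_ge0 ?HM ?HN.
move=> e e0; have e2 : 0 < e / 2 by rewrite divr_gt0.
have [d d0 Hd] := ug _ (divr_gt0 e2 N0); have [d' d'0 Hd'] := uh _ (divr_gt0 e2 M0).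
exists (Num.min d d'); first by rewrite lt_min d0.
move=> th th' b b' dist.
have -> : g th * h th - g th' * h th' = g th * (h th - h th') + (g th - g th') * h th' by ring.
rewrite (splitr e) (le_lt_trans (cabsD _ _)) // !cabsM ltrD //.
- apply: (@le_lt_trans _ _ (M * cabs (h th - h th'))).
    by rewrite ler_wpM2r ?cabs_ge0 ?HM.
  rewrite -ltr_pdivlMl // mulrC.
  by apply: Hd' => // j /dist; rewrite lt_min => /andP[].
- apply: (@le_lt_trans _ _ (cabs (g th - g th') * N)).
    by rewrite ler_wpM2l ?cabs_ge0 ?HN.
  rewrite -ltr_pdivlMr //.
  by apply: Hd => // j /dist; rewrite lt_min => /andP[].
Qed.

Lemma tameN k g : tame k g -> tame k (fun th => - g th).
Proof.
move=> tg; under eq_fun do rewrite -mulN1r.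
by apply: tameM => //; exact: tame_cst.
Qed.

Lemma tameB k g h : tame k g -> tame k h -> tame k (fun th => g th - h th).
Proof. by move=> tg t_h; apply: tameD => //; exact: tameN. Qed.

Lemma tameX k g n : tame k g -> tame k (fun th => g th ^+ n).
Proof.
move=> tg; elim: n => [|n IH]; first exact: tame_cst.
by under eq_fun do rewrite exprS; exact: tameM.
Qed.

Lemma tame_sum k (I : Type) (s : seq I) (f : I -> (nat -> R) -> C) :
  (forall i, tame k (f i)) -> tame k (fun th => \sum_(i <- s) f i th).
Proof.
move=> cf; elim: s => [|i s IH].
  by under eq_fun do rewrite big_nil; exact: tame_cst.
by under eq_fun do rewrite big_cons; exact: tameD.
Qed.

Lemma tame_prod k (I : Type) (s : seq I) (f : I -> (nat -> R) -> C) :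
  (forall i, tame k (f i)) -> tame k (fun th => \prod_(i <- s) f i th).
Proof.
move=> cf; elim: s => [|i s IH].
  by under eq_fun do rewrite big_nil; exact: tame_cst.
by under eq_fun do rewrite big_cons; exact: tameM.
Qed.

Lemma tameV k g (m : R) : tame k g -> 0 < m ->
  (forall th, inbox k th -> m <= cabs (g th)) -> tame k (fun th => (g th)^-1).
Proof.
move=> [ug _] m0 Hm; split; last first.
  exists m^-1 => th b; rewrite cabsV lef_pV2 ?posrE ?Hm //.
  exact: lt_le_trans (Hm _ b).
move=> e e0; have [d d0 Hd] := ug _ (mulr_gt0 e0 (mulr_gt0 m0 m0)).
exists d => // th th' b b' dist.
have p1 : 0 < cabs (g th) := lt_le_trans m0 (Hm _ b).
have p2 : 0 < cabs (g th') := lt_le_trans m0 (Hm _ b').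
have n1 : g th != 0 by rewrite -cabs_gt0.
have n2 : g th' != 0 by rewrite -cabs_gt0.
have -> : (g th)^-1 - (g th')^-1 = (g th' - g th) * ((g th)^-1 * (g th')^-1) :> C.
  by field; rewrite n1 n2.
rewrite !cabsM !cabsV cabsB -invfM ltr_pdivrMr ?mulr_gt0 //.
apply: (lt_le_trans (Hd _ _ b b' dist)).
by rewrite ler_pM2l // ler_pM ?Hm // ltW.
Qed.

Lemma tame_cexpi k j : (j < k)%N -> tame k (fun th => cexpi (th j)).
Proof.
move=> jk; split; last by exists 1 => th _; rewrite cabs_cexpi.
move=> e e0; exists (e / 2); first by rewrite divr_gt0.
move=> th th' _ _ /(_ _ jk) h; apply: (le_lt_trans (cexpi_lip _ _)).
by rewrite mulrC -ltr_pdivlMr.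
Qed.

Lemma tame_cexpiz k j (m : int) : (j < k)%N -> tame k (fun th => cexpi (th j) ^ m).
Proof.
move=> jk; case: m => n.
  by under eq_fun do rewrite -exprnP; apply: tameX; exact: tame_cexpi.
under eq_fun do rewrite NegzE -exprnN -exprVn.
apply: tameX; apply: (@tameV _ _ 1) => //; first exact: tame_cexpi.
by move=> th _; rewrite cabs_cexpi.
Qed.

Lemma tame_ext k g h : (forall th, inbox k th -> g th = h th) -> tame k g -> tame k h.
Proof.
move=> gh [ug [M HM]]; split; last by exists M => th b; rewrite -gh // HM.
move=> e /ug[d d0 Hd]; exists d => // th th' b b'.
by rewrite -!gh //; exact: Hd.
Qed.

Lemma inbox_upd k th t : inbox k th -> 0 <= t <= pi2 -> inbox k.+1 (upd th k t).
Proof.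
move=> b bt j; rewrite ltnS leq_eqVlt /upd; case: eqVneq => //= _; exact: b.
Qed.

Lemma tame_slice k g t : tame k.+1 g -> 0 <= t <= pi2 -> tame k (fun th => g (upd th k t)).
Proof.
move=> [ug [M HM]] bt; split; last by exists M => th b; apply: HM; exact: inbox_upd.
move=> e /ug[d d0 Hd]; exists d => // th th' b b' dist.
apply: Hd; try exact: inbox_upd.
move=> j; rewrite ltnS leq_eqVlt /upd; case: eqVneq => //= [_ _|_]; last exact: dist.
by rewrite subrr normr0.
Qed.

Lemma tintS k g : tint k.+1 g = cint (fun t => tint k (fun th => g (upd th k t))).
Proof. by []. Qed.

Lemma tint_ext k g h : (forall th, inbox k th -> g th = h th) -> tint k g = tint k h.
Proof.
elim: k g h => [|k IH] g h gh; first by apply: gh.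
rewrite !tintS !cintE; apply: cintab_ext => t bt; apply: IH => th b.
by apply: gh; exact: inbox_upd.
Qed.

(** The three properties are proved in one induction: together, at level k, they give the continuity
    of the inner integral in the next variable, and that continuity is what each of them needs at
    level k + 1. *)
Let tint_lin k :=
  [/\ forall g h, tame k g -> tame k h -> tint k (fun th => g th + h th) = tint k g + tint k h,
      forall (c : C) g, tame k g -> tint k (fun th => c * g th) = c * tint k g &
      forall g (M : R), tame k g -> (forall th, inbox k th -> cabs (g th) <= M) ->
        cabs (tint k g) <= (2 * pi2) ^+ k * M].

Let icont_tint_aux k : tint_lin k -> forall g, tame k.+1 g ->
  icont 0 pi2 (fun t => tint k (fun th => g (upd th k t))).
Proof.
move=> [Hadd Hscal Hbd] g tg; apply: icont_eps => t bt e e0.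
have P0 : 0 < (2 * pi2) ^+ k by rewrite exprn_gt0 // mulr_gt0 // pi2_gt0.
have e2 : 0 < e / (2 * (2 * pi2) ^+ k) by rewrite divr_gt0 // mulr_gt0.
have [d d0 Hd] := tg.1 _ e2; exists d => // t' bt' dist.
have ts := tame_slice tg bt; have ts' := tame_slice tg bt'.
have -> : tint k (fun th => g (upd th k t)) - tint k (fun th => g (upd th k t')) =
   tint k (fun th => g (upd th k t) + (-1) * g (upd th k t')).
  by rewrite Hadd ?Hscal ?mulN1r //; apply: tameM => //; exact: tame_cst.
apply: (@le_lt_trans _ _ ((2 * pi2) ^+ k * (e / (2 * (2 * pi2) ^+ k)))).
  apply: Hbd; first by apply: tameD => //; apply: tameM => //; exact: tame_cst.
  move=> th b; rewrite mulN1r; apply: ltW; apply: Hd; try exact: inbox_upd.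
  move=> j; rewrite ltnS leq_eqVlt /upd; case: eqVneq => //= _ _.
  by rewrite subrr normr0.
have -> : (2 * pi2) ^+ k * (e / (2 * (2 * pi2) ^+ k)) = e / 2.
  by field; rewrite expf_neq0 // ?mulf_neq0 // gt_eqF // pi2_gt0.
by rewrite ltr_pdivrMr // ltr_pMr // ltr1n.
Qed.

Let tint_linP k : tint_lin k.
Proof.
elim: k => [|k IH].
  split => // g M _ HM; rewrite expr0 mul1r; exact: HM.
have [Hadd Hscal Hbd] := IH.
split.
- move=> g h tg t_h; rewrite !tintS !cintE -cintabD; try exact: icont_tint_aux.
  by apply: cintab_ext => t bt; rewrite Hadd //; exact: tame_slice.
- move=> c g tg; rewrite !tintS !cintE -cintabZ; try exact: icont_tint_aux.
  by apply: cintab_ext => t bt; rewrite Hscal //; exact: tame_slice.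
- move=> g M tg HM; rewrite tintS cintE exprS -!mulrA.
  have -> : 2 * (pi2 * ((2 * pi2) ^+ k * M)) = 2 * (pi2 - 0) * ((2 * pi2) ^+ k * M).
    by rewrite subr0 mulrA.
  apply: cintab_le; [exact: pi2_ge0|exact: icont_tint_aux|].
  move=> t bt; apply: Hbd; first exact: tame_slice.
  by move=> th b; apply: HM; exact: inbox_upd.
Qed.

Lemma icont_tint k g : tame k.+1 g ->
  icont 0 pi2 (fun t => tint k (fun th => g (upd th k t))).
Proof. exact: (icont_tint_aux (tint_linP k)). Qed.

Lemma tintD k g h : tame k g -> tame k h ->
  tint k (fun th => g th + h th) = tint k g + tint k h.
Proof. by have [H _ _] := tint_linP k; exact: H. Qed.

Lemma tintZ k (c : C) g : tame k g -> tint k (fun th => c * g th) = c * tint k g.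
Proof. by have [_ H _] := tint_linP k; exact: H. Qed.

Lemma tint_le k g (M : R) : tame k g -> (forall th, inbox k th -> cabs (g th) <= M) ->
  cabs (tint k g) <= (2 * pi2) ^+ k * M.
Proof. by have [_ _ H] := tint_linP k; exact: H. Qed.

Lemma tintB k g h : tame k g -> tame k h ->
  tint k (fun th => g th - h th) = tint k g - tint k h.
Proof.
move=> tg t_h; rewrite -mulN1r -tintZ // -tintD //.
  by apply: tint_ext => th _; rewrite mulN1r.
by apply: tameM => //; exact: tame_cst.
Qed.

Lemma tint_sum k (I : Type) (s : seq I) (f : I -> (nat -> R) -> C) :
  (forall i, tame k (f i)) ->
  tint k (fun th => \sum_(i <- s) f i th) = \sum_(i <- s) tint k (f i).
Proof.
move=> cf; elim: s => [|i s IH].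
  rewrite big_nil (@tint_ext _ _ (fun=> 0 * (0 : C))) => [|th _].
    by rewrite tintZ ?mul0r //; exact: tame_cst.
  by rewrite big_nil mul0r.
rewrite big_cons -IH -tintD //; last exact: tame_sum.
by apply: tint_ext => th _; rewrite big_cons.
Qed.

Definition emon (k : nat) (a : nat -> int) th : C := \prod_(j < k) cexpi (th j) ^ a j.

Lemma tame_emon k a : tame k (emon k a).
Proof. by apply: tame_prod => j; exact: tame_cexpiz. Qed.

Lemma cabs_emon k a th : cabs (emon k a th) = 1.
Proof.
rewrite cabs_prod big1 // => j _; rewrite -cexpiMz; exact: cabs_cexpi.
Qed.

Lemma emonM k a b th : emon k a th * emon k b th = emon k (fun j => a j + b j) th.
Proof.
rewrite /emon -big_split; apply: eq_bigr => j _ /=.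
by rewrite expfzDr ?cexpi_neq0.
Qed.

Lemma prod_ord_recr (F : nat -> C) k : \prod_(j < k.+1) F j = \prod_(j < k) F j * F k.
Proof. exact: big_ord_recr. Qed.

Lemma emon_recr k a th : emon k.+1 a th = emon k a th * cexpi (th k) ^ a k.
Proof. exact: (prod_ord_recr (fun j => cexpi (th j) ^ a j)). Qed.

Lemma emon_upd k a th t : emon k a (upd th k t) = emon k a th.
Proof.
rewrite /emon; apply: eq_bigr => j _.
by rewrite (upd_lt th t (ltn_ord j)).
Qed.

Lemma emonS k a th t : emon k.+1 a (upd th k t) = cexpi t ^ a k * emon k a th.
Proof. by rewrite emon_recr emon_upd updE mulrC. Qed.

Lemma tint_emon k a :
  tint k (emon k a) = \prod_(j < k) (if a j == 0 then pi2%:C%C else 0).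
Proof.
elim: k => [|k IH]; first by rewrite /= /emon !big_ord0.
rewrite tintS (prod_ord_recr (fun j => if a j == 0 then pi2%:C%C else 0)) -IH.
rewrite -cint_cexpiz !cintE -cintabZ; last first.
  have := @icont_tint 0 (fun th => cexpi (th 0%N) ^ a k).
  by apply; exact: tame_cexpiz.
apply: cintab_ext => t bt; rewrite [RHS]mulrC -tintZ; last exact: tame_emon.
by apply: tint_ext => th _; rewrite emonS.
Qed.

Lemma tint_emon0 k a : (forall j, (j < k)%N -> a j = 0) -> tint k (emon k a) = (pi2%:C%C) ^+ k.
Proof.
move=> a0; rewrite tint_emon (eq_bigr (fun=> pi2%:C%C)); last first.
  by move=> j _; rewrite a0 ?eqxx.
by rewrite prodr_const card_ord.
Qed.

Lemma tint_emon_neq0 k a j : (j < k)%N -> a j != 0 -> tint k (emon k a) = 0.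
Proof.
move=> jk aj; rewrite tint_emon (bigD1 (Ordinal jk)) //= (negbTE aj).
exact: mul0r.
Qed.

End IteratedIntegral.

(** * Multi-indices bounded by N in each of k variables *)

Section Boxes.

(** Multi-indices are functions on all of nat, equal to 0 from k on, so that one type serves every
    number of variables. The last variable is split off first, as in [tint]. *)
Fixpoint box (N k : nat) : seq (nat -> nat) :=
  if k is k'.+1 then [seq upd a k' i | i <- iota 0 N, a <- box N k'] else [:: fun=> 0%N].

Lemma box_sumS (V : nmodType) N k (g : (nat -> nat) -> V) :
  \sum_(a <- box N k.+1) g a = \sum_(i < N) \sum_(a <- box N k) g (upd a k i).
Proof.
rewrite /= big_allpairs_dep (_ : iota 0 N = index_iota 0 N) ?big_mkord //.
by rewrite /index_iota subn0.
Qed.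

Lemma box_sum_delta (V : nmodType) N k (b : nat -> nat) (g : (nat -> nat) -> V) :
  (forall j, (j < k)%N -> (b j < N)%N) ->
  (forall a, (forall j, (j < k)%N -> a j = b j) -> g a = g b) ->
  (forall a j, (j < k)%N -> a j != b j -> g a = 0) ->
  \sum_(a <- box N k) g a = g b.
Proof.
elim: k g b => [|k IH] g b bN gb g0.
  by rewrite big_seq1; apply: gb.
rewrite box_sumS (bigD1 (Ordinal (bN k (ltnSn k)))) //= [X in _ + X]big1 ?addr0 => [|i ib]; last first.
  rewrite big1 // => a _; apply: (g0 _ k) => //.
  by rewrite updE; apply: contraNneq ib => E; apply/eqP/val_inj.
have E : g (upd b k (b k)) = g b.
  by apply: gb => j _; rewrite /upd; case: eqVneq => // ->.
rewrite (IH (fun a => g (upd a k (b k))) b) // => [j jk|a ab|a j jk ab].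
- by apply: bN; rewrite ltnS ltnW.
- rewrite E; apply: gb => j; rewrite ltnS leq_eqVlt /upd; case: eqVneq => [->|_] //=.
  exact: ab.
- by apply: (g0 _ j); rewrite ?upd_lt // ltnS ltnW.
Qed.

End Boxes.

(** * Cauchy coefficients on a torus and Taylor's formula on a polydisc *)

Section Taylor.
Variable R : realType.
Local Notation C := (CC R).
Implicit Types (th : nat -> R) (z : nat -> C) (a b : nat -> nat).
Local Notation pi2 := (pi *+ 2 : R).

Definition mon k z a : C := \prod_(j < k) z j ^+ a j.
Definition asize k a := (\sum_(j < k) a j)%N.
Definition circ (r : R) th : nat -> C := fun j => r%:C%C * cexpi (th j).

Lemma mon_recr k z a : mon k.+1 z a = mon k z a * z k ^+ a k.
Proof. exact: (prod_ord_recr (fun j => z j ^+ a j)). Qed.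

Lemma asize_recr k a : asize k.+1 a = (asize k a + a k)%N.
Proof. by rewrite /asize big_ord_recr. Qed.

Lemma mon_upd k z w a : mon k (upd z k w) a = mon k z a.
Proof. by rewrite /mon; apply: eq_bigr => j _; rewrite (upd_lt z w (ltn_ord j)). Qed.

Lemma mon_updr k z i a : mon k z (upd a k i) = mon k z a.
Proof. by rewrite /mon; apply: eq_bigr => j _; rewrite (upd_lt a i (ltn_ord j)). Qed.

Lemma cabs_circ (r : R) th j : 0 < r -> cabs (circ r th j) = r.
Proof. by move=> r0; rewrite cabsM cabs_real cabs_cexpi mulr1 gtr0_norm. Qed.

Lemma circ_neq0 (r : R) th j : 0 < r -> circ r th j != 0.
Proof. by move=> r0; rewrite -cabs_gt0 cabs_circ. Qed.

Lemma mon_emon (r : R) k th a :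
  mon k (circ r th) a = r%:C%C ^+ asize k a * emon k (fun j => (a j)%:Z) th.
Proof.
elim: k => [|k IH].
  by rewrite /mon /emon /asize !big_ord0 expr0 mulr1.
rewrite mon_recr emon_recr asize_recr IH exprD /circ exprMn.
rewrite -[_ ^ _]exprnP; ring.
Qed.

Lemma mon_emonV (r : R) k th a :
  (mon k (circ r th) a)^-1 = r%:C%C ^- asize k a * emon k (fun j => - (a j)%:Z) th.
Proof.
elim: k => [|k IH].
  by rewrite /mon /emon /asize !big_ord0 expr0 mulr1.
rewrite mon_recr emon_recr asize_recr invfM IH exprD /circ exprMn !invfM.
by rewrite -exprnN mulrACA.
Qed.

Lemma tame_monV (r : R) k a : tame k (fun th => (mon k (circ r th) a)^-1).
Proof.
under eq_fun do rewrite mon_emonV.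
by apply: tameM; [exact: tame_cst|exact: tame_emon].
Qed.

Lemma tame_mon (r : R) k a : tame k (fun th => mon k (circ r th) a).
Proof.
under eq_fun do rewrite mon_emon.
by apply: tameM; [exact: tame_cst|exact: tame_emon].
Qed.

(** Cauchy's coefficient integral in angular form: dz_j = i z_j dtheta_j removes one power of z_j,
    so the exponents are a_j and not a_j + 1, and 2 pi i becomes 2 pi. *)
Definition tcoef (r : R) k (h : (nat -> R) -> C) a : C :=
  (pi2%:C%C) ^- k * tint k (fun th => h th * (mon k (circ r th) a)^-1).

Let pi2C : pi2%:C%C != 0 :> C.
Proof. by rewrite -cabs_gt0 cabs_real normr_gt0 gt_eqF // pi2_gt0. Qed.

Lemma tcoef_ext r k h h' a : (forall th, inbox k th -> h th = h' th) ->
  tcoef r k h a = tcoef r k h' a.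
Proof. by move=> hh; congr (_ * _); apply: tint_ext => th b; rewrite hh. Qed.

Lemma tcoef_updr r k h a i : tcoef r k h (upd a k i) = tcoef r k h a.
Proof. by congr (_ * _); apply: tint_ext => th b; rewrite mon_updr. Qed.

Lemma tcoefB r k h h' a : tame k h -> tame k h' ->
  tcoef r k (fun th => h th - h' th) a = tcoef r k h a - tcoef r k h' a.
Proof.
move=> th0 th'; rewrite /tcoef -mulrBr -tintB; try by apply: tameM => //; exact: tame_monV.
by congr (_ * _); apply: tint_ext => th _; rewrite mulrBl.
Qed.

Lemma tcoefZ r k (c : C) h a : tame k h ->
  tcoef r k (fun th => c * h th) a = c * tcoef r k h a.
Proof.
move=> th0; rewrite /tcoef [RHS]mulrCA -(tintZ c); last by apply: tameM => //; exact: tame_monV.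
by congr (_ * _); apply: tint_ext => th _; rewrite mulrA.
Qed.

Lemma tcoef_sum r k (I : Type) (s : seq I) (f : I -> (nat -> R) -> C) a :
  (forall i, tame k (f i)) ->
  tcoef r k (fun th => \sum_(i <- s) f i th) a = \sum_(i <- s) tcoef r k (f i) a.
Proof.
move=> tf; rewrite /tcoef -mulr_sumr -tint_sum.
  by congr (_ * _); apply: tint_ext => th _; rewrite mulr_suml.
by move=> i; apply: tameM => //; exact: tame_monV.
Qed.

Lemma tcoef_le (r : R) k h a (M : R) : 0 < r -> tame k h ->
  (forall th, inbox k th -> cabs (h th) <= M) ->
  cabs (tcoef r k h a) <= 2 ^+ k * M / r ^+ asize k a.
Proof.
move=> r0 th0 hM; rewrite /tcoef cabsM cabsV cabsX cabs_real (gtr0_norm (pi2_gt0 R)).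
have p0 : 0 < pi2 ^+ k by rewrite exprn_gt0 // pi2_gt0.
rewrite mulrC ler_pdivrMr //.
have -> : 2 ^+ k * M / r ^+ asize k a * pi2 ^+ k = (2 * pi2) ^+ k * (M / r ^+ asize k a).
  by rewrite exprMn; ring.
apply: tint_le; first by apply: tameM => //; exact: tame_monV.
move=> th b; rewrite mon_emonV !cabsM cabs_emon mulr1 cabsV cabsX cabs_real (gtr0_norm r0).
by rewrite ler_pM2r ?hM // invr_gt0 exprn_gt0.
Qed.

Lemma tcoef_mon (r : R) k a b : 0 < r ->
  tcoef r k (fun th => mon k (circ r th) b) a =
  (pi2%:C%C) ^- k * (r%:C%C ^+ asize k b * r%:C%C ^- asize k a *
    tint k (emon k (fun j => (b j)%:Z - (a j)%:Z))).
Proof.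
move=> r0; rewrite /tcoef; congr (_ * _); rewrite -tintZ; last exact: tame_emon.
by apply: tint_ext => th _; rewrite mon_emon mon_emonV mulrACA emonM.
Qed.

Lemma tcoef_mon_eq (r : R) k a b : 0 < r -> (forall j, (j < k)%N -> b j = a j) ->
  tcoef r k (fun th => mon k (circ r th) b) a = 1.
Proof.
move=> r0 ba; rewrite tcoef_mon // tint_emon0; last by move=> j jk; rewrite ba // subrr.
have -> : asize k b = asize k a by apply: eq_bigr => j _; rewrite ba.
have rC : r%:C%C != 0 :> C by rewrite -cabs_gt0 cabs_real normr_gt0 gt_eqF.
by rewrite mulfV ?expf_neq0 // mul1r mulVf // expf_neq0.
Qed.

Lemma tcoef_mon_neq (r : R) k a b j : 0 < r -> (j < k)%N -> b j != a j ->
  tcoef r k (fun th => mon k (circ r th) b) a = 0.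
Proof.
move=> r0 jk ba; rewrite tcoef_mon // (@tint_emon_neq0 _ _ _ j) ?mulr0 //.
by rewrite subr_eq0 eqz_nat.
Qed.

Lemma tcoefS (r : R) k h a : tame k.+1 h ->
  tcoef r k.+1 h a = (pi2%:C%C)^-1 *
   cint (fun t => (r%:C%C * cexpi t)^-1 ^+ a k * tcoef r k (fun th => h (upd th k t)) a).
Proof.
move=> th0; rewrite /tcoef exprS invfM -mulrA; congr (_ * _).
have tM : tame k.+1 (fun th => h th * (mon k.+1 (circ r th) a)^-1).
  by apply: tameM => //; exact: tame_monV.
rewrite tintS !cintE -cintabZ; last exact: (icont_tint tM).
apply: cintab_ext => t bt.
rewrite [RHS]mulrCA -(tintZ ((r%:C%C * cexpi t)^-1 ^+ a k)); last first.
  by apply: tameM; [exact: tame_slice|exact: tame_monV].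
congr (_ * _); apply: tint_ext => th _.
have -> : circ r (upd th k t) = upd (circ r th) k (r%:C%C * cexpi t).
  by apply/funext => j; rewrite /circ /upd; case: eqVneq.
by rewrite mon_recr mon_upd updE invfM exprVn; ring.
Qed.

Lemma geo_half (N : nat) : \sum_(i < N) (2 : R) ^- i <= 2.
Proof.
have : \sum_(i < N) (2 : R) ^- i = 2 - 2 * 2 ^- N.
  elim: N => [|N IH]; first by rewrite big_ord0 expr0 invr1; ring.
  by rewrite big_ord_recr /= IH exprS invfM; field; rewrite expf_neq0.
by move=> ->; rewrite gerBl mulr_ge0 // invr_ge0 exprn_ge0.
Qed.

(** The Cauchy kernel w/(w - a) is a finite geometric sum in a/w plus (a/w)^N w/(w - a). For |a| <=
    r/2 this remainder is at most 2 / 2^N, and [cintab_le] doubles it. *)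
Lemma taylor1 (f : C -> C) (r M : R) (a : C) (N : nat) :
  (forall w, cdiff f w) -> 0 < r -> cabs a <= r / 2 ->
  (forall t, cabs (f (r%:C%C * cexpi t)) <= M) ->
  cabs (f a - \sum_(i < N) a ^+ i * ((pi2%:C%C)^-1 *
     cint (fun t => (r%:C%C * cexpi t)^-1 ^+ i * f (r%:C%C * cexpi t)))) <= 4 * M / 2 ^+ N.
Proof.
move=> fd r0 a2 fM.
have ar : cabs a < r by apply: (le_lt_trans a2); rewrite ltr_pdivrMr // ltr_pMr // ltr1n.
pose w t : C := r%:C%C * cexpi t.
have wn0 t : w t != 0.
  by rewrite -cabs_gt0 cabsM cabs_real cabs_cexpi mulr1 normr_gt0 gt_eqF.
have wa0 t : w t - a != 0 by have [] := cauchy_kernel_bound t ar.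
have M0 : 0 <= M := le_trans (cabs_ge0 _) (fM 0).
have cb : icont 0 pi2 (fun t => w t / (w t - a)).
  by apply: icont_continuous => t _; exact: continuous_kernel.
have cw : icont 0 pi2 (fun t => (w t)^-1).
  by apply: icont_continuous => t _; apply: continuousCV => //; exact: continuous_circle.
have cf : icont 0 pi2 (fun t => f (w t)).
  apply: icont_continuous => t _; apply: (continuous_comp (@continuous_circle _ r t)).
  exact: cdiff_continuous.
have caw : icont 0 pi2 (fun t => a / w t) by apply: icontM => //; exact: icont_cst.
pose rest t := f (w t) * ((a / w t) ^+ N * (w t / (w t - a))).
have crest : icont 0 pi2 rest.
  by apply: icontM => //; apply: icontM => //; exact: icontX.
have cterm i : icont 0 pi2 (fun t => (w t)^-1 ^+ i * f (w t)).
  by apply: icontM => //; exact: icontX.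
have geo t : f (w t) * (w t / (w t - a)) =
    \sum_(i < N) a ^+ i * ((w t)^-1 ^+ i * f (w t)) + rest t.
  rewrite /rest; elim: N {rest crest} => [|n IH]; first by rewrite big_ord0 add0r expr0 mul1r.
  rewrite IH big_ord_recr /= -addrA; congr (_ + _).
  rewrite exprS exprMn; move: ((w t)^-1 ^+ n) (a ^+ n) => p q.
  by field; rewrite wn0 wa0.
have := cauchy_circle fd ar; rewrite -/w.
have -> : (fun t => f (w t) * (w t / (w t - a))) =
   (fun t => \sum_(i < N) a ^+ i * ((w t)^-1 ^+ i * f (w t)) + rest t).
  by apply/funext => t; exact: geo.
rewrite cintE cintabD //; last first.
  by apply: icont_sum => i; apply: icontM => //; exact: icont_cst.
rewrite cintab_sum; last by move=> i; apply: icontM => //; exact: icont_cst.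
move=> E.
have -> : f a - \sum_(i < N) a ^+ i * ((pi2%:C%C)^-1 * cint (fun t => (w t)^-1 ^+ i * f (w t))) =
   (pi2%:C%C)^-1 * cintab 0 pi2 rest.
  have -> : f a = (pi2%:C%C)^-1 * (pi2%:C%C * f a) by rewrite mulKf.
  rewrite -E mulrDr [X in X - _]addrC -addrA.
  rewrite (_ : _ + - _ = 0) ?addr0 //.
  rewrite mulr_sumr; apply/eqP; rewrite subr_eq0; apply/eqP; apply: eq_bigr => i _.
  by rewrite cintabZ // cintE mulrCA.
rewrite cabsM cabsV cabs_real (gtr0_norm (pi2_gt0 R)) mulrC ler_pdivrMr ?pi2_gt0 //.
have -> : 4 * M / 2 ^+ N * pi2 = 2 * (pi2 - 0) * (M * (2 ^- N * 2)).
  by rewrite subr0; ring.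
apply: cintab_le => //; first exact: pi2_ge0.
move=> t _; rewrite /rest cabsM; apply: ler_pM; rewrite ?cabs_ge0 ?fM //.
rewrite cabsM; apply: ler_pM; rewrite ?cabs_ge0 //.
  rewrite cabsX -exprVn lerXn2r ?nnegrE ?cabs_ge0 ?invr_ge0 //.
  rewrite cabsM cabsV cabsM cabs_real cabs_cexpi mulr1 gtr0_norm // ler_pdivrMr //.
  by rewrite mulrC.
have [_ h] := cauchy_kernel_bound t ar; apply: (le_trans h).
rewrite ler_pdivrMr ?subr_gt0 //; move: a2; rewrite ler_pdivlMr //; lra.
Qed.

(** Induction on the number of variables: [taylor1] expands in the last one, and under the remaining
    circle integral G is replaced by its expansion in the others. The induction hypothesis is used
    at points whose last coordinate is on the circle; this is why the bound on G is only asked at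
    points agreeing with z from k on. *)
Lemma taylor k : exists2 c : R, 0 <= c &
  forall (G : (nat -> C) -> C) (z : nat -> C) (M r : R) (N : nat), 0 < r ->
  (forall j, (j < k)%N -> cabs (z j) <= r / 2) ->
  (forall z' j w, (j < k)%N -> cdiff (fun w => G (upd z' j w)) w) ->
  tame k (fun th => G (merge k (circ r th) z)) ->
  (forall z', (forall j, (j < k)%N -> cabs (z' j) <= r) ->
     (forall j, (k <= j)%N -> z' j = z j) -> cabs (G z') <= M) ->
  cabs (G z - \sum_(a <- box N k)
      mon k z a * tcoef r k (fun th => G (merge k (circ r th) z)) a) <= c * M / 2 ^+ N.
Proof.
elim: k => [|k [c c0 IH]].
  exists 0 => // G z M r N r0 _ _ _ _.
  rewrite big_seq1 /mon big_ord0 mul1r /tcoef expr0 invr1 mul1r /= /mon big_ord0 invr1 mulr1.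
  by rewrite merge0 subrr cabs0 !mul0r.
exists (4 + 4 * c); first by rewrite addr_ge0 // mulr_ge0.
move=> G z M r N r0 zr Gd Gt GM.
pose zt t := upd z k (r%:C%C * cexpi t).
pose H th := G (merge k.+1 (circ r th) z).
have HE th t : H (upd th k t) = G (merge k (circ r th) (zt t)).
  rewrite /H; have -> : circ r (upd th k t) = upd (circ r th) k (r%:C%C * cexpi t).
    by apply/funext => j; rewrite /circ /upd; case: eqVneq.
  by rewrite merge_upd.
have M0 : 0 <= M.
  apply: (le_trans (cabs_ge0 _) (GM z _ _)) => // j /zr h.
  by apply: (le_trans h); rewrite ler_pdivrMr // ler_pMr // ler1n.
pose S t := \sum_(a <- box N k) mon k z a * tcoef r k (fun th => H (upd th k t)) a.
have cT a : icont 0 pi2 (fun t => tcoef r k (fun th => H (upd th k t)) a).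
  apply: icontM; first exact: icont_cst.
  have := @icont_tint _ k (fun th => H th * (mon k (circ r th) a)^-1).
  have tHm : tame k.+1 (fun th => H th * (mon k (circ r th) a)^-1).
    apply: tameM => //; under eq_fun do rewrite mon_emonV.
    apply: tameM; first exact: tame_cst.
    by apply: tame_prod => j; apply: tame_cexpiz; rewrite ltnS ltnW.
  move=> /(_ tHm); congr icont; apply/funext => t; apply: tint_ext => th _.
  congr (_ * _^-1); have -> : circ r (upd th k t) = upd (circ r th) k (r%:C%C * cexpi t).
    by apply/funext => j; rewrite /circ /upd; case: eqVneq.
  exact: mon_upd.
have cS : icont 0 pi2 S.
  by apply: icont_sum => a; apply: icontM => //; exact: icont_cst.
have wn0 t : r%:C%C * cexpi t != 0 :> C.
  by rewrite -cabs_gt0 cabsM cabs_real cabs_cexpi mulr1 normr_gt0 gt_eqF.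
have cw i : icont 0 pi2 (fun t => (r%:C%C * cexpi t)^-1 ^+ i : C).
  apply: icontX; apply: icont_continuous => t _; apply: continuousCV => //.
  exact: continuous_circle.
have cG : icont 0 pi2 (fun t => G (zt t)).
  apply: icont_continuous => t _.
  have cGw : {for r%:C%C * cexpi t : C, continuous (fun w => G (upd z k w))}.
    by apply: cdiff_continuous; exact: Gd.
  exact: (continuous_comp (@continuous_circle _ r t) cGw).
have E : \sum_(a <- box N k.+1) mon k.+1 z a * tcoef r k.+1 H a =
   \sum_(i < N) z k ^+ i * ((pi2%:C%C)^-1 * cint (fun t => (r%:C%C * cexpi t)^-1 ^+ i * S t)).
  rewrite box_sumS; apply: eq_bigr => i _.
  have -> : cint (fun t => (r%:C%C * cexpi t)^-1 ^+ i * S t) =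
     \sum_(a <- box N k) mon k z a *
       cint (fun t => (r%:C%C * cexpi t)^-1 ^+ i * tcoef r k (fun th => H (upd th k t)) a).
    transitivity (cint (fun t => \sum_(a <- box N k) mon k z a *
        ((r%:C%C * cexpi t)^-1 ^+ i * tcoef r k (fun th => H (upd th k t)) a))).
      rewrite !cintE; apply: cintab_ext => t _; rewrite /S mulr_sumr.
      by apply: eq_bigr => a _; rewrite mulrCA.
    rewrite cintE cintab_sum; last first.
      by move=> a; apply: icontM; [exact: icont_cst|exact: icontM].
    by apply: eq_bigr => a _; rewrite cintabZ //; exact: icontM.
  rewrite !mulr_sumr; apply: eq_bigr => a _.
  rewrite tcoefS // mon_recr mon_updr updE.
  have -> : (fun t => (r%:C%C * cexpi t)^-1 ^+ i * tcoef r k (fun th => H (upd th k t)) (upd a k i)) =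
    (fun t => (r%:C%C * cexpi t)^-1 ^+ i * tcoef r k (fun th => H (upd th k t)) a).
    by apply/funext => t; rewrite tcoef_updr.
  ring.
rewrite -/H E.
have zk : cabs (z k) <= r / 2 by apply: zr.
have T1 := @taylor1 (fun w => G (upd z k w)) r M (z k) N.
have updz : upd z k (z k) = z.
  by apply/funext => j; rewrite /upd; case: eqVneq => // ->.
have {}T1 : cabs (G z - \sum_(i < N) z k ^+ i * ((pi2%:C%C)^-1 *
     cint (fun t => (r%:C%C * cexpi t)^-1 ^+ i * G (zt t)))) <= 4 * M / 2 ^+ N.
  rewrite -{1}updz; apply: T1 => //; first by move=> w; exact: Gd.
  move=> t; apply: GM => j jk.
    rewrite /upd; case: eqVneq => [_|jnk].
      by rewrite cabsM cabs_real cabs_cexpi mulr1 gtr0_norm.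
    by apply: (le_trans (zr j jk)); rewrite ler_pdivrMr // ler_pMr // ler1n.
  by rewrite /upd; case: eqVneq => // jE; move: jk; rewrite jE ltnn.
apply: (le_trans (cabs_le_dist _ _ _)).
have -> : (4 + 4 * c) * M / 2 ^+ N = 4 * M / 2 ^+ N + 4 * c * M / 2 ^+ N by ring.
apply: lerD; first exact: T1.
have GS t : 0 <= t <= pi2 -> cabs (G (zt t) - S t) <= c * M / 2 ^+ N.
  move=> bt; have -> : S t = \sum_(a <- box N k) mon k (zt t) a *
       tcoef r k (fun th => G (merge k (circ r th) (zt t))) a.
    apply: eq_bigr => a _; rewrite mon_upd; congr (_ * _).
    by apply: tcoef_ext => th _; rewrite HE.
  apply: IH => //.
  - move=> j jk; rewrite /zt upd_lt //; apply: zr; exact: ltnW.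
  - by move=> z' j w jk; apply: Gd; exact: ltnW.
  - have := tame_slice Gt bt; apply: tame_ext => th _; exact: HE.
  - move=> z' hz' hz''; apply: GM => j.
      rewrite ltnS leq_eqVlt => /predU1P[->|]; last exact: hz'.
      by rewrite hz'' // /zt updE cabsM cabs_real cabs_cexpi mulr1 gtr0_norm.
    by move=> kj; rewrite hz'' ?(ltnW kj) // /zt /upd gtn_eqF.
have cM0 : 0 <= c * M / 2 ^+ N by rewrite !mulr_ge0 // invr_ge0 exprn_ge0.
rewrite -sumrB; apply: (le_trans (cabs_sum _ _ _)).
(* |z k|^i <= (r/2)^i against r^-i leaves 2^-i, with sum at most 2; the inner 2 is that of
   [cintab_le]. This is the 4 c of the new constant, the other 4 being that of [taylor1]. *)
apply: (@le_trans _ _ (\sum_(i < N) 2 ^- i * (2 * (c * M / 2 ^+ N)))).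
  apply: ler_sum => i _; rewrite -!mulrBr !cabsM cabsX !cintE -cintabB; try exact: icontM.
  have -> : (fun t => (r%:C%C * cexpi t)^-1 ^+ i * G (zt t) - (r%:C%C * cexpi t)^-1 ^+ i * S t) =
     (fun t => (r%:C%C * cexpi t)^-1 ^+ i * (G (zt t) - S t)).
    by apply/funext => t; rewrite mulrBr.
  have B : cabs (cintab 0 pi2 (fun t => (r%:C%C * cexpi t)^-1 ^+ i * (G (zt t) - S t))) <=
      2 * (pi2 - 0) * (r ^- i * (c * M / 2 ^+ N)).
    apply: cintab_le; [exact: pi2_ge0|by apply: icontM => //; exact: icontB|].
    move=> t bt; rewrite cabsM; apply: ler_pM; rewrite ?cabs_ge0 ?GS //.
    by rewrite cabsX cabsV cabsM cabs_real cabs_cexpi mulr1 gtr0_norm // exprVn.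
  rewrite cabsV cabs_real (gtr0_norm (pi2_gt0 R)).
  apply: (@le_trans _ _ ((r / 2) ^+ i * (pi2^-1 * (2 * (pi2 - 0) * (r ^- i * (c * M / 2 ^+ N)))))).
    apply: ler_pM; rewrite ?exprn_ge0 ?cabs_ge0 ?mulr_ge0 ?cabs_ge0 ?invr_ge0 ?pi2_ge0 //.
      by rewrite lerXn2r ?nnegrE ?cabs_ge0 // divr_ge0 // ltW.
    by rewrite ler_pM2l // invr_gt0 pi2_gt0.
  rewrite subr0 expr_div_n le_eqVlt; apply/orP; left; apply/eqP.
  have p0 : pi2 != 0 by rewrite gt_eqF // pi2_gt0.
  have ri : r ^+ i != 0 by rewrite expf_neq0 // gt_eqF.
  move: (c * M / 2 ^+ N) => q.
  move: pi2 p0 (r ^+ i) ri => p p0 ri ri0.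
  by field; rewrite p0 ri0 expf_neq0.
rewrite -mulr_suml.
have -> : 4 * c * M / 2 ^+ N = 2 * (2 * (c * M / 2 ^+ N)) by ring.
by apply: ler_wpM2r; [rewrite mulr_ge0|exact: geo_half].
Qed.

End Taylor.

(** * Compactness and uniform continuity *)

Section Compactness.
Variable R : realType.
Local Notation C := (CC R).

Lemma cvg_row (T : topologicalType) (I : Type) (F : set_system I) (FF : Filter F) m
    (f : I -> 'rV[T]_m) (l : 'rV[T]_m) :
  (forall j, (fun i => f i 0 j) @ F --> l 0 j) -> f @ F --> l.
Proof.
move=> fl A [P lP PA].
have : \forall i \near F, forall j : 'I_m, P 0 j (f i 0 j).
  by apply: filter_forall => j; apply: fl; exact: lP.
by apply: filterS => i Pi; apply: PA => k j; rewrite !ord1.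
Qed.

Lemma compact_bounded (V : topologicalType) (A : set V) (g : V -> C) : compact A ->
  (forall v, A v -> {for v, continuous g}) ->
  exists M : R, forall v, A v -> cabs (g v) <= M.
Proof.
move=> /compact_near_coveringP cA cg.
have [k _ Hk] : \forall k \near \oo, A `<=` (fun v => cabs (g v) <= k%:R).
  apply: cA => v Av; have /continuousC_eps/(_ 1 ltr01) near1 := cg v Av.
  exists ([set v' | cabs (g v - g v') < 1], [set k | cabs (g v) + 1 <= k%:R]) => /=.
    split => //; apply: nbhs_infty_ger.
  move=> [v' k] /= [h1 h2]; apply: le_trans h2.
  have := cabsD (g v) (g v' - g v); rewrite addrC subrK cabsB => h.
  by apply: (le_trans h); rewrite lerD2l ltW.
by exists k%:R; exact: (Hk k (leqnn k)).
Qed.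

(** Heine-Cantor on the cube [0, 2 pi]^k. Compactness is applied along radii d tending to 0 from the
    right, with [P d v] as the property to be made uniform in v. *)
Lemma tame_continuous k (g : 'rV[R]_k -> C) : continuous g ->
  tame k (fun th => g (\row_j th j)).
Proof.
move=> cg; pose A : set 'rV[R]_k := [set v | forall j, `[0, pi *+ 2]%classic (v ord0 j)].
have cA : compact A by apply: (@rV_compact R k (fun=> `[0, pi *+ 2]%classic)) => j; exact: segment_compact.
have inA th : inbox k th -> A (\row_j th j).
  by move=> b j /=; rewrite mxE in_itv /=; exact: b.
split; last first.
  have [M HM] := @compact_bounded _ _ g cA (fun v _ => cg v).
  by exists M => th b; apply: HM; exact: inA.
move=> e e0; have e2 : 0 < e / 2 by rewrite divr_gt0.
move: cA => /compact_near_coveringP cA.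
pose P (d : R) (v : 'rV[R]_k) : Prop :=
  forall v' : 'rV[R]_k, (forall j, `|v 0 j - v' 0 j| < d) -> cabs (g v - g v') < e.
have [d /= d0 Hd] : \forall d \near (0 : R)^'+, A `<=` P d.
  apply: cA => v Av; have /continuousC_eps/(_ _ e2)[Q vQ HQ] := cg v.
  have [d d0 Hd] : exists2 d : R, 0 < d &
      forall v' : 'rV[R]_k, (forall j, `|(v : 'rV[R]_k) 0 j - v' 0 j| < d) -> cabs (g v - g v') < e / 2.
    have /(_ _)/cid2 H j : exists2 d : R, 0 < d & forall x : R, `|(v : 'rV[R]_k) 0 j - x| < d -> Q 0 j x.
      have /nbhs_ballP[d /= d0 hd] := vQ 0 j.
      by exists d => // x xd; apply: hd; rewrite -ball_normE.
    exists (\big[Num.min/1]_j sval (H j)).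
      apply: lt_bigmin => // j _; exact: (s2valP (H j)).
    move=> v' hv'; apply: HQ => i j; rewrite ord1.
    apply: (s2valP' (H j)); apply: (lt_le_trans (hv' j)).
    exact: bigmin_le.
  exists ([set v' : 'rV[R]_k | forall j, `|(v : 'rV[R]_k) 0 j - v' 0 j| < d / 2], [set d' : R | d' < d / 2]) => /=.
    split; last by exists (d / 2) => /=; [rewrite divr_gt0|move=> x /=; rewrite sub0r normrN => + x0; rewrite gtr0_norm].
    exists (fun i j => [set x : R | `|(v : 'rV[R]_k) 0 j - x| < d / 2]) => [i j|v' /= hv' j]; last exact: (hv' 0 j).
    rewrite ord1; apply/nbhs_ballP; exists (d / 2) => /=; first by rewrite divr_gt0.
    by move=> x; rewrite -ball_normE.
  move=> [v' d'] /= [h1 h2] v'' hv''.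
  have h3 : cabs (g v - g v') < e / 2.
    by apply: Hd => j; apply: (lt_trans (h1 j)); rewrite ltr_pdivrMr // ltr_pMr // ltr1n.
  have h4 : cabs (g v - g v'') < e / 2.
    apply: Hd => j; rewrite (splitr d) -(subrKA (v' 0 j)).
    by apply: (le_lt_trans (ler_normD _ _)); rewrite ltrD ?h1 // (lt_trans (hv'' j)).
  rewrite (splitr e); apply: (le_lt_trans (cabs_le_dist _ (g v) _)).
  by rewrite ltrD // cabsB.
exists (d / 2); first by rewrite divr_gt0.
move=> th th' b b' dist.
have d2 : 0 < d / 2 by rewrite divr_gt0.
apply: (Hd (d / 2)) => //=.
- by rewrite sub0r normrN gtr0_norm // ltr_pdivrMr // ltr_pMr // ltr1n.
- exact: inA.
- by move=> j; rewrite !mxE; exact: dist.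
Qed.

(** A square instead of a disc: it is the image of a product of two segments, hence compact, and it
    contains the disc of radius r. *)
Definition csquare (r : R) : set C :=
  [set z | exists xy : R * R, (`[- r, r]%classic xy.1 /\ `[- r, r]%classic xy.2) /\
                              z = xy.1%:C%C + 'i%C * xy.2%:C%C].

Lemma csquareP (r : R) z : cabs z <= r -> csquare r z.
Proof.
move=> zr; exists (complex.Re z, complex.Im z) => /=; split; last exact: complexE.
rewrite !in_itv /= -!ler_norml; split.
- exact: le_trans (cabs_Re _) zr.
- exact: le_trans (cabs_Im _) zr.
Qed.

Lemma compact_csquare (r : R) : compact (csquare r).
Proof.
have -> : csquare r = (fun xy : R * R => xy.1%:C%C + 'i%C * xy.2%:C%C : C) @`
    (`[- r, r]%classic `*` `[- r, r]%classic).
  by apply/seteqP; split=> [z [xy [h ->]]|z [xy h <-]]; exists xy.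
apply: continuous_compact; last by apply: compact_setX; exact: segment_compact.
apply: continuous_subspaceT => xy; apply: cvgD.
  by apply: (continuous_comp (@cvg_fst _ _ _ _ _)); exact: continuous_RtoC.
apply: cvgM; first exact: cvg_cst.
by apply: (continuous_comp (@cvg_snd _ _ _ _ _)); exact: continuous_RtoC.
Qed.

End Compactness.

(** * Differentiability of functions of one complex variable *)

Section Derivability.
Variable R : realType.
Local Notation C := (CC R).

Lemma differentiable_cdiff (f : C -> C) z : differentiable f z -> cdiff f z.
Proof.
move=> /derivable1_diffP/cvg_ex[l /cvgC_eps Hl]; exists l => e e0.
have := Hl e e0; rewrite /dnbhs => /nearC_eps[d d0 Hd]; exists d => // w wz.
have [->|wn] := eqVneq w z.
  by rewrite !subrr mulr0 subr0 cabs0 mulr0.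
have h0 : w - z != 0 by rewrite subr_eq0.
have h1 : cabs (0 - (w - z)) < d by rewrite sub0r opprB.
have /= := Hd _ h1 h0.
rewrite [_%:A]mulr1 subrK => h.
have -> : f w - f z - l * (w - z) = - (l - (w - z)^-1 *: (f w - f z)) * (w - z).
  by rewrite /GRing.scale /=; field.
by rewrite cabsM cabsN ler_wpM2r ?cabs_ge0 // ltW.
Qed.

Lemma differentiable_row m (f : C -> 'rV[C]_m) w :
  (forall j, differentiable (fun z => f z 0 j) w) -> differentiable f w.
Proof.
move=> fd; have -> : f = \sum_j (fun z => f z 0 j *: delta_mx 0 j).
  by apply/funext => z; rewrite fct_sumE {1}(row_sum_delta (f z)).
by apply: differentiable_sum => j; exact: differentiableZl.
Qed.

End Derivability.

(** * Affine charts of \hat Z *)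

Section Charts.
Variables (R : realType) (n : nat).
Local Notation C := (CC R).
Local Notation pt := (pt R n).

Lemma hformZ (a b : C) (p q : 'rV[C]_n.+1) :
  hform (a *: p) (b *: q) = a * b * hform p q.
Proof.
rewrite /hform mulr_sumr; apply: eq_bigr => mu _; rewrite !mxE.
ring.
Qed.

Lemma cactM (a b : C) (pq : pt) : cact a (cact b pq) = cact (a * b) pq.
Proof. by rewrite /cact /= !scalerA invfM. Qed.

Lemma Zhat_cact (z : C) (pq : pt) : z != 0 -> Zhat pq -> Zhat (cact z pq).
Proof. by move=> z0; rewrite /Zhat /= hformZ mulfV // mul1r. Qed.

Lemma Zhat_neq0 (pq : pt) : Zhat pq ->
  (exists mu, pq.1 0 mu != 0) /\ (exists nu, pq.2 0 nu != 0).
Proof.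
rewrite /Zhat /= => h; have n1 : (-1 : C) != 0 by rewrite oppr_eq0 oner_neq0.
split; apply/existsP; apply: contraNT n1; rewrite negb_exists -h => /forallP p0;
  rewrite /hform big1 // => mu _; move: (p0 mu); rewrite negbK => /eqP ->; ring.
Qed.

Definition chart_map (mu nu : 'I_n.+1) (pq : pt) : 'rV[C]_n * 'rV[C]_n :=
  (\row_k (pq.1 0 (lift mu k) / pq.1 0 mu), \row_k (pq.2 0 (lift nu k) / pq.2 0 nu)).

Lemma ins_chart (mu : 'I_n.+1) (p : 'rV[C]_n.+1) : p 0 mu != 0 ->
  ins mu (\row_k (p 0 (lift mu k) / p 0 mu)) = (p 0 mu)^-1 *: p.
Proof.
move=> p0; apply/rowP => j; rewrite !mxE; case: unliftP => [k ->|->].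
  by rewrite mxE mulrC.
by rewrite mulVf.
Qed.

Lemma chart_mapK mu nu (pq : pt) : Zhat pq -> pq.1 0 mu != 0 -> pq.2 0 nu != 0 ->
  chart_dom mu nu (chart_map mu nu pq) /\
  chart_inv mu nu (chart_map mu nu pq) = cact (pq.1 0 mu)^-1 pq.
Proof.
rewrite /Zhat /chart_dom /chart_inv /= => h p0 q0; rewrite !ins_chart // hformZ h.
split; first by rewrite mulrN1 oppr_eq0 mulf_neq0 ?invr_neq0.
rewrite /cact; congr pair; rewrite scalerA; congr (_ *: _).
by rewrite mulrN1 invrN opprK -invfM invrK mulfVK // invrK.
Qed.

Lemma Ohat_chart (F : pt -> C) mu nu (pq : pt) : Ohat F -> Zhat pq ->
  pq.1 0 mu != 0 -> pq.2 0 nu != 0 -> F pq = F (chart_inv mu nu (chart_map mu nu pq)).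
Proof.
move=> [inv _] Zpq p0 q0; have [_ ->] := chart_mapK Zpq p0 q0.
by rewrite inv // invr_eq0.
Qed.

Lemma near_neq0 (V : topologicalType) (g : V -> C) (v : V) :
  {for v, continuous g} -> g v != 0 -> \forall x \near v, g x != 0.
Proof.
move=> /continuousC_eps cg g0; have m0 : 0 < cabs (g v) by rewrite cabs_gt0.
apply: filterS (cg _ m0) => x; apply: contraTneq => ->.
by rewrite subr0 ltxx.
Qed.

Section Curve.
Variables (F : pt -> C) (V : topologicalType) (ga : V -> pt) (v0 : V).
Hypotheses (OF : Ohat F) (Zga : forall v, Zhat (ga v)).
Hypothesis c1 : forall j, {for v0, continuous (fun v => (ga v).1 0 j)}.
Hypothesis c2 : forall j, {for v0, continuous (fun v => (ga v).2 0 j)}.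

(** F is controlled only on [Zhat], and its regularity is known only in charts. Hence continuity is
    stated along a map [ga] into [Zhat]: near v0 it stays in one chart domain, and there F is F read
    in the chart, by invariance. *)
Lemma Ohat_continuous : {for v0, continuous (F \o ga)}.
Proof.
have [[mu p0] [nu q0]] := Zhat_neq0 (Zga v0).
have c12 : {for v0, continuous (fun v => chart_map mu nu (ga v))}.
  have h1 : {for v0, continuous (fun v => (chart_map mu nu (ga v)).1)}.
    apply: (@cvg_row C V (nbhs v0)) => j; under eq_fun do rewrite mxE; rewrite mxE.
    by apply: cvgM; [exact: c1|apply: (continuousCV p0); exact: c1].
  have h2 : {for v0, continuous (fun v => (chart_map mu nu (ga v)).2)}.
    apply: (@cvg_row C V (nbhs v0)) => j; under eq_fun do rewrite mxE; rewrite mxE.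
    by apply: cvgM; [exact: c2|apply: (continuousCV q0); exact: c2].
  exact: (cvg_pair h1 h2).
have cF : {for chart_map mu nu (ga v0), continuous (F \o chart_inv mu nu)}.
  apply: differentiable_continuous; apply: OF.2.
  by have [] := chart_mapK (Zga v0) p0 q0.
have /continuousC_eps H := continuous_comp c12 cF.
apply/continuousC_eps => e e0.
have n1 : \forall v \near v0, (ga v).1 0 mu != 0.
  by apply: (near_neq0 _ p0); exact: c1.
have n2 : \forall v \near v0, (ga v).2 0 nu != 0.
  by apply: (near_neq0 _ q0); exact: c2.
apply: filterS (filterI n1 (filterI n2 (H e e0))) => v [pv [qv Hv]].
change (cabs (F (ga v0) - F (ga v)) < e).
rewrite (Ohat_chart OF (Zga v0) p0 q0) (Ohat_chart OF (Zga v) pv qv).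
exact: Hv.
Qed.

End Curve.

Lemma Ohat_cdiff (F : pt -> C) (ga : C -> pt) (w : C) :
  Ohat F -> (forall v, Zhat (ga v)) ->
  (forall j, differentiable (fun v => (ga v).1 0 j) w) ->
  (forall j, differentiable (fun v => (ga v).2 0 j) w) -> cdiff (F \o ga) w.
Proof.
move=> OF Zga d1 d2; apply: differentiable_cdiff.
have [[mu p0] [nu q0]] := Zhat_neq0 (Zga w).
have d12 : differentiable (fun v => chart_map mu nu (ga v)) w.
  apply: differentiable_pair; apply: differentiable_row => j.
    under eq_fun do rewrite mxE.
    by apply: differentiableM; [exact: d1|apply: differentiableV; [exact: d1|exact: p0]].
  under eq_fun do rewrite mxE.
  by apply: differentiableM; [exact: d2|apply: differentiableV; [exact: d2|exact: q0]].
have dF : differentiable (F \o chart_inv mu nu) (chart_map mu nu (ga w)).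
  by apply: OF.2; have [] := chart_mapK (Zga w) p0 q0.
have /derivable1_diffP H := differentiable_comp d12 dF.
apply/derivable1_diffP; apply: near_eq_derivable H.
have n1 := near_neq0 (differentiable_continuous (d1 mu)) p0.
have n2 := near_neq0 (differentiable_continuous (d2 nu)) q0.
apply: filterS2 n1 n2 => v pv qv /=.
by rewrite -Ohat_chart.
Qed.

Definition crow (c : C) (u : 'I_n -> C) : 'rV[C]_n.+1 :=
  \row_j (if unlift ord0 j is Some k then u k else c).

Lemma crow0 c u : crow c u 0 ord0 = c.
Proof. by rewrite mxE unlift_none. Qed.

Lemma crow_lift c u k : crow c u 0 (lift ord0 k) = u k.
Proof. by rewrite mxE liftK. Qed.

Lemma crowP (p : 'rV[C]_n.+1) : p = crow (p 0 ord0) (fun k => p 0 (lift ord0 k)).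
Proof. by apply/rowP => j; rewrite mxE; case: unliftP => [k ->|->]. Qed.

Lemma scale_crow (a c : C) u : a *: crow c u = crow (a * c) (fun k => a * u k).
Proof. by apply/rowP => j; rewrite !mxE; case: unliftP. Qed.

Lemma hformE (p q : 'rV[C]_n.+1) :
  hform p q = - (p 0 ord0 * q 0 ord0) + \sum_(i < n) p 0 (lift ord0 i) * q 0 (lift ord0 i).
Proof.
rewrite /hform big_ord_recl /hsgn eqxx mulN1r mulNr; congr (_ + _).
apply: eq_bigr => i _; rewrite -(inj_eq val_inj) /= mul1r.
by [].
Qed.

Lemma hform_crow a b u v : hform (crow a u) (crow b v) = - (a * b) + \sum_(i < n) u i * v i.
Proof. by rewrite hformE !crow0; congr (_ + _); apply: eq_bigr => i _; rewrite !crow_lift. Qed.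

Definition dotz (z : nat -> C) : C := \sum_(i < n) z i * z (n + i)%N.

(* Global affine coordinates: gq (resp. gp) is a section over {q^0 <> 0}
   (resp. {p^0 <> 0}), normalised by q^0 = 1 (resp. p^0 = 1). *)
Definition gq (z : nat -> C) : pt :=
  (crow (1 + dotz z) (fun i => z i), crow 1 (fun i => z (n + i)%N)).
Definition gp (z : nat -> C) : pt :=
  (crow 1 (fun i => z i), crow (1 + dotz z) (fun i => z (n + i)%N)).

Lemma Zhat_gq z : Zhat (gq z).
Proof. rewrite /Zhat /= hform_crow /dotz; ring. Qed.

Lemma Zhat_gp z : Zhat (gp z).
Proof. rewrite /Zhat /= hform_crow /dotz; ring. Qed.

Lemma dotz_ext z z' : (forall j, (j < n + n)%N -> z j = z' j) -> dotz z = dotz z'.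
Proof.
move=> zz; apply: eq_bigr => i _.
by rewrite !zz // ?ltn_add2l // ltn_addr.
Qed.

Lemma gq_ext z z' : (forall j, (j < n + n)%N -> z j = z' j) -> gq z = gq z'.
Proof.
move=> zz; rewrite /gq (dotz_ext zz); congr (crow _ _, crow _ _); apply/funext => i; apply: zz.
  by rewrite ltn_addr.
by rewrite ltn_add2l.
Qed.

Lemma gp_ext z z' : (forall j, (j < n + n)%N -> z j = z' j) -> gp z = gp z'.
Proof.
move=> zz; rewrite /gp (dotz_ext zz); congr (crow _ _, crow _ _); apply/funext => i; apply: zz.
  by rewrite ltn_addr.
by rewrite ltn_add2l.
Qed.

Lemma gq_of (pq : pt) : Zhat pq -> pq.2 0 ord0 != 0 ->
  exists2 z, z != 0 & cact z pq = gq (fun j =>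
    if insub j is Some i then pq.1 0 (lift ord0 i) * pq.2 0 ord0
    else if insub (j - n)%N is Some i then pq.2 0 (lift ord0 i) / pq.2 0 ord0 else 0).
Proof.
move=> Zpq q0; exists (pq.2 0 ord0) => //; rewrite /cact; set z := (fun j : nat => _).
have zl (i : 'I_n) : z i = pq.1 0 (lift ord0 i) * pq.2 0 ord0 by rewrite /z valK.
have zr (i : 'I_n) : z (n + i)%N = pq.2 0 (lift ord0 i) / pq.2 0 ord0.
  by rewrite /z insubF ?ltnNge ?leq_addr // addKn valK.
rewrite /gq; congr pair; rewrite [LHS]crowP ![X in crow X]mxE.
  congr crow; last by apply/funext => i; rewrite mxE zl mulrC.
  (* Acting by q^0 normalises q^0 to 1; the equation of [Zhat] then forces the zeroth entry of p to
     be 1 + x.y. *)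
  move: Zpq; rewrite /Zhat /= hformE => /eqP; rewrite addrC subr_eq addrC => /eqP E.
  rewrite /dotz (eq_bigr (fun i : 'I_n => pq.1 0 (lift ord0 i) * pq.2 0 (lift ord0 i))); last first.
    by move=> i _; rewrite zl zr; field.
  by rewrite E; ring.
congr crow; first by rewrite mulVf.
by apply/funext => i; rewrite mxE zr mulrC.
Qed.

End Charts.

(** * Taylor expansion and Cauchy estimates in the two global coordinate systems *)

Section Sections.
Variables (R : realType) (n : nat).
Local Notation C := (CC R).
Local Notation pt := (pt R n).
Local Notation d := (n + n)%N.

(** What [gq] and [gp] have in common, so that compactness, Cauchy estimates and Taylor expansion
    are proved once for both. Points of C^{2n} are encoded as sequences, of which only the first 2n
    terms count. *)
Record good_section (ga : (nat -> C) -> pt) : Prop := GoodSection {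
  gsZ : forall z, Zhat (ga z);
  gs_ext : forall z z', (forall j, (j < d)%N -> z j = z' j) -> ga z = ga z';
  gs_cont : forall (V : topologicalType) (v0 : V) (zv : V -> nat -> C),
    (forall j, {for v0, continuous (fun v => zv v j)}) ->
    (forall j, {for v0, continuous (fun v => (ga (zv v)).1 0 j)}) /\
    (forall j, {for v0, continuous (fun v => (ga (zv v)).2 0 j)});
  gs_diff : forall (w0 : C) (zw : C -> nat -> C),
    (forall j, differentiable (fun w => zw w j) w0) ->
    (forall j, differentiable (fun w => (ga (zw w)).1 0 j) w0) /\
    (forall j, differentiable (fun w => (ga (zw w)).2 0 j) w0) }.

Lemma continuous_crow (V : topologicalType) (v0 : V) (c : V -> C) (u : V -> 'I_n -> C) :
  {for v0, continuous c} -> (forall i, {for v0, continuous (fun v => u v i)}) ->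
  forall j, {for v0, continuous (fun v => crow (c v) (u v) 0 j)}.
Proof.
move=> cc cu j; case: (unliftP ord0 j) => [k ->|->].
  have E : (fun v => crow (c v) (u v) 0 (lift ord0 k)) = (fun v => u v k).
    by apply/funext => v; rewrite crow_lift.
  rewrite E; exact: cu.
have E : (fun v => crow (c v) (u v) 0 ord0) = c by apply/funext => v; rewrite crow0.
rewrite E; exact: cc.
Qed.

Lemma differentiable_crow (w0 : C) (c : C -> C) (u : C -> 'I_n -> C) :
  differentiable c w0 -> (forall i, differentiable (fun v => u v i) w0) ->
  forall j, differentiable (fun v => crow (c v) (u v) 0 j) w0.
Proof.
move=> cc cu j; case: (unliftP ord0 j) => [k ->|->].
  under eq_fun do rewrite crow_lift; exact: cu.
by under eq_fun do rewrite crow0; exact: cc.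
Qed.

Lemma continuousC_sum (V : topologicalType) (v0 : V) (I : Type) (s : seq I) (f : I -> V -> C) :
  (forall i, {for v0, continuous (f i)}) ->
  {for v0, continuous (fun v => \sum_(i <- s) f i v)}.
Proof.
move=> cf; elim: s => [|i s IH].
  have E : (fun v => \sum_(i <- [::]) f i v) = cst 0 by apply/funext => v; rewrite big_nil.
  rewrite E; exact: cvg_cst.
have E : (fun v => \sum_(j <- i :: s) f j v) = (fun v => f i v + \sum_(j <- s) f j v).
  by apply/funext => v; rewrite big_cons.
by rewrite E; apply: cvgD; [exact: cf|exact: IH].
Qed.

Lemma continuousC_prod (V : topologicalType) (v0 : V) (I : Type) (s : seq I) (f : I -> V -> C) :
  (forall i, {for v0, continuous (f i)}) ->
  {for v0, continuous (fun v => \prod_(i <- s) f i v)}.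
Proof.
move=> cf; elim: s => [|i s IH].
  have E : (fun v => \prod_(i <- [::]) f i v) = cst 1 by apply/funext => v; rewrite big_nil.
  rewrite E; exact: cvg_cst.
have E : (fun v => \prod_(j <- i :: s) f j v) = (fun v => f i v * \prod_(j <- s) f j v).
  by apply/funext => v; rewrite big_cons.
by rewrite E; apply: cvgM; [exact: cf|exact: IH].
Qed.

Lemma continuousC_X (V : topologicalType) (v0 : V) (f : V -> C) k :
  {for v0, continuous f} -> {for v0, continuous (fun v => f v ^+ k)}.
Proof.
move=> cf; elim: k => [|k IH]; first exact: cvg_cst.
have E : (fun v => f v ^+ k.+1) = (fun v => f v * f v ^+ k).
  by apply/funext => v; rewrite exprS.
by rewrite E; apply: cvgM; [exact: cf|exact: IH].
Qed.

Lemma continuous_dotz (V : topologicalType) (v0 : V) (zv : V -> nat -> C) :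
  (forall j, {for v0, continuous (fun v => zv v j)}) ->
  {for v0, continuous (fun v => 1 + dotz n (zv v))}.
Proof.
move=> cz; apply: cvgD; first exact: cvg_cst.
by apply: continuousC_sum => i; apply: cvgM; exact: cz.
Qed.

Lemma differentiable_dotz (w0 : C) (zw : C -> nat -> C) :
  (forall j, differentiable (fun w => zw w j) w0) ->
  differentiable (fun w => 1 + dotz n (zw w)) w0.
Proof.
move=> dz; apply: differentiableD; first exact: differentiable_cst.
rewrite (_ : (fun w => _) = \sum_(i < n) (fun w => zw w i * zw w (n + i)%N)); last first.
  by apply/funext => w; rewrite fct_sumE.
by apply: differentiable_sum => i; apply: differentiableM.
Qed.

Lemma good_gq : good_section (@gq R n).
Proof.
split.
- exact: Zhat_gq.
- exact: gq_ext.
- move=> V v0 zv cz; split; apply: continuous_crow => //.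
    exact: continuous_dotz.
  exact: cvg_cst.
- move=> w0 zw dz; split; apply: differentiable_crow.
  + exact: differentiable_dotz.
  + by move=> i; exact: dz.
  + exact: differentiable_cst.
  + by move=> i; exact: dz.
Qed.

Lemma good_gp : good_section (@gp R n).
Proof.
split.
- exact: Zhat_gp.
- exact: gp_ext.
- move=> V v0 zv cz; split; apply: continuous_crow => //.
    exact: cvg_cst.
  exact: continuous_dotz.
- move=> w0 zw dz; split; apply: differentiable_crow.
  + exact: differentiable_cst.
  + by move=> i; exact: dz.
  + exact: differentiable_dotz.
  + by move=> i; exact: dz.
Qed.

(** Open saturated sets pull back to open sets along [ga]; saturation then extends a finite subcover
    from the points of [ga] to their whole orbits. *)
Lemma qcompact_image (V : ptopologicalType) (A : set V) (ga : V -> pt) :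
  compact A -> continuous ga -> (forall v, Zhat (ga v)) ->
  qcompact [set pq | exists v c, [/\ A v, c != 0 & pq = cact c (ga v)]].
Proof.
move=> cA cga Zga; split.
  split=> [_ [v [c [Av c0 ->]]]|z z0 _ [v [c [Av c0 ->]]]]; first exact: Zhat_cact.
  by exists v, (z * c); rewrite mulf_neq0 // cactM.
move=> Os Oop KO; have {}cA : cover_compact A by rewrite -compact_cover.
have op O : Os O -> open (ga @^-1` O).
  move=> /Oop[_ [W [Wop ->]]]; rewrite preimage_setI.
  have -> : ga @^-1` (@Zhat R n) = setT by apply/seteqP; split=> // v _; exact: Zga.
  by rewrite setIT; apply: open_comp => // v _; exact: cga.
have [v Av|D DO Dcov] := cA (set pt) Os (fun O => ga @^-1` O) op.
  have [|O OsO Ov] := KO (ga v).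
    by exists v, 1; rewrite oner_neq0 /cact invr1 !scale1r; split => //; case: (ga v).
  by exists O.
exists (finmap.enum_fset D); split.
  by move=> O /DO; rewrite inE.
move=> _ [v [c [Av c0 ->]]]; have [U UD Uv] := Dcov v Av.
exists U => //; have := DO U UD; rewrite inE => /Oop[[_ sat] _].
exact: sat.
Qed.

Variable ga : (nat -> C) -> pt.
Hypothesis gaP : good_section ga.

Let zof (v : 'rV[C]_d) : nat -> C := fun j => if insub j is Some i then v 0 i else 0.

Let zofE v (i : 'I_d) : zof v i = v 0 i.
Proof. by rewrite /zof valK. Qed.

Let zof_cont j : continuous (fun v => zof v j).
Proof.
move=> v; rewrite /zof; case: (insub j) => [i|]; last exact: cst_continuous.
exact: coord_continuous.
Qed.

Let sq (r : R) : set 'rV[C]_d := [set v | forall i, csquare r (v ord0 i)].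

Let compact_sq r : compact (sq r).
Proof.
by apply: (@rV_compact C d (fun=> csquare r)) => j; exact: compact_csquare.
Qed.

Let ga_cont : continuous (fun v => ga (zof v)).
Proof.
move=> v; have [h1 h2] := gs_cont gaP (fun j => @zof_cont j v).
have h1' : {for v, continuous (fun v => (ga (zof v)).1)}.
  by apply: (@cvg_row C _ (nbhs v)) => j; exact: h1.
have h2' : {for v, continuous (fun v => (ga (zof v)).2)}.
  by apply: (@cvg_row C _ (nbhs v)) => j; exact: h2.
rewrite (_ : (fun v => ga (zof v)) = (fun v => ((ga (zof v)).1, (ga (zof v)).2))).
  exact: (cvg_pair h1' h2').
by apply/funext => v'; case: (ga _).
Qed.

Definition Ksec (r : R) : set pt := [set pq | exists v c,
  [/\ (forall i : 'I_d, csquare r ((v : 'rV[C]_d) ord0 i)), c != 0 &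
      pq = cact c (ga (fun j => if insub j is Some i then v 0 i else 0))]].

Lemma qcompact_Ksec r : qcompact (Ksec r).
Proof.
exact: (qcompact_image (@compact_sq r) ga_cont (fun v => gsZ gaP (zof v))).
Qed.

Lemma ga_zof z : ga z = ga (zof (\row_i z i)).
Proof.
apply: (gs_ext gaP) => j jd.
by have := zofE (\row_i z i) (Ordinal jd); rewrite mxE => <-.
Qed.

Lemma Ksec_ga r z : (forall j, (j < d)%N -> cabs (z j) <= r) -> Ksec r (ga z).
Proof.
move=> zr; exists (\row_i z i), 1; split; first last.
- by rewrite ga_zof /cact invr1 !scale1r; case: (ga _).
- exact: oner_neq0.
- by move=> i; rewrite mxE; apply: csquareP; exact: zr.
Qed.

Variable F : pt -> C.
Hypothesis OF : Ohat F.

Lemma Ksec_bounded r : exists M : R, forall pq, Ksec r pq -> cabs (F pq) <= M.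
Proof.
have cFg v : {for v, continuous (F \o (fun v => ga (zof v)))}.
  have [h1 h2] := gs_cont gaP (fun j => @zof_cont j v).
  by apply: Ohat_continuous => // v'; exact: gsZ.
have [M HM] := compact_bounded (@compact_sq r) (fun v _ => cFg v).
exists M => _ [v [c [hv c0 ->]]].
rewrite OF.1 //; first exact: HM.
exact: gsZ.
Qed.

Lemma section_cdiff z j w : cdiff (fun w => F (ga (upd z j w))) w.
Proof.
apply: (Ohat_cdiff (ga := fun w => ga (upd z j w)) OF) => [v|i|i]; first exact: gsZ.
- apply: (gs_diff gaP _).1 => k; rewrite /upd; case: (k == j) => //.
- apply: (gs_diff gaP _).2 => k; rewrite /upd; case: (k == j) => //.
Qed.

Lemma section_tame (r : R) z : tame d (fun th => F (ga (merge d (circ r th) z))).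
Proof.
pose zt (v : 'rV[R]_d) : nat -> C := fun j =>
  if insub j is Some i then r%:C%C * cexpi (v 0 i) else z j.
have -> : (fun th => F (ga (merge d (circ r th) z))) =
          (fun th => (F \o (fun v => ga (zt v))) (\row_j th j)).
  apply/funext => th; congr F; apply: (gs_ext gaP) => j jd.
  rewrite /merge jd /zt /circ; have -> : insub j = Some (Ordinal jd) by exact: insubT.
  by rewrite mxE.
apply: tame_continuous => v.
have cz j : {for v, continuous (fun v => zt v j)}.
  rewrite /zt; case: (insub j) => [i|]; last exact: cst_continuous.
  have hc := continuous_comp (@coord_continuous R 1 d 0 i v) (@continuous_cexpi R (v 0 i)).
  exact: (cvgM (cvg_cst (r%:C%C : C)) hc).
have [h1 h2] := gs_cont gaP cz.
by apply: Ohat_continuous => // v'; exact: gsZ.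
Qed.

Definition seccoef (r : R) (a : nat -> nat) : C :=
  tcoef r d (fun th => F (ga (merge d (circ r th) (fun=> 0)))) a.

Lemma seccoef_ext r a b : (forall j, (j < d)%N -> a j = b j) -> seccoef r a = seccoef r b.
Proof.
move=> ab; congr (_ * _); apply: tint_ext => th _; congr (_ * _^-1).
by apply: eq_bigr => j _; rewrite ab.
Qed.

Lemma seccoef_le (r M : R) a : 0 < r -> (forall pq, Ksec r pq -> cabs (F pq) <= M) ->
  cabs (seccoef r a) <= 2 ^+ d * M / r ^+ asize d a.
Proof.
move=> r0 HM; apply: tcoef_le => //; first exact: section_tame.
move=> th _; apply: HM; apply: Ksec_ga => j jd; rewrite /merge jd.
by rewrite cabs_circ.
Qed.

Lemma section_taylor : exists2 c : R, 0 <= c & forall (r M : R) z N, 0 < r ->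
  (forall pq, Ksec r pq -> cabs (F pq) <= M) ->
  (forall j, (j < d)%N -> cabs (z j) <= r / 2) ->
  cabs (F (ga z) - \sum_(a <- box N d) mon d z a * seccoef r a) <= c * M / 2 ^+ N.
Proof.
have [c c0 Hc] := taylor R d; exists c => // r M z N r0 HM zr.
have := Hc (fun z => F (ga z)) z M r N r0 zr.
have -> : (fun th => F (ga (merge d (circ r th) z))) =
          (fun th => F (ga (merge d (circ r th) (fun=> 0)))).
  by apply/funext => th; congr F; apply: (gs_ext gaP) => j jd; rewrite /merge jd.
apply.
- by move=> z' j w _; exact: section_cdiff.
- exact: section_tame.
- by move=> z' hz' _; apply: HM; exact: Ksec_ga.
Qed.

Lemma half_pow_le0 (x A : R) N0 : (forall N, (N0 <= N)%N -> x <= A / 2 ^+ N) -> x <= 0.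
Proof.
move=> H; rewrite leNgt; apply/negP => x0.
have [k hk] : exists k : nat, A / x < k%:R.
  exists (Num.bound `|A / x|); apply: (le_lt_trans (ler_norm _)); exact: archi_boundP.
have := H _ (leq_maxl N0 k); apply/negP; rewrite -ltNge.
rewrite ltr_pdivrMr ?exprn_gt0 // mulrC -ltr_pdivrMr //.
apply: (lt_le_trans hk); rewrite -natrX ler_nat.
by apply: (leq_trans (leq_maxr N0 k)); exact: ltnW (ltn_expl _ _).
Qed.

(** The torus of radius r1 lies where the Taylor polynomials with the coefficients of radius r2
    converge uniformly. Extracting the coefficient a at radius r1 gives [seccoef r2 a] from each
    large enough polynomial, and [seccoef r1 a] in the limit. *)
Let indep_le (r1 r2 : R) a : 0 < r1 -> r1 <= r2 / 2 -> seccoef r1 a = seccoef r2 a.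
Proof.
move=> r10 r12; have r20 : 0 < r2 by lra.
have [c c0 Hc] := section_taylor.
have [M HM] := Ksec_bounded r2.
pose h th := F (ga (merge d (circ r1 th) (fun=> 0))).
pose S N th := \sum_(b <- box N d) seccoef r2 b * mon d (circ r1 th) b.
have tS N : tame d (S N).
  by apply: tame_sum => b; apply: tameM; [exact: tame_cst|exact: tame_mon].
have coefS N : (forall j, (j < d)%N -> (a j < N)%N) -> tcoef r1 d (S N) a = seccoef r2 a.
  move=> aN; rewrite /S tcoef_sum; last first.
    by move=> b; apply: tameM; [exact: tame_cst|exact: tame_mon].
  rewrite (eq_bigr (fun b => seccoef r2 b * tcoef r1 d (fun th => mon d (circ r1 th) b) a)); last first.
    by move=> b _; rewrite tcoefZ //; exact: tame_mon.
  rewrite (box_sum_delta aN).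
  - by rewrite tcoef_mon_eq // mulr1.
  - move=> b ba; rewrite (seccoef_ext r2 ba) tcoef_mon_eq // tcoef_mon_eq //.
  - by move=> b j jd ba; rewrite (tcoef_mon_neq r10 jd ba) mulr0.
apply/eqP; rewrite -subr_eq0; apply/eqP/cabs0P/eqP; rewrite eq_le cabs_ge0 andbT.
have [N0 HN0] : exists N0, forall j, (j < d)%N -> (a j < N0)%N.
  exists (\sum_(j < d) a j).+1 => j jd.
  by rewrite ltnS (bigD1 (Ordinal jd)) //= leq_addr.
apply: (@half_pow_le0 _ (2 ^+ d * (c * M) / r1 ^+ asize d a) N0) => N NN0.
rewrite -(coefS N); last by move=> j /HN0 jN; exact: leq_trans jN NN0.
rewrite /seccoef -tcoefB //; last exact: section_tame.
have -> : 2 ^+ d * (c * M) / r1 ^+ asize d a / 2 ^+ N =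
          2 ^+ d * (c * M / 2 ^+ N) / r1 ^+ asize d a by ring.
apply: tcoef_le => //; first by apply: tameB => //; exact: section_tame.
move=> th _; have -> : S N th = \sum_(b <- box N d)
    mon d (merge d (circ r1 th) (fun=> 0)) b * seccoef r2 b.
  apply: eq_bigr => b _; rewrite mulrC; congr (_ * _).
  by apply: eq_bigr => j _; rewrite /merge ltn_ord.
by apply: Hc => // j jd; rewrite /merge jd cabs_circ.
Qed.

Lemma seccoef_indep (r r' : R) a : 0 < r -> 0 < r' -> seccoef r a = seccoef r' a.
Proof.
(* Both radii are at most half of the common radius 2 (r + r'). *)
move=> r0 r'0; rewrite (@indep_le r (2 * (r + r'))) ?(@indep_le r' (2 * (r + r'))) //; lra.
Qed.

End Sections.

(** * Weights under C^*, and the comparison of the two Taylor series *)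

Section Weights.
Variables (R : realType) (n : nat).
Local Notation C := (CC R).
Local Notation pt := (pt R n).
Local Notation d := (n + n)%N.
Local Notation pi2 := (pi *+ 2 : R).
Implicit Types (z : nat -> C) (a : nat -> nat).

Definition lft a : mindex n := fun i => a i.
Definition rgt a : mindex n := fun i => a (n + i)%N.

Lemma mon_split z a :
  mon d z a = \prod_(i < n) z i ^+ lft a i * \prod_(i < n) z (n + i)%N ^+ rgt a i.
Proof. by rewrite /mon big_split_ord. Qed.

Lemma asize_split a : asize d a = (msize (lft a) + msize (rgt a))%N.
Proof. by rewrite /asize big_split_ord. Qed.

(** For zeta <> 0 this is the automorphism p^0 -> zeta p^0, q^0 -> q^0 / zeta of \hat D_n, given by
    the same formula in the coordinates of [gq] and of [gp]. It differs from [cact], which is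
    already divided out: F varies along its orbits. *)
Definition wz (zeta : C) z : nat -> C :=
  fun j => if (j < n)%N then zeta^-1 * z j else zeta * z j.

Lemma wz_l zeta z (i : 'I_n) : wz zeta z i = zeta^-1 * z i.
Proof. by rewrite /wz ltn_ord. Qed.

Lemma wz_r zeta z (i : 'I_n) : wz zeta z (n + i)%N = zeta * z (n + i)%N.
Proof. by rewrite /wz ltnNge leq_addr. Qed.

Lemma prod_exp (c : C) (P : mindex n) : \prod_(i < n) c ^+ P i = c ^+ msize P.
Proof. by rewrite prodrXr. Qed.

Lemma mon_wz zeta z a :
  mon d (wz zeta z) a = zeta^-1 ^+ msize (lft a) * zeta ^+ msize (rgt a) * mon d z a.
Proof.
rewrite !mon_split -!prod_exp.
rewrite (eq_bigr (fun i : 'I_n => zeta^-1 ^+ lft a i * z i ^+ lft a i)); last first.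
  by move=> i _; rewrite wz_l exprMn.
rewrite big_split /= [X in _ * X = _](eq_bigr (fun i : 'I_n =>
    zeta ^+ rgt a i * z (n + i)%N ^+ rgt a i)); last first.
  by move=> i _; rewrite wz_r exprMn.
by rewrite big_split /= mulrACA.
Qed.

Lemma dotz_wz zeta z : zeta != 0 -> dotz n (wz zeta z) = dotz n z.
Proof.
move=> z0; apply: eq_bigr => i _; rewrite wz_l wz_r; field.
exact: z0.
Qed.

Lemma wzC (u v : C) z : wz u (wz v z) = wz v (wz u z).
Proof. by apply/funext => j; rewrite /wz; case: (j < n)%N; rewrite mulrCA. Qed.

(** The change from [gq] to [gp] coordinates is itself a weight action, with zeta = 1 + x.y = p^0
    q^0. *)
Lemma gp_gq z : 1 + dotz n z != 0 ->
  gp n (wz (1 + dotz n z) z) = cact (1 + dotz n z)^-1 (gq n z).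
Proof.
move=> l0; rewrite /gp /gq /cact dotz_wz //= !scale_crow invrK mulr1 mulVf //.
congr (crow _ _, crow _ _); apply/funext => i; first by rewrite wz_l.
by rewrite wz_r.
Qed.

Let ze (t : R) : C := 2%:C%C * cexpi t.

Let abs_ze t : cabs (ze t) = 2.
Proof. by rewrite cabsM cabs_real cabs_cexpi mulr1 gtr0_norm. Qed.

Let ze0 t : ze t != 0.
Proof. by rewrite -cabs_gt0 abs_ze. Qed.

Let one2 : cabs (1 : C) < 2.
Proof. by rewrite cabs1 ltr1n. Qed.

Let ze1 t : ze t - 1 != 0.
Proof. by have [] := cauchy_kernel_bound t one2. Qed.

Lemma cdiffX k (w : C) : cdiff (fun w => w ^+ k) w.
Proof. by apply: differentiable_cdiff; apply/derivable1_diffP; exact: exprn_derivable. Qed.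

(* [1 / (zeta - 1)] separates the positive powers of [zeta] from the others. *)
Lemma cint_weight_kernel (a b : nat) :
  cint (fun t => (ze t)^-1 ^+ a * ze t ^+ b * (ze t - 1)^-1) =
  if (a < b)%N then pi2%:C%C else 0.
Proof.
case: ltnP => [ab|ba].
  have := @cauchy_circle R (fun w => w ^+ (b - a).-1) 2 1 (cdiffX _) one2.
  rewrite expr1n mulr1 => <-; congr cint; apply/funext => t.
  rewrite -/(ze t).
  have -> : ze t ^+ b = ze t ^+ a * (ze t ^+ (b - a).-1 * ze t).
    by rewrite -exprSr prednK ?subn_gt0 // -exprD subnKC // ltnW.
  rewrite !mulrA exprVn mulVf ?expf_neq0 // mul1r.
  by [].
(* For b <= a the integrand is zeta^-(a-b+1) zeta/(zeta - 1), whose exponent a - b + 1 is positive,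
   so the integral vanishes. For a < b it was Cauchy's formula for w^(b-a-1) at the point 1. *)
have := @cint_kernelX R 2 1 (a - b).+1 one2.
rewrite /= => <-; congr cint; apply/funext => t; rewrite -/(ze t) div1r.
have -> : (ze t)^-1 ^+ a = (ze t)^-1 ^+ (a - b) * (ze t)^-1 ^+ b by rewrite -exprD subnK.
have e1 : (ze t)^-1 ^+ b * ze t ^+ b = 1 by rewrite -exprMn mulVf ?ze0 // expr1n.
rewrite exprSr -(mulrA _ _ (ze t ^+ b)) e1 mulr1.
move: ((ze t)^-1 ^+ (a - b)) (ze0 t) (ze1 t) => q; move: (ze t) => x x0 x1.
by field; rewrite x0 x1.
Qed.

Variable F : pt -> C.
Hypothesis OF : Ohat F.

Definition cq := seccoef (@gq R n) F 1.
Definition cp := seccoef (@gp R n) F 1.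

Lemma mixed_expansion z : 1 + dotz n z != 0 -> exists A : R, forall N,
  cabs (F (gq n z) - \sum_(a <- box N d)
     (if (msize (rgt a) <= msize (lft a))%N then mon d z a * cq a
      else mon d (wz (1 + dotz n z) z) a * cp a)) <= A / 2 ^+ N.
Proof.
set lam := 1 + dotz n z => l0; pose z' := wz lam z.
(* Acting by zeta with zeta = 1 or |zeta| = 2 at most doubles a coordinate, so z and z' stay within
   the radius r / 2 required by [section_taylor]. *)
pose r : R := 4 * \sum_(j < d) (cabs (z j) + cabs (z' j)) + 1.
have S0 (j : nat) : (j < d)%N -> cabs (z j) + cabs (z' j) <= \sum_(j < d) (cabs (z j) + cabs (z' j)).
  move=> jd; rewrite (bigD1 (Ordinal jd)) //= lerDl sumr_ge0 // => i _.
  by rewrite addr_ge0 ?cabs_ge0.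
have r0 : 0 < r.
  by rewrite ltr_wpDl // mulr_ge0 // sumr_ge0 // => i _; rewrite addr_ge0 ?cabs_ge0.
have wle (zeta : C) (x : nat -> C) j : zeta = 1 \/ cabs zeta = 2 -> cabs (wz zeta x j) <= 2 * cabs (x j).
  have x0 := cabs_ge0 (x j).
  case=> [->|h]; rewrite /wz; case: ifP => _; rewrite cabsM ?cabsV ?h ?cabs1; lra.
have zr zeta j : zeta = 1 \/ cabs zeta = 2 -> (j < d)%N -> cabs (wz zeta z j) <= r / 2.
  move=> hz jd; apply: (le_trans (wle _ _ _ hz)).
  have := S0 j jd; have := cabs_ge0 (z j); have := cabs_ge0 (z' j); rewrite /r; lra.
have zr' zeta j : zeta = 1 \/ cabs zeta = 2 -> (j < d)%N -> cabs (wz zeta z' j) <= r / 2.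
  move=> hz jd; apply: (le_trans (wle _ _ _ hz)).
  have := S0 j jd; have := cabs_ge0 (z j); have := cabs_ge0 (z' j); rewrite /r; lra.
have [Mq HMq] := Ksec_bounded (good_gq R n) OF r.
have [Mp HMp] := Ksec_bounded (good_gp R n) OF r.
have [kq kq0 Hq] := section_taylor (good_gq R n) OF.
have [kp kp0 Hp] := section_taylor (good_gp R n) OF.
pose Sq N zeta := \sum_(a <- box N d) mon d (wz zeta z) a * cq a.
pose Sp N zeta := \sum_(a <- box N d) mon d (wz zeta z') a * cp a.
have hq N zeta : zeta = 1 \/ cabs zeta = 2 ->
    cabs (F (gq n (wz zeta z)) - Sq N zeta) <= kq * Mq / 2 ^+ N.
  move=> hz; have := Hq r Mq (wz zeta z) N r0 HMq (fun j => zr zeta j hz).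
  congr (cabs (_ - _) <= _); apply: eq_bigr => a _; congr (_ * _).
  exact: (seccoef_indep (good_gq R n) OF).
have hp N zeta : zeta = 1 \/ cabs zeta = 2 ->
    cabs (F (gq n (wz zeta z)) - Sp N zeta) <= kp * Mp / 2 ^+ N.
  move=> hz; have := Hp r Mp (wz zeta z') N r0 HMp (fun j => zr' zeta j hz).
  have zn0 : zeta != 0 by rewrite -cabs_gt0; case: hz => ->; rewrite ?cabs1.
  have lE : lam = 1 + dotz n (wz zeta z) by rewrite dotz_wz.
  (* Weight actions commute and preserve x.y, so [wz zeta z'] are the [gp] coordinates of the very
     point with [gq] coordinates [wz zeta z]: both series approximate the same value of F. *)
  rewrite /z' wzC {1}lE gp_gq -?lE // OF.1 ?invr_eq0 //; last exact: Zhat_gq.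
  congr (cabs (_ - _) <= _); apply: eq_bigr => a _; congr (_ * _).
    by rewrite wzC.
  exact: (seccoef_indep (good_gp R n) OF).
pose E := kq * Mq + kp * Mp.
exists (kq * Mq + 2 * E) => N.
pose del a := mon d z' a * cp a - mon d z a * cq a.
(* D is the error made by exchanging the terms with |P| < |Q| at zeta = 1. The kernel expresses it
   through the difference of the two series on |zeta| = 2, which is small because both are close to
   F there. *)
pose D := \sum_(a <- box N d) (if (msize (lft a) < msize (rgt a))%N then del a else 0).
have wz1 x : wz 1 x = x by apply/funext => j; rewrite /wz invr1 !mul1r; case: ifP.
have -> : \sum_(a <- box N d) (if (msize (rgt a) <= msize (lft a))%N then mon d z a * cq a
      else mon d z' a * cp a) = Sq N 1 + D.
  rewrite /Sq /D -big_split /= wz1; apply: eq_bigr => a _.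
  rewrite ltnNge /del; case: leqP => _ /=; first by rewrite addr0.
  by rewrite addrC subrK.
have ci : icont 0 pi2 (fun t => (ze t - 1)^-1).
  apply: icont_continuous => t _; apply: (@continuousCV _ _ (fun t => ze t - 1)) => //.
  exact: (cvgB (@continuous_circle R 2 t) (cvg_cst (1 : C))).
have cz : icont 0 pi2 ze by exact: icont_circle.
have cV : icont 0 pi2 (fun t => (ze t)^-1).
  by apply: icont_continuous => t _; apply: continuousCV => //; exact: continuous_circle.
have cw (i j : nat) : icont 0 pi2 (fun t => (ze t)^-1 ^+ i * ze t ^+ j * (ze t - 1)^-1).
  by apply: icontM => //; apply: icontM; exact: icontX.
have PsiE t : (Sp N (ze t) - Sq N (ze t)) * (ze t - 1)^-1 = \sum_(a <- box N d)
    del a * ((ze t)^-1 ^+ msize (lft a) * ze t ^+ msize (rgt a) * (ze t - 1)^-1).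
  rewrite /Sp /Sq -sumrB mulr_suml; apply: eq_bigr => a _.
  rewrite (mon_wz (ze t) z' a) (mon_wz (ze t) z a) /del.
  by move: (mon d z' a) (mon d z a) ((ze t - 1)^-1) => p q s; ring.
have DE : pi2%:C%C * D = cint (fun t => (Sp N (ze t) - Sq N (ze t)) * (ze t - 1)^-1).
  under eq_fun do rewrite PsiE.
  rewrite cintE cintab_sum; last by move=> a; apply: icontM => //; exact: icont_cst.
  rewrite mulr_sumr; apply: eq_bigr => a _.
  rewrite cintabZ // -cintE cint_weight_kernel; case: ifP => _; rewrite ?mulr0 //.
  exact: mulrC.
have cPsi : icont 0 pi2 (fun t => (Sp N (ze t) - Sq N (ze t)) * (ze t - 1)^-1).
  under eq_fun do rewrite PsiE.
  by apply: icont_sum => a; apply: icontM => //; exact: icont_cst.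
have E1 : kp * Mp / 2 ^+ N + kq * Mq / 2 ^+ N = E / 2 ^+ N by rewrite /E; ring.
have Dle : cabs D <= 2 * E / 2 ^+ N.
  have h : cabs (pi2%:C%C * D) <= 2 * (pi2 - 0) * (E / 2 ^+ N * 1).
    rewrite DE cintE; apply: cintab_le => //; first exact: pi2_ge0.
    move=> t _; rewrite cabsM; apply: ler_pM; rewrite ?cabs_ge0 //.
      rewrite -E1; apply: (le_trans (cabs_le_dist _ (F (gq n (wz (ze t) z))) _)).
      by rewrite lerD // ?(cabsB (Sp _ _)) ?hp ?hq //; right.
    (* On |zeta| = 2 one has |zeta - 1| >= 1. *)
    rewrite cabsV invf_le1 ?cabs_gt0 //.
    have := cabsD (ze t - 1) 1; rewrite subrK abs_ze cabs1; lra.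
  move: h; rewrite cabsM cabs_real (gtr0_norm (pi2_gt0 R)) subr0 mulr1.
  have -> : 2 * pi2 * (E / 2 ^+ N) = pi2 * (2 * E / 2 ^+ N) by ring.
  by rewrite ler_pM2l // pi2_gt0.
rewrite opprD addrA; apply: (le_trans (cabsD _ _)); rewrite cabsN.
have H := hq N 1 (or_introl erefl); rewrite wz1 in H.
have -> : (kq * Mq + 2 * E) / 2 ^+ N = kq * Mq / 2 ^+ N + 2 * E / 2 ^+ N by ring.
exact: lerD H Dle.
Qed.

End Weights.

(** * Convergence of the expansion *)

Section BoxSums.

Lemma box_cat (V : nmodType) N k m (h : (nat -> nat) -> V) :
  \sum_(a <- box N (k + m)) h a =
  \sum_(a <- box N k) \sum_(b <- box N m) h (merge k a (fun j => b (j - k)%N)).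
Proof.
elim: m h => [|m IH] h.
  rewrite addn0; have bk a : a \in box N k -> forall j, (k <= j)%N -> a j = 0%N.
    elim: k {h} a => [|k IHk] a; first by rewrite /= inE => /eqP ->.
    move=> /allpairsP[[i b] [/= _ bb ->]] j kj; rewrite /upd gtn_eqF //.
    by apply: IHk => //; exact: ltnW.
  apply: eq_big_seq => a ab; rewrite big_seq1; congr h; apply/funext => j.
  by rewrite /merge; case: ltnP => // kj; exact: bk.
rewrite addnS box_sumS.
under [RHS]eq_bigr do rewrite box_sumS.
rewrite [RHS]exchange_big; apply: eq_bigr => i _; rewrite IH.
apply: eq_bigr => a _; apply: eq_bigr => b _; congr h; apply/funext => j.
rewrite /upd /merge; case: ltnP => jk.
  by rewrite ltn_eqF // (leq_trans jk) // leq_addr.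
by rewrite -(eqn_add2l k (j - k)) subnKC.
Qed.

(** Passes from finite functions to the recursive enumeration [box]; [ord_max] is the coordinate
    split off, since [box] peels the largest index. *)
Lemma ffun_box (V : nmodType) N k (h : ('I_k -> nat) -> V) :
  \sum_(f : {ffun 'I_k -> 'I_N}) h (fun i => nat_of_ord (f i)) =
  \sum_(a <- box N k) h (fun i => a i).
Proof.
elim: k h => [|k IH] h.
  rewrite big_seq1 (eq_bigr (fun=> h (fun=> 0%N))); last first.
    by move=> f _; congr h; apply/funext => -[].
  by rewrite sumr_const card_ffun !card_ord expn0.
rewrite box_sumS.
pose ext (p : 'I_N * {ffun 'I_k -> 'I_N}) : {ffun 'I_k.+1 -> 'I_N} :=
  [ffun j => if unlift ord_max j is Some j' then p.2 j' else p.1].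
pose res (f : {ffun 'I_k.+1 -> 'I_N}) : 'I_N * {ffun 'I_k -> 'I_N} :=
  (f ord_max, [ffun j => f (lift ord_max j)]).
rewrite (reindex ext) /=; last first.
  apply: onW_bij; exists res => [[i f]|f].
    rewrite /res /ext ffunE unlift_none /=; congr pair; apply/ffunP => j.
    by rewrite !ffunE liftK.
  by apply/ffunP => j; rewrite !ffunE; case: unliftP => [j' ->|->] //; rewrite ffunE.
rewrite -(pair_bigA_idem _ (fun i f => h (fun j => nat_of_ord (ext (i, f) j)))) /=; last exact: addr0.
apply: eq_bigr => i _.
pose h' (b : 'I_k -> nat) := h (fun j => if unlift ord_max j is Some j' then b j' else i).
transitivity (\sum_(f : {ffun 'I_k -> 'I_N}) h' (fun j => nat_of_ord (f j))).
  apply: eq_bigr => f _; congr h; apply/funext => j; rewrite ffunE /=.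
  by case: unliftP.
rewrite IH; apply: eq_bigr => a _; congr h; apply/funext => j.
rewrite /upd; case: unliftP => [j' ->|->] /=; last by rewrite eqxx.
by rewrite /bump leqNgt ltn_ord add0n ltn_eqF.
Qed.

Lemma boxsum_box n (V : nmodType) N (g : mindex n -> mindex n -> V) :
  boxsum N g = \sum_(a <- box N (n + n)) g (lft a) (rgt a).
Proof.
rewrite /boxsum box_cat.
rewrite (ffun_box N (fun P => \sum_(Q : {ffun 'I_n -> 'I_N}) g P (fun i => nat_of_ord (Q i)))).
apply: eq_bigr => a _; rewrite (ffun_box N (g (fun i => a i))).
apply: eq_bigr => b _; congr (g _ _); apply/funext => i.
  by rewrite /lft /merge ltn_ord.
by rewrite /rgt /merge ltnNge leq_addr addKn.
Qed.

Definition ibox (N k : nat) (a : nat -> nat) : bool := [forall j : 'I_k, (a j < N)%N].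

Lemma iboxS N k a i : ibox N k.+1 (upd a k i) = (i < N)%N && ibox N k a.
Proof.
apply/forallP/andP => [H|[iN /forallP H] j].
  split; first by have := H ord_max; rewrite updE.
  apply/forallP => j; have /= := H (widen_ord (leqnSn k) j).
  by rewrite (upd_lt a i (ltn_ord j)).
case: (eqVneq (j : nat) k) => [->|jk]; first by rewrite updE.
have jk' : (j < k)%N by rewrite ltn_neqAle jk -ltnS ltn_ord.
by rewrite upd_lt //; exact: (H (Ordinal jk')).
Qed.

(** Puts sums over two boxes on one index set, so that tails can be compared term by term. *)
Lemma box_widen (V : nmodType) N N' k (g : (nat -> nat) -> V) : (N <= N')%N ->
  \sum_(a <- box N k) g a = \sum_(a <- box N' k) (if ibox N k a then g a else 0).
Proof.
move=> NN'; elim: k g => [|k IH] g.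
  by rewrite !big_seq1 (_ : ibox N 0 _ = true) //; apply/forallP => -[].
rewrite !box_sumS (big_ord_widen N' (fun i => \sum_(a <- box N k) g (upd a k i)) NN').
rewrite big_mkcond; apply: eq_bigr => i _; case: ifP => iN.
  by rewrite IH; apply: eq_bigr => a _; rewrite iboxS iN.
by rewrite big1 // => a _; rewrite iboxS iN.
Qed.

Variable R : realType.

Lemma box_diff_le (f : (nat -> nat) -> CC R) (w : (nat -> nat) -> R) N N' k :
  (N <= N')%N -> (forall a, cabs (f a) <= w a) ->
  cabs (\sum_(a <- box N' k) f a - \sum_(a <- box N k) f a) <=
  \sum_(a <- box N' k) w a - \sum_(a <- box N k) w a.
Proof.
move=> NN' fw; rewrite !(box_widen _ _ NN') -!sumrB.
apply: (le_trans (cabs_sum _ _ _)); apply: ler_sum => a _.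
by case: ifP => _; rewrite ?subrr ?cabs0 // !subr0.
Qed.

Lemma box_diff_ler (u v : (nat -> nat) -> R) N N' k :
  (N <= N')%N -> (forall a, u a <= v a) ->
  \sum_(a <- box N' k) u a - \sum_(a <- box N k) u a <=
  \sum_(a <- box N' k) v a - \sum_(a <- box N k) v a.
Proof.
move=> NN' uv; rewrite !(box_widen _ _ NN') -!sumrB.
by apply: ler_sum => a _; case: ifP => _; rewrite ?subrr // !subr0.
Qed.

Lemma box_geo N k : \sum_(a <- box N k) (2 : R) ^- asize k a = (2 - 2 * 2 ^- N) ^+ k.
Proof.
have geo : \sum_(i < N) (2 : R) ^- i = 2 - 2 * 2 ^- N.
  elim: N => [|N IH]; first by rewrite big_ord0 expr0 invr1; ring.
  by rewrite big_ord_recr /= IH exprS invfM; field; rewrite expf_neq0.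
elim: k => [|k IH]; first by rewrite big_seq1 /asize big_ord0 expr0 invr1.
rewrite box_sumS exprSr -{2}geo mulr_sumr; apply: eq_bigr => i _.
rewrite -IH mulr_suml; apply: eq_bigr => a _.
rewrite asize_recr updE exprD invfM; congr (2 ^- _ * _).
by apply: eq_bigr => j _; rewrite upd_lt.
Qed.

Lemma bernoulli_le (x : R) k : 0 <= x -> x <= 1 -> 1 - k%:R * x <= (1 - x) ^+ k.
Proof.
move=> x0 x1; elim: k => [|k IH]; first by rewrite expr0 mul0r subr0.
rewrite exprS -natr1; apply: (@le_trans _ _ ((1 - x) * (1 - k%:R * x))).
  have : 0 <= k%:R * x * x by rewrite !mulr_ge0.
  have -> : (1 - x) * (1 - k%:R * x) = 1 - (k%:R + 1) * x + k%:R * x * x by ring.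
  by rewrite lerDl.
by rewrite ler_wpM2l // subr_ge0.
Qed.

(** By [box_geo] the difference is 2^k ((1 - 2^-N')^k - (1 - 2^-N)^k); the first power is at most 1
    and Bernoulli's inequality handles the second. *)
Lemma box_geo_tail N N' k : (N <= N')%N ->
  \sum_(a <- box N' k) (2 : R) ^- asize k a - \sum_(a <- box N k) 2 ^- asize k a <=
  2 ^+ k * k%:R / 2 ^+ N.
Proof.
move=> NN'; rewrite !box_geo.
have h M : (2 : R) - 2 * 2 ^- M = 2 * (1 - 2 ^- M) by ring.
have p M : 0 <= (2 : R) ^- M by rewrite invr_ge0 exprn_ge0.
have q M : (2 : R) ^- M <= 1 by rewrite invf_le1 ?exprn_gt0 // exprn_ege1 // ler1n.
rewrite !h !exprMn -mulrBr -mulrA ler_pM2l ?exprn_gt0 //.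
have h1 : (1 - 2 ^- N' : R) ^+ k <= 1 by rewrite exprn_ile1 ?subr_ge0 // gerBl.
have := bernoulli_le k (p N) (q N); lra.
Qed.

Lemma box_geo_le N k : \sum_(a <- box N k) (2 : R) ^- asize k a <= 2 ^+ k.
Proof.
rewrite box_geo lerXn2r ?nnegrE //; last by rewrite gerBl mulr_ge0 // invr_ge0 exprn_ge0.
rewrite subr_ge0 -[X in _ <= X]mulr1 ler_pM2l // invf_le1 ?exprn_gt0 //.
by rewrite exprn_ege1 // ler1n.
Qed.

End BoxSums.

(** * Bounds on the fundamental monomials and uniform convergence of the series *)

Section Expansion.
Variables (R : realType) (n : nat).
Local Notation C := (CC R).
Local Notation pt := (pt R n).
Local Notation d := (n + n)%N.
Local Notation lft := (@lft n).
Local Notation rgt := (@rgt n).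
Implicit Types (P Q : mindex n) (pq : pt).

Lemma near_forall2 (T : topologicalType) (x : T) (I J : finType) (P : I -> J -> T -> Prop) :
  (forall i j, nbhs x (P i j)) -> nbhs x (fun t => forall i j, P i j t).
Proof.
move=> H; have H1 i : nbhs x (fun t => forall j, P i j t).
  by apply: filter_forall; exact: H.
exact: filter_forall H1.
Qed.

Lemma fhatE P Q pq : fhat P Q pq =
  pq.1 0 ord0 ^+ (maxn (msize P) (msize Q) - msize P) *
  pq.2 0 ord0 ^+ (maxn (msize P) (msize Q) - msize Q) *
  (\prod_(i < n) pq.1 0 (lift ord0 i) ^+ P i * \prod_(i < n) pq.2 0 (lift ord0 i) ^+ Q i).
Proof. by rewrite /fhat big_split. Qed.

Lemma prod_scale (c : C) (u : 'I_n -> C) P :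
  \prod_(i < n) (c * u i) ^+ P i = c ^+ msize P * \prod_(i < n) u i ^+ P i.
Proof. by rewrite -(prod_exp c P) -big_split; apply: eq_bigr => i _; rewrite exprMn. Qed.

Lemma fhat_cact P Q (c : C) pq : c != 0 -> fhat P Q (cact c pq) = fhat P Q pq.
Proof.
move=> c0; rewrite !fhatE /cact /= !mxE.
under eq_bigr do rewrite mxE.
under [X in _ * (_ * X)]eq_bigr do rewrite mxE.
rewrite !prod_scale !exprMn.
set A := \prod_(i < n) _; set B := \prod_(i < n) _; set m := maxn _ _.
have e1 : c ^+ (m - msize P) * c ^+ msize P = c ^+ m by rewrite -exprD subnK // leq_maxl.
have e2 : c^-1 ^+ (m - msize Q) * c^-1 ^+ msize Q = c^-1 ^+ m by rewrite -exprD subnK // leq_maxr.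
have e3 : c ^+ m * c^-1 ^+ m = 1 by rewrite -exprMn mulfV // expr1n.
move: (c ^+ (m - msize P)) (c ^+ msize P) (c^-1 ^+ (m - msize Q)) (c^-1 ^+ msize Q) e1 e2.
move=> x1 x2 x3 x4 e1 e2.
move: (pq.1 0 ord0 ^+ _) (pq.2 0 ord0 ^+ _) => y1 y2.
have -> : x1 * y1 * (x3 * y2) * (x2 * A * (x4 * B)) =
   (x1 * x2) * (x3 * x4) * (y1 * y2 * (A * B)) by ring.
by rewrite e1 e2 e3 mul1r.
Qed.

(** At [gq z] one has q^0 = 1 and p^0 = lam = 1 + x.y, so f_{r,P,Q} is lam^(m - |P|) x^P y^Q. If |P|
    < |Q|, the factor lam^(|Q| - |P|) is exactly what the change to [gp] coordinates produces from
    x^P y^Q. *)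
Lemma fhat_gq (z : nat -> C) (a : nat -> nat) : 1 + dotz n z != 0 ->
  fhat (lft a) (rgt a) (gq n z) =
  if (msize (rgt a) <= msize (lft a))%N then mon d z a else mon d (wz n (1 + dotz n z) z) a.
Proof.
move=> l0; rewrite mon_wz mon_split fhatE /gq /= !crow0 expr1n mulr1.
have -> : \prod_(i < n) crow (1 + dotz n z) (fun i => z i) 0 (lift ord0 i) ^+ lft a i =
    \prod_(i < n) z i ^+ lft a i by apply: eq_bigr => i _; rewrite crow_lift.
have -> : \prod_(i < n) crow (1 : C) (fun i : 'I_n => z (n + i)%N) 0 (lift ord0 i) ^+ rgt a i =
    \prod_(i < n) z (n + i)%N ^+ rgt a i by apply: eq_bigr => i _; rewrite crow_lift.
case: leqP => [QP|PQ].
  by rewrite subnn expr0 mul1r.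
congr (_ * _).
rewrite -[X in _ = _ * _ ^+ X](subnKC (ltnW PQ)) exprD mulrA -exprMn mulVf // expr1n mul1r.
by [].
Qed.

(* The products p^mu q^nu are invariant under C^*, and compactness bounds them. *)
Definition Reg (rho : R) : set pt :=
  [set pq : pt | forall mu nu, cabs (pq.1 0 mu) * cabs (pq.2 0 nu) <= rho].

Lemma max_entry (p : 'rV[C]_n.+1) : exists mu0, forall mu, cabs (p 0 mu) <= cabs (p 0 mu0).
Proof.
case: (@arg_maxP _ _ _ ord0 predT (fun mu => cabs (p 0 mu)) isT) => i _ h.
by exists i => mu; exact: h.
Qed.

(** f_{r,P,Q} is homogeneous of degree m = max(|P|,|Q|) in p and in q, hence bounded by (max |p^mu|
    max |q^nu|)^m, and this product of maxima is one of those bounded by rho. *)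
Lemma fhat_le (rho : R) P Q pq : 1 <= rho -> Reg rho pq ->
  cabs (fhat P Q pq) <= rho ^+ (msize P + msize Q).
Proof.
move=> rho1 Rpq; have [mu0 H1] := max_entry pq.1; have [nu0 H2] := max_entry pq.2.
have h := Rpq mu0 nu0; set A := cabs (pq.1 0 mu0) in h H1; set B := cabs (pq.2 0 nu0) in h H2.
have A0 : 0 <= A := cabs_ge0 _; have B0 : 0 <= B := cabs_ge0 _.
have pw (p : 'rV[C]_n.+1) (D : R) (S : mindex n) : (forall mu, cabs (p 0 mu) <= D) ->
    cabs (\prod_(i < n) p 0 (lift ord0 i) ^+ S i) <= D ^+ msize S.
  move=> hD; rewrite cabs_prod -prodrXr; apply: ler_prod => i _.
  rewrite cabsX exprn_ge0 ?cabs_ge0 //= lerXn2r ?nnegrE ?cabs_ge0 //.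
  exact: le_trans (cabs_ge0 _) (hD ord0).
have px (x D : R) k : 0 <= x -> x <= D -> x ^+ k <= D ^+ k.
  by move=> x0 xD; rewrite lerXn2r ?nnegrE // (le_trans x0).
set m := maxn (msize P) (msize Q).
apply: (@le_trans _ _ ((A * B) ^+ m)); last first.
  apply: (@le_trans _ _ (rho ^+ m)); first by rewrite px // mulr_ge0.
  by rewrite ler_weXn2l // geq_max leq_addr leq_addl.
have -> : (A * B) ^+ m = A ^+ (m - msize P) * B ^+ (m - msize Q) * (A ^+ msize P * B ^+ msize Q).
  by rewrite mulrACA -!exprD !subnK ?leq_maxl ?leq_maxr // exprMn.
rewrite fhatE !cabsM !cabsX.
apply: ler_pM; rewrite ?mulr_ge0 ?exprn_ge0 ?cabs_ge0 //.
  by apply: ler_pM; rewrite ?exprn_ge0 ?cabs_ge0 //; apply: px; rewrite ?cabs_ge0.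
by apply: ler_pM; rewrite ?cabs_ge0 //; exact: pw.
Qed.

Lemma psum_cact N (c : mindex n -> mindex n -> C) (z : C) pq : z != 0 ->
  psum N c (cact z pq) = psum N c pq.
Proof.
move=> z0; apply: eq_bigr => P _; apply: eq_bigr => Q _.
by rewrite fhat_cact.
Qed.

Lemma psumE N (c : mindex n -> mindex n -> C) pq :
  psum N c pq = \sum_(a <- box N d) c (lft a) (rgt a) * fhat (lft a) (rgt a) pq.
Proof. by rewrite /psum (boxsum_box N (fun P Q => c P Q * fhat P Q pq)). Qed.

Lemma rnormE rho N (c : mindex n -> mindex n -> C) :
  rnorm rho N c = \sum_(a <- box N d) cabs (c (lft a) (rgt a)) * rho ^+ asize d a.
Proof.
rewrite /rnorm (boxsum_box N (fun P Q => cabs (c P Q) * rho ^+ (msize P + msize Q))).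
by apply: eq_bigr => a _; rewrite asize_split.
Qed.

Lemma psum_le (rho : R) N (c : mindex n -> mindex n -> C) pq : 1 <= rho -> Reg rho pq ->
  cabs (psum N c pq) <= rnorm rho N c.
Proof.
move=> r1 Rpq; rewrite psumE rnormE; apply: (le_trans (cabs_sum _ _ _)).
apply: ler_sum => a _; rewrite cabsM ler_wpM2l ?cabs_ge0 // asize_split.
exact: fhat_le.
Qed.

Lemma psum_diff_le (rho : R) N N' (c : mindex n -> mindex n -> C) pq :
  1 <= rho -> Reg rho pq -> (N <= N')%N ->
  cabs (psum N' c pq - psum N c pq) <= rnorm rho N' c - rnorm rho N c.
Proof.
move=> r1 Rpq NN'; rewrite !psumE !rnormE.
apply: (@box_diff_le R (fun a => c (lft a) (rgt a) * fhat (lft a) (rgt a) pq)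
   (fun a => cabs (c (lft a) (rgt a)) * rho ^+ asize d a)) => // a.
rewrite cabsM ler_wpM2l ?cabs_ge0 // asize_split.
exact: fhat_le.
Qed.

Lemma fhat_continuous P Q (V : topologicalType) (v0 : V) (ga : V -> pt) :
  (forall j, {for v0, continuous (fun v => (ga v).1 0 j)}) ->
  (forall j, {for v0, continuous (fun v => (ga v).2 0 j)}) ->
  {for v0, continuous (fun v => fhat P Q (ga v))}.
Proof.
move=> c1 c2; apply: cvgM.
  by apply: cvgM; apply: continuousC_X; [exact: c1|exact: c2].
apply: continuousC_prod => i.
by apply: cvgM; apply: continuousC_X; [exact: c1|exact: c2].
Qed.

Lemma psum_continuous N (c : mindex n -> mindex n -> C) (V : topologicalType) (v0 : V)
    (ga : V -> pt) :
  (forall j, {for v0, continuous (fun v => (ga v).1 0 j)}) ->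
  (forall j, {for v0, continuous (fun v => (ga v).2 0 j)}) ->
  {for v0, continuous (fun v => psum N c (ga v))}.
Proof.
move=> c1 c2; have -> : (fun v => psum N c (ga v)) =
    (fun v => \sum_(a <- box N d) c (lft a) (rgt a) * fhat (lft a) (rgt a) (ga v)).
  by apply/funext => v; rewrite psumE.
apply: continuousC_sum => a; apply: cvgM; first exact: cvg_cst.
exact: fhat_continuous.
Qed.

Definition jn P Q : nat -> nat := fun j =>
  if insub j is Some i then P i else if insub (j - n)%N is Some i then Q i else 0%N.

Lemma jn_lft P Q : lft (jn P Q) = P.
Proof. by apply/funext => i; rewrite /lft /jn valK. Qed.

Lemma jn_rgt P Q : rgt (jn P Q) = Q.
Proof.
by apply/funext => i; rewrite /rgt /jn insubF ?ltnNge ?leq_addr // addKn valK.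
Qed.

Lemma jnK (a : nat -> nat) j : (j < d)%N -> jn (lft a) (rgt a) j = a j.
Proof.
move=> jd; rewrite /jn; case: insubP => [i _ <-|]; first by [].
rewrite -leqNgt => nj; case: insubP => [i _ E|]; first by rewrite /rgt E subnKC.
by rewrite ltn_subLR // jd.
Qed.

Section Function.
Variable F : pt -> C.
Hypothesis OF : Ohat F.

(* The coefficient of [f_{r,P,Q}] is the Taylor coefficient of [F] in whichever of
   the two affine charts turns [f_{r,P,Q}] into the monomial with exponents [P, Q]. *)
Definition ecoef P Q : C :=
  if (msize Q <= msize P)%N then cq F (jn P Q) else cp F (jn P Q).

Lemma ecoef_jn (a : nat -> nat) : ecoef (lft a) (rgt a) =
  if (msize (rgt a) <= msize (lft a))%N then cq F a else cp F a.
Proof.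
rewrite /ecoef; case: ifP => _; apply: seccoef_ext => j jd; exact: jnK.
Qed.

Lemma ecoef_le (r M : R) P Q : 0 < r ->
  (forall pq, Ksec (@gq R n) r pq -> cabs (F pq) <= M) ->
  (forall pq, Ksec (@gp R n) r pq -> cabs (F pq) <= M) ->
  cabs (ecoef P Q) <= 2 ^+ d * M / r ^+ (msize P + msize Q).
Proof.
move=> r0 Hq Hp.
have -> : (msize P + msize Q)%N = asize d (jn P Q) by rewrite asize_split jn_lft jn_rgt.
rewrite /ecoef /cq /cp; case: ifP => _.
  rewrite (seccoef_indep (good_gq R n) OF _ ltr01 r0).
  exact: (seccoef_le (good_gq R n) OF).
rewrite (seccoef_indep (good_gp R n) OF _ ltr01 r0).
exact: (seccoef_le (good_gp R n) OF).
Qed.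

(** Cauchy's estimate at radius 2 rho, twice the radius of the norm, leaves a summable factor
    2^-(|P|+|Q|). One T serves the total and the tail. *)
Lemma ecoef_tail (rho : R) : 0 < rho -> exists2 T : R, 0 <= T &
  (forall N, rnorm rho N ecoef <= T) /\
  forall N N', (N <= N')%N -> rnorm rho N' ecoef - rnorm rho N ecoef <= T / 2 ^+ N.
Proof.
move=> rho0; have r0 : 0 < 2 * rho by rewrite mulr_gt0.
have [Mq HMq] := Ksec_bounded (good_gq R n) OF (2 * rho).
have [Mp HMp] := Ksec_bounded (good_gp R n) OF (2 * rho).
pose M := `|Mq| + `|Mp|.
have M0 : 0 <= M by rewrite addr_ge0.
have cle (a : nat -> nat) : cabs (ecoef (lft a) (rgt a)) * rho ^+ asize d a <=
    2 ^+ d * M * 2 ^- asize d a.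
  have h : cabs (ecoef (lft a) (rgt a)) <= 2 ^+ d * M / (2 * rho) ^+ asize d a.
    rewrite asize_split; apply: (ecoef_le _ _ r0) => pq h.
      by apply: (le_trans (HMq _ h)); rewrite (le_trans (ler_norm _)) // lerDl.
    by apply: (le_trans (HMp _ h)); rewrite (le_trans (ler_norm _)) // lerDr.
  have rk : 0 < rho ^+ asize d a by rewrite exprn_gt0.
  apply: (@le_trans _ _ (2 ^+ d * M / (2 * rho) ^+ asize d a * rho ^+ asize d a)).
    by rewrite ler_pM2r.
  by rewrite exprMn invfM -!mulrA mulVf ?gt_eqF // mulr1.
have p2 k : (0 : R) <= 2 ^+ k by rewrite exprn_ge0.
exists (2 ^+ d * M * (2 ^+ d * (d%:R + 1))).
  by rewrite !mulr_ge0 // addr_ge0.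
split=> [N|N N' NN'].
  rewrite rnormE; apply: (@le_trans _ _ (\sum_(a <- box N d) 2 ^+ d * M * 2 ^- asize d a)).
    by apply: ler_sum => a _.
  rewrite -mulr_sumr ler_wpM2l ?mulr_ge0 //; apply: (le_trans (box_geo_le R N d)).
  by rewrite ler_peMr // lerDr.
rewrite !rnormE; apply: (le_trans (box_diff_ler _ NN' cle)).
rewrite -!mulr_sumr -mulrBr -!mulrA ler_wpM2l // ler_wpM2l //.
apply: (le_trans (box_geo_tail R d NN')).
by rewrite -mulrA ler_wpM2l // ler_wpM2r ?invr_ge0 // lerDl.
Qed.

(** T may depend on rho but not on the point of S, so that the estimate passes to limits of points
    of S. *)
Definition approx (S : set pt) := forall rho : R, 1 <= rho -> exists2 T : R, 0 <= T &
  forall pq, Zhat pq -> S pq -> Reg rho pq ->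
    forall N, cabs (F pq - psum N ecoef pq) <= T / 2 ^+ N.

Lemma approx_generic : approx [set pq : pt | pq.1 0 ord0 != 0 /\ pq.2 0 ord0 != 0].
Proof.
move=> rho rho1; have [T T0 [_ HT]] := ecoef_tail (lt_le_trans ltr01 rho1).
exists T => // pq Zpq [p0 q0] Rpq N.
have [w w0 E] := gq_of Zpq q0; move: E; set z := (fun j : nat => _) => E.
have l0 : 1 + dotz n z != 0.
  have : (gq n z).1 0 ord0 != 0 by rewrite -E /= mxE mulf_neq0.
  by rewrite /gq /= crow0.
have FE : F pq = F (gq n z) by rewrite -E OF.1.
have PE N' : psum N' ecoef pq = \sum_(a <- box N' d)
     (if (msize (rgt a) <= msize (lft a))%N then mon d z a * cq F a
      else mon d (wz n (1 + dotz n z) z) a * cp F a).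
  rewrite -(psum_cact N' ecoef pq w0) E psumE; apply: eq_bigr => a _.
  by rewrite fhat_gq // ecoef_jn mulrC; case: ifP.
(* A depends on the point, but enters only as A / 2^N' with N' free: letting N' grow leaves the
   uniform tail T / 2^N. *)
have [A HA] := mixed_expansion OF l0.
rewrite -subr_le0; apply: (@half_pow_le0 _ _ A N) => N' NN'.
have h1 := HA N'; rewrite -PE -FE in h1.
have h2 := psum_diff_le ecoef rho1 Rpq NN'.
have h3 := HT N N' NN'.
have := cabs_le_dist (F pq) (psum N' ecoef pq) (psum N ecoef pq); lra.
Qed.

Lemma limit_le (h : C -> C) (T : R) : {for 0, continuous h} ->
  (\forall w \near (0 : C), w != 0 -> cabs (h w) <= T) -> cabs (h 0) <= T.
Proof.
move=> ch hT; apply/ler_addgt0Pr => e e0.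
move/continuousC_eps/(_ e e0): ch => ch.
have [del del0 H] := (nearC_eps 0 (fun w =>
  cabs (h 0 - h w) < e /\ (w != 0 -> cabs (h w) <= T))).1 (filterI ch hT).
pose w : C := (del / 2)%:C%C.
have w0 : w != 0 by rewrite -cabs_gt0 cabs_real gtr0_norm divr_gt0.
have /H[h1 /(_ w0) h2] : cabs (0 - w) < del.
  by rewrite sub0r cabsN cabs_real gtr0_norm ?divr_gt0 // ltr_pdivrMr // ltr_pMr // ltr1n.
have := cabsD (h 0 - h w) (h w); rewrite subrK => h3.
by apply: (le_trans h3); rewrite addrC lerD // ltW.
Qed.

Lemma approx_extend (S S' : set pt) : approx S ->
  (forall pq, Zhat pq -> S' pq -> exists ga : C -> pt,
     [/\ ga 0 = pq, (forall w, Zhat (ga w)), (forall w, w != 0 -> S (ga w)),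
         forall j, {for 0, continuous (fun w => (ga w).1 0 j)} &
         forall j, {for 0, continuous (fun w => (ga w).2 0 j)}]) ->
  approx S'.
Proof.
move=> aS HS rho rho1; have rho1' : 1 <= rho + 1 by lra.
have [T T0 HT] := aS (rho + 1) rho1'; exists T => // pq Zpq Spq Rpq N.
have [ga [ga0 Zga Sga c1 c2]] := HS pq Zpq Spq.
pose h w := F (ga w) - psum N ecoef (ga w).
have -> : F pq - psum N ecoef pq = h 0 by rewrite /h ga0.
apply: limit_le.
  have cF := Ohat_continuous OF Zga c1 c2.
  have cP := @psum_continuous N ecoef _ 0 ga c1 c2.
  exact: (cvgB cF cP).
have Rn : \forall w \near (0 : C), forall mu nu,
    cabs ((ga w).1 0 mu) * cabs ((ga w).2 0 nu) <= rho + 1.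
  apply: (@near_forall2 C 0 _ _ (fun mu nu w =>
    cabs ((ga w).1 0 mu) * cabs ((ga w).2 0 nu) <= rho + 1)) => mu nu.
  have c12 : {for 0, continuous (fun w => (ga w).1 0 mu * (ga w).2 0 nu)}.
    exact: (cvgM (c1 mu) (c2 nu)).
  move/continuousC_eps/(_ 1 ltr01): c12; apply: filterS => w hw.
  rewrite -cabsM; have := cabsD ((ga w).1 0 mu * (ga w).2 0 nu - pq.1 0 mu * pq.2 0 nu)
    (pq.1 0 mu * pq.2 0 nu).
  rewrite subrK => h1; apply: (le_trans h1); rewrite addrC lerD //.
    by rewrite cabsM; exact: Rpq.
  by move: hw; rewrite ga0 cabsB => /ltW.
by apply: filterS Rn => w Rw w0; apply: HT => //; exact: Sga.
Qed.

Lemma continuous_affine (a b : C) : continuous (fun w : C => a + w * b).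
Proof.
move=> w; apply/continuousC_eps => e e0.
have b0 : 0 < cabs b + 1 by rewrite ltr_wpDl ?cabs_ge0.
apply/nearC_eps; exists (e / (cabs b + 1)); first by rewrite divr_gt0.
move=> t; rewrite ltr_pdivlMr //; apply: le_lt_trans.
have -> : a + w * b - (a + t * b) = (w - t) * b by ring.
by rewrite cabsM ler_wpM2l ?cabs_ge0 // lerDl.
Qed.

Lemma sum_delta (u : 'I_n -> C) (k : 'I_n) (c : C) :
  \sum_(i < n) u i * (if i == k then c else 0) = u k * c.
Proof.
rewrite (bigD1 k) //= eqxx big1 ?addr0 // => i /negbTE ->.
by rewrite mulr0.
Qed.

(* Shears [p^0 += w p^k, q^k += w q^0] (and the same with [p] and [q] exchanged)
   preserve [Zhat] and move any point off the locus [p^0 = 0] (resp. [q^0 = 0]). *)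
Lemma approx_q : approx [set pq : pt | pq.2 0 ord0 != 0].
Proof.
apply: (approx_extend approx_generic) => pq Zpq q0.
have [p0|p0] := eqVneq (pq.1 0 ord0) 0; last first.
  by exists (fun=> pq); split => // j; exact: cst_continuous.
have [k pk] : exists k, pq.1 0 (lift ord0 k) != 0.
  have [[mu pmu] _] := Zhat_neq0 Zpq.
  by case: (unliftP ord0 mu) pmu => [k ->|->]; [exists k|rewrite p0 eqxx].
pose ga (w : C) : pt :=
  (crow (pq.1 0 ord0 + w * pq.1 0 (lift ord0 k)) (fun i => pq.1 0 (lift ord0 i)),
   crow (pq.2 0 ord0) (fun i => pq.2 0 (lift ord0 i) + w * (if i == k then pq.2 0 ord0 else 0))).
exists ga; split.
- case: pq @ga {Zpq q0 p0 pk} => p q ga /=; rewrite /ga /= [p in RHS]crowP [q in RHS]crowP.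
  congr (crow _ _, crow _ _); first by rewrite mul0r addr0.
  by apply/funext => i; rewrite mul0r addr0.
- move=> w; move: Zpq; rewrite /Zhat /= hform_crow hformE => <-.
  under eq_bigr do rewrite mulrDr mulrCA.
  rewrite big_split -mulr_sumr sum_delta /=.
  by move: (\sum_(i < n) _) => s; ring.
- move=> w w0; split; last by rewrite /ga /= crow0.
  by rewrite /ga /= crow0 p0 add0r mulf_neq0.
- apply: continuous_crow; first exact: continuous_affine.
  by move=> i; exact: cst_continuous.
- apply: continuous_crow; first exact: cst_continuous.
  by move=> i; exact: continuous_affine.
Qed.

(** A second stage is needed because this shear does not change p^0, which may vanish: it only leads
    back to the points with q^0 <> 0. *)
Lemma approx_all : approx setT.
Proof.
apply: (approx_extend approx_q) => pq Zpq _.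
have [q0|q0] := eqVneq (pq.2 0 ord0) 0; last first.
  by exists (fun=> pq); split => // j; exact: cst_continuous.
have [k qk] : exists k, pq.2 0 (lift ord0 k) != 0.
  have [_ [mu qmu]] := Zhat_neq0 Zpq.
  by case: (unliftP ord0 mu) qmu => [k ->|->]; [exists k|rewrite q0 eqxx].
pose ga (w : C) : pt :=
  (crow (pq.1 0 ord0) (fun i => pq.1 0 (lift ord0 i) + w * (if i == k then pq.1 0 ord0 else 0)),
   crow (pq.2 0 ord0 + w * pq.2 0 (lift ord0 k)) (fun i => pq.2 0 (lift ord0 i))).
exists ga; split.
- case: pq @ga {Zpq q0 qk} => p q ga /=; rewrite /ga /= [p in RHS]crowP [q in RHS]crowP.
  congr (crow _ _, crow _ _); last by rewrite mul0r addr0.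
  by apply/funext => i; rewrite mul0r addr0.
- move=> w; move: Zpq; rewrite /Zhat /= hform_crow hformE => <-.
  have -> : \sum_(i < n) (pq.1 0 (lift ord0 i) + w * (if i == k then pq.1 0 ord0 else 0)) *
      pq.2 0 (lift ord0 i) = \sum_(i < n) pq.1 0 (lift ord0 i) * pq.2 0 (lift ord0 i) +
      w * \sum_(i < n) pq.2 0 (lift ord0 i) * (if i == k then pq.1 0 ord0 else 0).
    by rewrite mulr_sumr -big_split; apply: eq_bigr => i _ /=; ring.
  rewrite sum_delta.
  by move: (\sum_(i < n) _) => s; ring.
- by move=> w w0; rewrite /ga /= crow0 q0 add0r mulf_neq0.
- apply: continuous_crow; first exact: cst_continuous.
  by move=> i; exact: continuous_affine.
- apply: continuous_crow; first exact: continuous_affine.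
  by move=> i; exact: cst_continuous.
Qed.

End Function.

Lemma continuous_entry1 mu (pq : pt) : {for pq, continuous (fun pq : pt => pq.1 0 mu)}.
Proof.
apply/continuousC_eps => e e0.
have h := (continuousC_eps _ _).1 (@coord_continuous C 1 n.+1 0 mu pq.1) e e0.
exists ([set p : 'rV[C]_n.+1 | cabs (pq.1 0 mu - p 0 mu) < e], setT) => [|[p q] []] //=.
by split => //; exact: filterT.
Qed.

Lemma continuous_entry2 mu (pq : pt) : {for pq, continuous (fun pq : pt => pq.2 0 mu)}.
Proof.
apply/continuousC_eps => e e0.
have h := (continuousC_eps _ _).1 (@coord_continuous C 1 n.+1 0 mu pq.2) e e0.
exists (setT, [set p : 'rV[C]_n.+1 | cabs (pq.2 0 mu - p 0 mu) < e]) => [|[p q] []] //=.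
by split => //; exact: filterT.
Qed.

(** The sets [O k] are open and saturated, the products p^mu q^nu being invariant, and they increase
    to [Zhat]; finitely many of them lie in a single [W k]. *)
Lemma qcompact_Reg (K : set pt) : qcompact K -> exists2 rho : R, 1 <= rho & K `<=` Reg rho.
Proof.
move=> [[KZ _] cK].
pose W (k : nat) : set pt := [set pq : pt | forall mu nu, cabs (pq.1 0 mu * pq.2 0 nu) < k%:R].
pose O k := W k `&` @Zhat R n.
have Wo k : open (W k).
  rewrite openE => pq Wpq.
  have : \forall pq' \near pq, forall mu nu,
    cabs ((pq' : pt).1 0 mu * (pq' : pt).2 0 nu) < k%:R; last by [].
  apply: (@near_forall2 pt pq _ _ (fun mu nu (pq' : pt) =>
    cabs (pq'.1 0 mu * pq'.2 0 nu) < k%:R)) => mu nu.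
  have c12 : {for pq, continuous (fun pq : pt => pq.1 0 mu * pq.2 0 nu)}.
    exact: (cvgM (@continuous_entry1 mu pq) (@continuous_entry2 nu pq)).
  have := Wpq mu nu; rewrite -subr_gt0 => e0.
  move/continuousC_eps/(_ _ e0): c12; apply: filterS => pq' h.
  have := cabsD (pq'.1 0 mu * pq'.2 0 nu - pq.1 0 mu * pq.2 0 nu) (pq.1 0 mu * pq.2 0 nu).
  by rewrite subrK cabsB; lra.
have Oop U : range O U -> qopen U.
  move=> [k _ <-]; split; last by exists (W k).
  split; first by move=> pq [].
  move=> z z0 pq [Wpq Zpq]; split; last exact: Zhat_cact.
  move=> mu nu /=; rewrite !mxE; have -> : z * pq.1 0 mu * (z^-1 * pq.2 0 nu) = pq.1 0 mu * pq.2 0 nu.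
    by field.
  exact: Wpq.
have [s [sO Ks]] : exists s : seq (set pt), (forall U, U \in s -> range O U) /\
    K `<=` \bigcup_(U in [set` s]) U.
  apply: cK => // pq Kpq.
  have [mu0 H1] := max_entry pq.1; have [nu0 H2] := max_entry pq.2.
  pose A := cabs (pq.1 0 mu0) * cabs (pq.2 0 nu0).
  have A0 : 0 <= A by rewrite mulr_ge0 ?cabs_ge0.
  exists (O (Num.bound A)) => //; split; last exact: KZ.
  move=> mu nu; rewrite cabsM; apply: (le_lt_trans _ (archi_boundP A0)).
  by rewrite ler_pM ?cabs_ge0.
have [k Hk] : exists k : nat, forall U, U \in s -> U `<=` W k.
  elim: s sO {Ks} => [|U s IH] sO; first by exists 0%N.
  have [|k Hk] := IH; first by move=> U' U's; apply: sO; rewrite inE U's orbT.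
  have [k' _ kE] := sO U (mem_head _ _).
  exists (k + k')%N => U'; rewrite inE => /predU1P[->|/Hk sub].
    rewrite -kE => pq [Wpq _] mu nu; apply: (lt_le_trans (Wpq mu nu)).
    by rewrite ler_nat leq_addl.
  move=> pq /sub Wpq mu nu; apply: (lt_le_trans (Wpq mu nu)).
  by rewrite ler_nat leq_addr.
exists (k%:R + 1); first by rewrite lerDr.
move=> pq /Ks[U Us Upq] mu nu; rewrite -cabsM.
by apply: (le_trans (ltW (Hk U Us pq Upq mu nu))); rewrite lerDl.
Qed.

(** The sign of M covers an empty K, where the supremum is 0 by convention. *)
Lemma semiK_le (K : set pt) (F : pt -> C) (M : R) : 0 <= M ->
  (forall pq, K pq -> cabs (F pq) <= M) -> semiK K F <= M.
Proof.
move=> M0 H; have [[pq Kpq]|K0] := pselect (exists pq, K pq).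
  apply: ge_sup; first by exists (cabs (F pq)), pq.
  by move=> _ [pq' Kpq' <-]; exact: H.
rewrite /semiK; have -> : [set cabs (F pq) | pq in K] = set0.
  by apply/seteqP; split=> // x [pq Kpq _]; case: K0; exists pq.
by rewrite sup0.
Qed.

Lemma le_semiK (K : set pt) (F : pt -> C) (M : R) pq :
  (forall pq, K pq -> cabs (F pq) <= M) -> K pq -> cabs (F pq) <= semiK K F.
Proof.
move=> H Kpq; apply: ub_le_sup; last by exists pq.
by exists M => _ [pq' Kpq' <-]; exact: H.
Qed.

Lemma series_ecoef F : Ohat F -> series_to (ecoef F) F.
Proof.
move=> OF K cK eps eps0; have [rho rho1 KR] := qcompact_Reg cK.
have [T T0 HT] := approx_all OF rho1.
have [N0 HN0] : exists N0 : nat, T / eps < N0%:R.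
  by exists (Num.bound (T / eps)); apply: archi_boundP; rewrite divr_ge0 // ltW.
exists N0 => N NN0; apply: (@le_lt_trans _ _ (T / 2 ^+ N)).
  apply: semiK_le => [|pq Kpq]; first by rewrite divr_ge0 // exprn_ge0.
  by apply: HT => //; [exact: (cK.1.1)|exact: KR].
rewrite ltr_pdivrMr ?exprn_gt0 // mulrC -ltr_pdivrMr //.
apply: (lt_le_trans HN0); rewrite -natrX ler_nat.
by apply: (leq_trans NN0); exact: ltnW (ltn_expl _ _).
Qed.

Lemma abs_conv_ecoef F : Ohat F -> abs_conv (ecoef F).
Proof.
move=> OF K cK; have [rho rho1 KR] := qcompact_Reg cK.
have rho0 := lt_le_trans ltr01 rho1.
have [T _ [HT _]] := ecoef_tail OF rho0.
exists T => N; apply: le_trans (HT N).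
apply: ler_sum => P _; apply: ler_sum => Q _.
rewrite ler_wpM2l ?cabs_ge0 //; apply: semiK_le.
  by rewrite exprn_ge0 // ltW.
by move=> pq /KR Rpq; exact: fhat_le.
Qed.

End Expansion.

(** * Uniqueness of the coefficients *)

Section Uniqueness.
Variables (R : realType) (n : nat).
Local Notation C := (CC R).
Local Notation pt := (pt R n).
Local Notation d := (n + n)%N.
Local Notation pi2 := (pi *+ 2 : R).
Local Notation lft := (@lft n).
Local Notation rgt := (@rgt n).
Variable r : R.
Hypotheses (r0 : 0 < r) (rn : n%:R * r ^+ 2 < 1).

(** q bounds |x.y| on the torus of radius r. That q < 1 keeps the torus inside the standard chart
    and makes the geometric series of 1/(1 - x.y) converge uniformly on it. *)
Let q := n%:R * r ^+ 2.
Let q0 : 0 <= q. Proof. by rewrite mulr_ge0 // exprn_ge0 // ltW. Qed.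
Let q1 : 0 < 1 - q. Proof. by rewrite subr_gt0. Qed.

Let xy (th : nat -> R) : C := dotz n (circ r th).

Let dot_le (z : nat -> C) : (forall j, (j < d)%N -> cabs (z j) = r) -> cabs (dotz n z) <= q.
Proof.
move=> zr; apply: (le_trans (cabs_sum _ _ _)); rewrite /q mulr_natl -[n in _ *+ n]card_ord -sumr_const.
by apply: ler_sum => i _; rewrite cabsM !zr ?ltn_add2l ?ltn_addr // expr2.
Qed.

Let one_sub (z : nat -> C) : (forall j, (j < d)%N -> cabs (z j) = r) ->
  1 - q <= cabs (1 - dotz n z) /\ 1 - dotz n z != 0.
Proof.
move=> /dot_le h; have l : 1 - q <= cabs (1 - dotz n z).
  by have := cabsD (1 - dotz n z) (dotz n z); rewrite subrK cabs1; lra.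
by split => //; rewrite -cabs_gt0; exact: lt_le_trans l.
Qed.

Let xy_le th : cabs (xy th) <= q.
Proof. by apply: dot_le => j _; rewrite cabs_circ. Qed.

Let omxy th : 1 - q <= cabs (1 - xy th) /\ 1 - xy th != 0.
Proof. by apply: one_sub => j _; rewrite cabs_circ. Qed.

Let tame_circ k j : (j < k)%N -> tame k (fun th => circ r th j).
Proof. by move=> jk; apply: tameM; [exact: tame_cst|exact: tame_cexpi]. Qed.

Let tame_xy : tame d xy.
Proof.
by apply: tame_sum => i; apply: tameM; apply: tame_circ; rewrite ?ltn_add2l // ltn_addr.
Qed.

Let tame_om : tame d (fun th => 1 - xy th).
Proof. by apply: tameB => //; exact: tame_cst. Qed.

Let tame_omV : tame d (fun th => (1 - xy th)^-1).
Proof. by apply: (tameV tame_om q1) => th _; have [] := omxy th. Qed.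

Let tame_omz (k : int) : tame d (fun th => (1 - xy th) ^ k).
Proof.
case: k => k; first exact: tameX.
by under eq_fun do rewrite NegzE -exprnN -exprVn; exact: tameX.
Qed.

Let dbl (K : 'I_n -> nat) : nat -> nat := jn K K.

(* [g] is a function of the products x^i y^i in which only monomials of degree
   [l] with [L l] occur, so that multiplying by it shifts exponents by (K, K), |K| = l. *)
Definition annihilated (L : nat -> Prop) (g : (nat -> R) -> C) := tame d g /\
  forall a b : nat -> nat,
    (forall K, L (msize K) -> exists2 j, (j < d)%N & (a j + dbl K j)%N != b j) ->
    tcoef r d (fun th => mon d (circ r th) a * g th) b = 0.

Let tmon a g : tame d g -> tame d (fun th => mon d (circ r th) a * g th).
Proof. by move=> tg; apply: tameM => //; exact: tame_mon. Qed.

Let ann_sub (L L' : nat -> Prop) g : (forall l, L l -> L' l) ->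
  annihilated L g -> annihilated L' g.
Proof.
by move=> LL' [tg ag]; split => // a b H; apply: ag => K /LL' /H.
Qed.

Let ann_cst (c : C) : annihilated (fun l => l = 0%N) (fun=> c).
Proof.
split=> [|a b H]; first exact: tame_cst.
have [|j jd] := H (fun=> 0%N); first by rewrite /msize big1.
have -> : dbl (fun=> 0%N) j = 0%N.
  by rewrite /dbl /jn; case: (insub j) => //; case: (insub (j - n)%N).
rewrite addn0 => ab; rewrite (@tcoef_ext _ _ _ _ (fun th => c * mon d (circ r th) a)).
  by rewrite tcoefZ ?(tcoef_mon_neq r0 jd ab) ?mulr0 //; exact: tame_mon.
by move=> th _; rewrite mulrC.
Qed.

Let annD L g h : annihilated L g -> annihilated L h -> annihilated L (fun th => g th + h th).
Proof.
move=> [tg ag] [t_h ah]; split=> [|a b H]; first exact: tameD.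
rewrite (@tcoef_ext _ _ _ _ (fun th => mon d (circ r th) a * g th -
    - 1 * (mon d (circ r th) a * h th))); last by move=> th _; ring.
rewrite tcoefB; [|exact: tmon|by apply: tameM; [exact: tame_cst|exact: tmon]].
by rewrite tcoefZ ?ag ?ah ?mulr0 ?subr0 //; exact: tmon.
Qed.

Let annN L g : annihilated L g -> annihilated L (fun th => - g th).
Proof.
move=> [tg ag]; split=> [|a b H]; first exact: tameN.
rewrite (@tcoef_ext _ _ _ _ (fun th => - 1 * (mon d (circ r th) a * g th))).
  by rewrite tcoefZ ?ag ?mulr0 //; exact: tmon.
by move=> th _; ring.
Qed.

Let dE (i : 'I_n) : 'I_n -> nat := fun k => (k == i :> nat).

Let msize_dE i : msize (dE i) = 1%N.
Proof.
rewrite /msize (bigD1 i) //= /dE eqxx big1 // => k ki.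
by rewrite /= (inj_eq val_inj) (negbTE ki).
Qed.

Let dblD K K' j : dbl (fun i => K i + K' i)%N j = (dbl K j + dbl K' j)%N.
Proof. by rewrite /dbl /jn; case: (insub j) => [i|] //; case: (insub (j - n)%N) => [i|]. Qed.

Let mon_add z a b : mon d z a * mon d z b = mon d z (fun j => a j + b j)%N :> C.
Proof. by rewrite /mon -big_split; apply: eq_bigr => j _; rewrite exprD. Qed.

Let mon_dbl (z : nat -> C) i : mon d z (dbl (dE i)) = z i * z (n + i)%N.
Proof.
rewrite mon_split /dbl jn_lft jn_rgt.
rewrite (bigD1 i) //= [X in _ * X](bigD1 i) //= /dE eqxx !expr1.
rewrite !big1 ?mulr1 // => k /negbTE ki.
  by rewrite (inj_eq val_inj) ki expr0.
by rewrite (inj_eq val_inj) ki expr0.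
Qed.

Let ann_xy L g : annihilated L g ->
  annihilated (fun l => exists2 l', l = l'.+1 & L l') (fun th => xy th * g th).
Proof.
move=> [tg ag]; split=> [|a b H]; first exact: tameM.
rewrite (@tcoef_ext _ _ _ _ (fun th => \sum_(i < n)
    mon d (circ r th) (fun j => a j + dbl (dE i) j)%N * g th)).
  rewrite tcoef_sum; last by move=> i; exact: tmon.
  apply: big1 => i _; apply: ag => K LK.
  have [|j jd hj] := H (fun k => dE i k + K k)%N.
    exists (msize K) => //; rewrite -add1n -(msize_dE i).
    by rewrite /msize -big_split.
  by exists j => //; rewrite -addnA -dblD.
move=> th _; rewrite /xy /dotz mulr_suml mulr_sumr; apply: eq_bigr => i _.
by rewrite -mon_add mon_dbl mulrA.
Qed.

(** Coefficients are continuous for the sup norm on the torus: [k] bounds how much multiplication by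
    the monomial a followed by extraction at b can enlarge it. This replaces integrating an infinite
    series term by term. *)
Let ann_lim L g : tame d g -> (forall e : R, 0 < e -> exists2 g', annihilated L g' &
    forall th, inbox d th -> cabs (g th - g' th) <= e) -> annihilated L g.
Proof.
move=> tg H; split => // a b Hab; apply: cabs0P; apply/eqP.
rewrite eq_le cabs_ge0 andbT; apply/ler_addgt0Pl => e e0; rewrite addr0.
pose k := 2 ^+ d * r ^+ asize d a / r ^+ asize d b.
have k0 : 0 < k by rewrite !mulr_gt0 ?invr_gt0 ?exprn_gt0.
have [g' [tg' ag'] gg'] := H (e / k) (divr_gt0 e0 k0).
rewrite -[X in cabs X]subr0 -(ag' a b Hab) -tcoefB; try exact: tmon.
have -> : e = 2 ^+ d * (r ^+ asize d a * (e / k)) / r ^+ asize d b.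
  have -> : 2 ^+ d * (r ^+ asize d a * (e / k)) / r ^+ asize d b = k * (e / k).
    by rewrite {2}/k; move: (e / k) => u; ring.
  by rewrite mulrC divfK // gt_eqF.
apply: tcoef_le => //; first by apply: tameB; exact: tmon.
move=> th hb; rewrite -mulrBr cabsM ler_pM ?cabs_ge0 ?gg' //.
by rewrite mon_emon cabsM cabs_emon mulr1 cabsX cabs_real gtr0_norm.
Qed.

Let ann_pos k : annihilated (fun l => (l <= k)%N) (fun th => (1 - xy th) ^+ k).
Proof.
elim: k => [|k IH].
  by apply: (ann_sub _ (ann_cst 1)) => l ->.
have -> : (fun th => (1 - xy th) ^+ k.+1) =
          (fun th => (1 - xy th) ^+ k + - (xy th * (1 - xy th) ^+ k)).
  by apply/funext => th; rewrite exprS; ring.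
apply: annD; first by apply: (ann_sub _ IH) => l /leqW.
by apply: annN; apply: (ann_sub _ (ann_xy IH)) => l [l' -> ].
Qed.

(** Approximation by partial geometric sums; the remainder (x.y)^N g/(1 - x.y) is at most q^N M / (1
    - q). *)
Let ann_inv g : annihilated (fun=> True) g ->
  annihilated (fun=> True) (fun th => (1 - xy th)^-1 * g th).
Proof.
move=> ag; have tg := ag.1; apply: ann_lim; first exact: tameM.
move=> e e0; have [M M0 HM] := tame_bound tg.
have e1 : 0 < e * (1 - q) / M by rewrite divr_gt0 // mulr_gt0.
have qn : `|q| < 1 by rewrite ger0_norm // -subr_gt0.
have /cvgrPdist_lt/(_ _ e1)[N _ /(_ N (leqnn N)) HN] := cvg_expr qn.
exists (fun th => \sum_(l < N) xy th ^+ l * g th).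
  elim: N {HN} => [|N IH].
    rewrite (_ : (fun th => _) = (fun=> 0)).
      by apply: (ann_sub _ (ann_cst 0)).
    by apply/funext => th; rewrite big_ord0.
  rewrite (_ : (fun th => _) = (fun th => g th + xy th * \sum_(l < N) xy th ^+ l * g th)).
    by apply: annD => //; apply: (ann_sub _ (ann_xy IH)).
  apply/funext => th; rewrite big_ord_recl expr0 mul1r; congr (_ + _).
  by rewrite mulr_sumr; apply: eq_bigr => l _; rewrite /= exprS mulrA.
move=> th hb; have [lo nz] := omxy th.
have -> : (1 - xy th)^-1 * g th - \sum_(l < N) xy th ^+ l * g th =
          xy th ^+ N * ((1 - xy th)^-1 * g th).
  elim: N {HN} => [|N IH]; first by rewrite big_ord0 subr0 expr0 mul1r.
  rewrite big_ord_recr /= opprD addrA IH exprS.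
  by move: (xy th ^+ N) => u; field; exact: nz.
rewrite cabsM cabsX cabsM cabsV.
move: HN; rewrite /= sub0r normrN ger0_norm ?exprn_ge0 // => /ltW HN.
have h1 : cabs (xy th) ^+ N <= e * (1 - q) / M.
  by apply: le_trans HN; rewrite lerXn2r ?nnegrE ?cabs_ge0.
have h2 : (cabs (1 - xy th))^-1 * cabs (g th) <= (1 - q)^-1 * M.
  rewrite ler_pM ?invr_ge0 ?cabs_ge0 ?HM //.
  by rewrite lef_pV2 ?posrE // (lt_le_trans q1).
have -> : e = e * (1 - q) / M * ((1 - q)^-1 * M).
  by field; rewrite !gt_eqF.
by rewrite ler_pM ?exprn_ge0 ?mulr_ge0 ?invr_ge0 ?cabs_ge0.
Qed.

Let ann_all k : annihilated (fun=> True) (fun th => (1 - xy th)^-1 ^+ k).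
Proof.
elim: k => [|k IH]; first by apply: (ann_sub _ (ann_cst 1)).
rewrite (_ : (fun th => _) = (fun th => (1 - xy th)^-1 * (1 - xy th)^-1 ^+ k)).
  exact: ann_inv.
by apply/funext => th; rewrite exprS.
Qed.

(** The orthogonality behind the integral formula. (1 - x.y)^k involves only monomials x^K y^K, so a
    contribution needs b = a + (K, K). Then max(|P|,|Q|) grows by |K|, so k = |K| - 1, with |K| > 0
    since a and b differ. Hence k >= 0, and (1 - x.y)^k is a polynomial of degree |K| - 1 in the
    products x^i y^i, in which x^K y^K cannot occur. *)
Let tcoef_neq a b (k : int) j : (j < d)%N -> a j != b j ->
  k = (maxn (msize (lft b)) (msize (rgt b)))%:Z - (maxn (msize (lft a)) (msize (rgt a)))%:Z - 1 ->
  tcoef r d (fun th => mon d (circ r th) a * (1 - xy th) ^ k) b = 0.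
Proof.
move=> jd abj kE.
have key K : (forall j, (j < d)%N -> (a j + dbl K j)%N = b j) -> k = (msize K)%:Z - 1 /\ (0 < msize K)%N.
  move=> H.
  have Hl : lft b = (fun i => lft a i + K i)%N.
    apply/funext => i; rewrite /lft -H ?ltn_addr //; congr addn.
    by have := congr1 (fun f => f i) (jn_lft K K).
  have Hr : rgt b = (fun i => rgt a i + K i)%N.
    apply/funext => i; rewrite /rgt -H ?ltn_add2l //; congr addn.
    by have := congr1 (fun f => f i) (jn_rgt K K).
  have sl : msize (lft b) = (msize (lft a) + msize K)%N by rewrite Hl /msize big_split.
  have sr : msize (rgt b) = (msize (rgt a) + msize K)%N by rewrite Hr /msize big_split.
  split; first by rewrite kE sl sr -addn_maxl PoszD; ring.
  rewrite lt0n; apply: contraNneq abj => K0; rewrite -H //.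
  suff -> : dbl K j = 0%N by rewrite addn0.
  have Ki i : K i = 0%N.
    by apply/eqP; move/eqP: K0; rewrite /msize sum_nat_eq0 => /forallP/(_ i).
  by rewrite /dbl /jn; case: (insub j) => [i|]; rewrite ?Ki //; case: (insub _).
have exj (L : nat -> Prop) : (forall K, L (msize K) ->
    (forall j, (j < d)%N -> (a j + dbl K j)%N = b j) -> False) ->
  forall K, L (msize K) -> exists2 j, (j < d)%N & (a j + dbl K j)%N != b j.
  move=> H K LK; apply: contrapT => N; apply: (H K LK) => i id.
  by apply/eqP; apply/negPn/negP => ne; apply: N; exists i.
case: k kE key => k kE key.
  have [_ ->] := ann_pos k; first by [].
  by apply: (exj (fun l => (l <= k)%N)) => K LK /key[]; move: LK; lia.
have -> : (fun th => mon d (circ r th) a * (1 - xy th) ^ Negz k) =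
          (fun th => mon d (circ r th) a * (1 - xy th)^-1 ^+ k.+1).
  by apply/funext => th; rewrite NegzE -exprnN -exprVn.
have [_ ->] := ann_all k.+1; first by [].
by apply: (exj (fun=> True)) => K _ /key[]; lia.
Qed.

(** 1/(1 - x.y) = 1 + x.y/(1 - x.y), and the second summand only shifts exponents by pairs (K, K)
    with |K| > 0. *)
Let tcoef_eq a b : (forall j, (j < d)%N -> a j = b j) ->
  tcoef r d (fun th => mon d (circ r th) a * (1 - xy th)^-1) b = 1.
Proof.
move=> ab.
have [ta aa] := ann_xy (ann_all 1).
have tm : tame d (fun th => mon d (circ r th) a) := tame_mon r d a.
rewrite (@tcoef_ext _ _ _ _ (fun th => mon d (circ r th) a -
   (- 1) * (mon d (circ r th) a * (xy th * (1 - xy th)^-1 ^+ 1)))); last first.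
  by move=> th _; have [_ nz] := omxy th; rewrite expr1; field.
have t1 := tmon a ta.
rewrite tcoefB //; last by apply: tameM => //; exact: tame_cst.
rewrite tcoefZ // aa ?mulr0 ?subr0 ?tcoef_mon_eq // => K [l lE _].
have [i Ki] : exists i, K i != 0%N.
  apply/existsP; apply: contraPT lE; rewrite negb_exists => /forallP K0.
  by rewrite /msize big1 // => i _; move: (K0 i); rewrite negbK => /eqP.
exists (i : nat); first by rewrite ltn_addr.
rewrite -ab ?ltn_addr // -[X in _ != X]addn0 eqn_add2l.
by have := congr1 (fun f => f i) (jn_lft K K); rewrite /dbl /lft => ->.
Qed.

(* From the coordinates u^i = p^i/p^0, v^i = q^i/q^0 of the standard chart to those
   of [gq]. *)
Definition st (z : nat -> C) : nat -> C :=
  fun j => if (j < n)%N then z j / (1 - dotz n z) else z j.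

Let dotz_st z : 1 - dotz n z != 0 -> 1 + dotz n (st z) = (1 - dotz n z)^-1.
Proof.
move=> nz; have -> : dotz n (st z) = dotz n z / (1 - dotz n z).
  rewrite {1}/dotz mulr_suml; apply: eq_bigr => i _.
  by rewrite /st ltn_ord ltnNge leq_addr /= mulrAC.
by field.
Qed.

Let fhat_st (th : nat -> R) (a : nat -> nat) :
  fhat (lft a) (rgt a) (gq n (st (circ r th))) =
  mon d (circ r th) a * (1 - xy th)^-1 ^+ maxn (msize (lft a)) (msize (rgt a)).
Proof.
have [_ nz] := omxy th; rewrite fhatE /gq /= !crow0 dotz_st // expr1n mulr1 mon_split.
rewrite (eq_bigr (fun i : 'I_n => ((1 - xy th)^-1 * circ r th i) ^+ lft a i)); last first.
  by move=> i _; rewrite crow_lift /st ltn_ord mulrC.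
rewrite [X in _ * (_ * X)](eq_bigr (fun i : 'I_n => circ r th (n + i)%N ^+ rgt a i)); last first.
  by move=> i _; rewrite crow_lift /st ltnNge leq_addr.
rewrite prod_scale !mulrA -exprD subnK ?leq_maxl // mulrC mulrA.
by rewrite mulrC -!mulrA mulrC -!mulrA; congr (_ * _); rewrite mulrC.
Qed.

Variable F : pt -> C.
Hypothesis OF : Ohat F.

Let tame_F : tame d (fun th => F (gq n (st (circ r th)))).
Proof.
pose zt (v : 'rV[R]_d) : nat -> C := fun j =>
  if insub j is Some i then r%:C%C * cexpi (v 0 i) else 0.
have zE th j : (j < d)%N -> circ r th j = zt (\row_j th j) j.
  by move=> jd; rewrite /zt (insubT (fun j => j < d)%N jd) mxE.
have stE th j : (j < d)%N -> st (circ r th) j = st (zt (\row_j th j)) j.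
  by move=> jd; rewrite /st -(dotz_ext (zE th)) zE.
have -> : (fun th => F (gq n (st (circ r th)))) =
    (fun th => (F \o (fun v => gq n (st (zt v)))) (\row_j th j)).
  by apply/funext => th; congr F; apply: gq_ext; exact: stE.
apply: tame_continuous => v.
have cz j : {for v, continuous (fun v => zt v j)}.
  rewrite /zt; case: (insub j) => [i|]; last exact: cst_continuous.
  have hc := continuous_comp (@coord_continuous R 1 d 0 i v) (@continuous_cexpi R (v 0 i)).
  exact: (cvgM (cvg_cst (r%:C%C : C)) hc).
have cd : {for v, continuous (fun v => 1 - dotz n (zt v))}.
  have h : {for v, continuous (fun v => dotz n (zt v))}.
    apply: continuousC_sum => i.
    exact: (cvgM (cz i) (cz (n + i)%N)).
  exact: (cvgB (cvg_cst (1 : C)) h).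
have nz : 1 - dotz n (zt v) != 0.
  apply: (one_sub _).2 => j jd.
  by rewrite /zt (insubT (fun j => j < d)%N jd) cabsM cabs_real cabs_cexpi mulr1 gtr0_norm.
have cs j : {for v, continuous (fun v => st (zt v) j)}.
  rewrite /st; case: (j < n)%N; last exact: cz.
  have hV : {for v, continuous (fun v => (1 - dotz n (zt v))^-1)}.
    by apply: (@continuousCV _ _ (fun v => 1 - dotz n (zt v)) v nz); exact: cd.
  exact: (cvgM (cz j) hV).
have [h1 h2] := gs_cont (good_gq R n) cs.
exact: (@Ohat_continuous R n F _ (fun v => gq n (st (zt v))) v OF (fun v' => Zhat_gq n _) h1 h2).
Qed.

Let ins0 (u : 'rV[C]_n) : ins ord0 u = crow 1 (fun i => u 0 i).
Proof. by apply/rowP => j; rewrite !mxE. Qed.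

Let chart_inv_st (th : nat -> R) :
  chart_inv ord0 ord0 (\row_(i < n) circ r th i, \row_(i < n) circ r th (n + i)%N) =
  cact (1 - xy th) (gq n (st (circ r th))).
Proof.
have [_ nz] := omxy th; rewrite /chart_inv /gq /cact /= dotz_st // !ins0.
have -> : hform (crow 1 (fun i : 'I_n => (\row_(i < n) circ r th i) 0 i))
    (crow 1 (fun i : 'I_n => (\row_(i < n) circ r th (n + i)%N) 0 i)) = - (1 - xy th).
  rewrite hform_crow mul1r /xy /dotz opprB addrC; congr (_ - 1).
  by apply: eq_bigr => i _; rewrite !mxE.
rewrite invrN opprK !scale_crow mulfV //; congr (crow _ _, crow _ _).
- apply/funext => i; rewrite mxE /st ltn_ord mulrCA mulfV ?mulr1 //.
- by apply/funext => i; rewrite mxE /st ltnNge leq_addr.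
Qed.

(** In angular variables the factors i x^i and i y^i of the differentials lower the exponents P_i +
    1 and Q_i + 1 to P_i and Q_i, and the 2n factors i cancel against (2 pi i)^(2n). Invariance
    under C^* then moves the argument of F from the standard chart to [gq]. *)
Lemma coef_tcoef P Q : coef r F P Q =
  tcoef r d (fun th => F (gq n (st (circ r th))) *
     (1 - xy th) ^ ((maxn (msize P) (msize Q))%:Z - 1)) (jn P Q).
Proof.
have I0 : (@cI R) != 0 by rewrite -cabs_gt0 cabsI.
have p0 : pi2%:C%C != 0 :> C by rewrite -cabs_gt0 cabs_real gtr0_norm ?pi2_gt0.
rewrite /coef /tcoef mul2n -addnn.
rewrite (@tint_ext _ _ _ (fun th => @cI R ^+ d * (F (gq n (st (circ r th))) *
     (1 - xy th) ^ ((maxn (msize P) (msize Q))%:Z - 1) *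
     (mon d (circ r th) (jn P Q))^-1))).
  rewrite tintZ; last first.
    apply: tameM; last exact: tame_monV.
    by apply: tameM; [exact: tame_F|exact: tame_omz].
  rewrite mulrA; congr (_ * _); rewrite exprMn invfM -mulrA mulVf ?mulr1 //.
  exact: expf_neq0.
move=> th _.
have [_ nz] := omxy th.
rewrite -/(circ r th _).
have -> : (\row_(i < n) (r%:C%C * cexpi (th i)), \row_(i < n) (r%:C%C * cexpi (th (n + i)%N))) =
  (\row_(i < n) circ r th i, \row_(i < n) circ r th (n + i)%N) by [].
rewrite chart_inv_st OF.1 //; last exact: Zhat_gq.
have -> : \sum_(i < n) (\row_(i0 < n) (r%:C%C * cexpi (th i0)) : 'rV[C]_n) 0 i *
   (\row_(i0 < n) (r%:C%C * cexpi (th (n + i0)%N)) : 'rV[C]_n) 0 i = xy th.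
  by apply: eq_bigr => i _; rewrite !mxE.
have E1 : \prod_(i < n) (@cI R * (\row_(i0 < n) (r%:C%C * cexpi (th i0)) : 'rV[C]_n) 0 i) =
   @cI R ^+ n * \prod_(i < n) circ r th i.
  under eq_bigr do rewrite mxE.
  by rewrite big_split prodr_const card_ord.
have E2 : \prod_(i < n) (@cI R * (\row_(i0 < n) (r%:C%C * cexpi (th (n + i0)%N)) : 'rV[C]_n) 0 i) =
   @cI R ^+ n * \prod_(i < n) circ r th (n + i)%N.
  under eq_bigr do rewrite mxE.
  by rewrite big_split prodr_const card_ord.
have E3 : \prod_(i < n) ((\row_(i0 < n) (r%:C%C * cexpi (th i0)) : 'rV[C]_n) 0 i ^+ (P i).+1 *
   (\row_(i0 < n) (r%:C%C * cexpi (th (n + i0)%N)) : 'rV[C]_n) 0 i ^+ (Q i).+1) =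
   (\prod_(i < n) circ r th i * \prod_(i < n) circ r th (n + i)%N) * mon d (circ r th) (jn P Q).
  rewrite mon_split jn_lft jn_rgt -!big_split; apply: eq_bigr => i _.
  by rewrite !mxE !exprS mulrACA.
rewrite E1 E2 E3.
have n1 : \prod_(i < n) circ r th i != 0 by apply/prodf_neq0 => i _; exact: circ_neq0.
have n2 : \prod_(i < n) circ r th (n + i)%N != 0 by apply/prodf_neq0 => i _; exact: circ_neq0.
have n3 : mon d (circ r th) (jn P Q) != 0.
  by apply/prodf_neq0 => i _; rewrite expf_neq0 // circ_neq0.
rewrite exprD; move: n1 n2 n3.
move: (\prod_(i < n) circ r th i) (\prod_(i < n) circ r th (n + i)%N) (mon d _ _) => x y m.
move: (F _) (_ ^ _) (@cI R ^+ n) => f g c x0 y0 m0.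
by field; rewrite x0 y0 m0.
Qed.

(** Against the kernel of c_{P,Q} a partial sum gives exactly [c P Q] once its box contains (P, Q),
    and partial sums converge uniformly to F on a compact set containing the torus. *)
Lemma coef_unique (c : mindex n -> mindex n -> C) : series_to c F ->
  forall P Q, c P Q = coef r F P Q.
Proof.
move=> sc P Q; pose b := jn P Q.
have lb : lft b = P by exact: jn_lft.
have rb : rgt b = Q by exact: jn_rgt.
pose m := maxn (msize P) (msize Q).
(* In [gq] coordinates the torus consists of points (x/(1 - x.y), y), with entries of modulus at
   most r / (1 - q) and equal to r respectively. *)
pose K := Ksec (@gq R n) (r / (1 - q)).
have cK : qcompact K := qcompact_Ksec (good_gq R n) _.
have Kst th : K (gq n (st (circ r th))).
  apply: (Ksec_ga (good_gq R n)) => j jd; rewrite /st.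
  have cr : cabs (circ r th j) = r by rewrite cabs_circ.
  have [lo nz] := omxy th; case: ifP => _.
    by rewrite cabsM cabsV cr ler_pM2l // lef_pV2 ?posrE // (lt_le_trans q1).
  by rewrite cr ler_peMr ?(ltW r0) // invf_ge1 // gerBl.
have [MF HMF] := Ksec_bounded (good_gq R n) OF (r / (1 - q)).
have [rho rho1 KR] := qcompact_Reg cK.
have [W W0 HW] := tame_bound (tame_omz (m%:Z - 1)).
have tame_psum N : tame d (fun th => psum N c (gq n (st (circ r th)))).
  have -> : (fun th => psum N c (gq n (st (circ r th)))) = (fun th => \sum_(a <- box N d)
     c (lft a) (rgt a) * (mon d (circ r th) a *
       (1 - xy th)^-1 ^+ maxn (msize (lft a)) (msize (rgt a)))).
    apply/funext => th; rewrite psumE; apply: eq_bigr => a _.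
    by rewrite fhat_st.
  apply: tame_sum => a; apply: tameM; first exact: tame_cst.
  by apply: tmon; exact: tameX.
have psum_coef N : (forall j, (j < d)%N -> (b j < N)%N) ->
    tcoef r d (fun th => psum N c (gq n (st (circ r th))) * (1 - xy th) ^ (m%:Z - 1)) b = c P Q.
  move=> bN.
  pose ka (a : nat -> nat) : int := m%:Z - (maxn (msize (lft a)) (msize (rgt a)))%:Z - 1.
  rewrite (@tcoef_ext _ _ _ _ (fun th => \sum_(a <- box N d) c (lft a) (rgt a) *
     (mon d (circ r th) a * (1 - xy th) ^ ka a))); last first.
    move=> th _; rewrite psumE mulr_suml; apply: eq_bigr => a _.
    have [_ nz] := omxy th.
    rewrite fhat_st -!mulrA; congr (_ * (_ * _)).
    by rewrite exprVn exprnN -expfzDr // /ka; congr (_ ^ _); ring.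
  rewrite tcoef_sum; last first.
    by move=> a; apply: tameM; [exact: tame_cst|apply: tmon; exact: tame_omz].
  rewrite (eq_bigr (fun a => c (lft a) (rgt a) *
     tcoef r d (fun th => mon d (circ r th) a * (1 - xy th) ^ ka a) b)); last first.
    by move=> a _; rewrite tcoefZ //; apply: tmon; exact: tame_omz.
  have gb a : (forall j, (j < d)%N -> a j = b j) -> c (lft a) (rgt a) *
     tcoef r d (fun th => mon d (circ r th) a * (1 - xy th) ^ ka a) b = c P Q.
    move=> ab; have la : lft a = P by rewrite -lb; apply/funext => i; rewrite /lft ab // ltn_addr.
    have ra : rgt a = Q by rewrite -rb; apply/funext => i; rewrite /rgt ab // ltn_add2l.
    rewrite la ra (@tcoef_ext _ _ _ _ (fun th => mon d (circ r th) a * (1 - xy th)^-1)).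
      by rewrite tcoef_eq // mulr1.
    move=> th _; congr (_ * _); rewrite /ka la ra -/m.
    by rewrite (_ : m%:Z - m%:Z - 1 = -1) //; ring.
  rewrite (box_sum_delta bN).
  - exact: gb.
  - by move=> a ab; rewrite !gb.
  - move=> a j jd abj; rewrite (tcoef_neq jd abj) ?mulr0 //.
    by rewrite lb rb.
have [N0 HN0] : exists N0, forall j, (j < d)%N -> (b j < N0)%N.
  exists (\sum_(j < d) b j).+1 => j jd.
  by rewrite ltnS (bigD1 (Ordinal jd)) //= leq_addr.
rewrite coef_tcoef -/m -/b.
apply/eqP; rewrite -subr_eq0; apply/eqP/cabs0P/eqP; rewrite eq_le cabs_ge0 andbT.
apply/ler_addgt0Pl => e e0; rewrite addr0.
pose k := 2 ^+ d * W / r ^+ asize d b.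
have k0 : 0 < k by rewrite !mulr_gt0 ?invr_gt0 ?exprn_gt0.
have [N1 HN1] := sc K cK (e / k) (divr_gt0 e0 k0).
pose N := (N0 + N1)%N.
have NN1 : (N1 <= N)%N by rewrite leq_addl.
have hN := HN1 N NN1.
have bN j : (j < d)%N -> (b j < N)%N.
  by move=> /HN0 h; apply: (leq_trans h); rewrite leq_addr.
rewrite cabsB -(psum_coef N bN) -tcoefB; first last.
- by apply: tameM => //; exact: tame_omz.
- by apply: tameM; [exact: tame_F|exact: tame_omz].
have -> : e = 2 ^+ d * ((e / k) * W) / r ^+ asize d b.
  have -> : 2 ^+ d * ((e / k) * W) / r ^+ asize d b = k * (e / k).
    by rewrite {2}/k; move: (e / k) => u; ring.
  by rewrite mulrC divfK // gt_eqF.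
apply: tcoef_le => //.
  by apply: tameB; [apply: tameM; [exact: tame_F|exact: tame_omz]|apply: tameM; [exact: tame_psum|exact: tame_omz]].
move=> th hb; rewrite -mulrBl cabsM ler_pM ?cabs_ge0 ?HW //.
apply: le_trans (ltW hN).
(* A supremum dominates the values only over a bounded set; boundedness comes from [MF] for F and
   from [rnorm rho N c] for the partial sum. *)
apply: (@le_semiK R n K (fun pq => F pq - psum N c pq) (MF + rnorm rho N c)) => // pq Kpq.
apply: (le_trans (cabsD _ _)); rewrite cabsN lerD ?HMF //.
by apply: psum_le => //; exact: KR.
Qed.

End Uniqueness.

(** * The completion *)

Section Completion.
Variables (R : realType) (n : nat).
Local Notation C := (CC R).
Local Notation pt := (pt R n).
Local Notation d := (n + n)%N.
Local Notation lft := (@lft n).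
Local Notation rgt := (@rgt n).

Section Differentiability.
Local Notation V := ('rV[C]_n * 'rV[C]_n)%type.
Variable uv : V.

Let diff_cst (a : C) : differentiable (fun _ : V => a) uv.
Proof. exact: differentiable_cst. Qed.

Let diffM (f g : V -> C) : differentiable f uv -> differentiable g uv ->
  differentiable (fun v => f v * g v) uv.
Proof. by move=> df dg; exact: (differentiableM df dg). Qed.

Let diffX (f : V -> C) k : differentiable f uv -> differentiable (fun v => f v ^+ k) uv.
Proof.
move=> df; elim: k => [|k IH]; first exact: (diff_cst 1).
rewrite (_ : (fun v => _) = (fun v => f v * f v ^+ k)); first exact: diffM.
by apply/funext => v; rewrite exprS.
Qed.

Let diff_sum (I : Type) (s : seq I) (f : I -> V -> C) :
  (forall i, differentiable (f i) uv) -> differentiable (fun v => \sum_(i <- s) f i v) uv.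
Proof.
move=> df; elim: s => [|i s IH].
  rewrite (_ : (fun v => _) = (fun=> 0)); first exact: (diff_cst 0).
  by apply/funext => v; rewrite big_nil.
rewrite (_ : (fun v => _) = (f i \+ (fun v => \sum_(i <- s) f i v))); first exact: differentiableD.
by apply/funext => v; rewrite big_cons.
Qed.

Let diff_prod (I : Type) (s : seq I) (f : I -> V -> C) :
  (forall i, differentiable (f i) uv) -> differentiable (fun v => \prod_(i <- s) f i v) uv.
Proof.
move=> df; elim: s => [|i s IH].
  rewrite (_ : (fun v => _) = (fun=> 1)); first exact: (diff_cst 1).
  by apply/funext => v; rewrite big_nil.
rewrite (_ : (fun v => _) = (fun v => f i v * \prod_(i <- s) f i v)); first exact: diffM.
by apply/funext => v; rewrite big_cons.
Qed.

Let diff_ins1 mu j : differentiable (fun v : V => ins mu v.1 0 j) uv.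
Proof.
rewrite (_ : (fun v => _) = (fun v : V => if unlift mu j is Some k then v.1 0 k else 1)); last first.
  by apply/funext => v; rewrite mxE.
case: (unlift mu j) => [k|]; last exact: (diff_cst 1).
have h1 : differentiable (fst : V -> 'rV[C]_n) uv.
  by apply: linear_differentiable => v; exact: cvg_fst.
exact: (differentiable_comp h1 (differentiable_coord uv.1 0 k)).
Qed.

Let diff_ins2 mu j : differentiable (fun v : V => ins mu v.2 0 j) uv.
Proof.
rewrite (_ : (fun v => _) = (fun v : V => if unlift mu j is Some k then v.2 0 k else 1)); last first.
  by apply/funext => v; rewrite mxE.
case: (unlift mu j) => [k|]; last exact: (diff_cst 1).
have h1 : differentiable (snd : V -> 'rV[C]_n) uv.
  by apply: linear_differentiable => v; exact: cvg_snd.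
exact: (differentiable_comp h1 (differentiable_coord uv.2 0 k)).
Qed.

Let diff_hform mu nu : differentiable (fun v : V => hform (ins mu v.1) (ins nu v.2)) uv.
Proof.
apply: diff_sum => j; apply: diffM; last exact: diff_ins2.
by apply: diffM; [exact: diff_cst|exact: diff_ins1].
Qed.

Lemma psum_differentiable N (c : mindex n -> mindex n -> C) mu nu : chart_dom mu nu uv ->
  differentiable (psum N c \o chart_inv mu nu) uv.
Proof.
move=> h0.
have d1 j : differentiable (fun v : V => (chart_inv mu nu v).1 0 j) uv by exact: diff_ins1.
have d2 j : differentiable (fun v : V => (chart_inv mu nu v).2 0 j) uv.
  rewrite (_ : (fun v => _) = (fun v : V =>
    - 1 * ((hform (ins mu v.1) (ins nu v.2))^-1 * ins nu v.2 0 j))); last first.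
    by apply/funext => v; rewrite mxE mulN1r mulNr.
  apply: diffM; first exact: diff_cst.
  apply: diffM; last exact: diff_ins2.
  exact: (differentiableV (diff_hform mu nu) h0).
rewrite (_ : psum N c \o chart_inv mu nu = (fun v => \sum_(a <- box N d)
    c (lft a) (rgt a) * fhat (lft a) (rgt a) (chart_inv mu nu v))); last first.
  by apply/funext => v; rewrite /comp psumE.
apply: diff_sum => a; apply: diffM; first exact: diff_cst.
apply: diffM; first by apply: diffM; exact: diffX.
by apply: diff_prod => i; apply: diffM; exact: diffX.
Qed.

End Differentiability.

Lemma Ohat_psum N (c : mindex n -> mindex n -> C) : Ohat (psum N c).
Proof.
split=> [z z0 pq _|mu nu uv]; first exact: psum_cact.
exact: psum_differentiable.
Qed.

Lemma qcompactU (K L : set pt) : qcompact K -> qcompact L -> qcompact (K `|` L).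
Proof.
move=> [[KZ Ks] cK] [[LZ Ls] cL]; split.
  split=> [pq [/KZ|/LZ] //|z z0 pq [h|h]]; first by left; exact: Ks.
  by right; exact: Ls.
move=> Os Oop cov.
have [s [sO sK]] := cK Os Oop (subset_trans (@subsetUl _ K L) cov).
have [t [tO tL]] := cL Os Oop (subset_trans (@subsetUr _ K L) cov).
exists (s ++ t); split=> [W|pq [/sK|/tL] [ W /= Ws Wpq]].
- by rewrite mem_cat => /orP[/sO|/tO].
- by exists W => //=; rewrite mem_cat Ws.
- by exists W => //=; rewrite mem_cat Ws orbT.
Qed.

Lemma rnorm_ge0 (rho : R) N (c : mindex n -> mindex n -> C) : 0 <= rho -> 0 <= rnorm rho N c.
Proof.
move=> r0; rewrite rnormE; apply: sumr_ge0 => a _.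
by rewrite mulr_ge0 ?cabs_ge0 ?exprn_ge0.
Qed.

Lemma semiK_psum (K : set pt) : qcompact K -> exists2 rho : R, 1 <= rho &
  forall N (c : mindex n -> mindex n -> C), semiK K (psum N c) <= rnorm rho N c.
Proof.
move=> /qcompact_Reg[rho rho1 KR]; exists rho => // N c.
apply: semiK_le => [|pq /KR Rpq]; last exact: psum_le.
by rewrite rnorm_ge0 // (le_trans ler01).
Qed.

Lemma coef_ecoef (r : R) (F : pt -> C) : 0 < r -> n%:R * r ^+ 2 < 1 -> Ohat F ->
  coef r F = ecoef F.
Proof.
move=> r0 rn OF; apply/funext => P; apply/funext => Q.
by rewrite (coef_unique r0 rn OF (series_ecoef OF)).
Qed.

(** Coefficients cut off outside the box: the partial sums are then all equal to [psum N c] from N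
    on, so uniqueness applies to this finite expansion. *)
Let trunc N (c : mindex n -> mindex n -> C) P Q : C :=
  if ibox N d (jn P Q) then c P Q else 0.

Let ibox_jn N a : ibox N d (jn (lft a) (rgt a)) = ibox N d a.
Proof. by apply: eq_forallb => j; rewrite jnK. Qed.

Let psum_trunc N N' c pq : (N <= N')%N -> psum N' (trunc N c) pq = psum N c pq.
Proof.
move=> NN'; rewrite !psumE [RHS](box_widen _ _ NN'); apply: eq_bigr => a _.
by rewrite /trunc ibox_jn; case: ifP => // _; rewrite mul0r.
Qed.

Lemma ecoef_psum N (c : mindex n -> mindex n -> C) P Q : ibox N d (jn P Q) ->
  ecoef (psum N c) P Q = c P Q.
Proof.
move=> bPQ; have [r [r0 rn]] : exists r : R, 0 < r /\ n%:R * r ^+ 2 < 1.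
  (* Any r with n r^2 < 1 would do, since r does not appear in the conclusion; here n < (n +
     1)^2. *)
  exists (n%:R + 1)^-1; have n0 : (0 : R) < n%:R + 1 by rewrite ltr_wpDl.
  split; first by rewrite invr_gt0.
  rewrite expr2 mulrA ltr_pdivrMr // mul1r ltr_pdivrMr //.
  have : (0 : R) <= n%:R by []; nra.
rewrite -(coef_ecoef r0 rn (Ohat_psum N c)) -(coef_unique r0 rn (Ohat_psum N c) (c := trunc N c)).
  by rewrite /trunc bPQ.
move=> K _ eps eps0; exists N => N' NN'.
apply: le_lt_trans eps0; apply: semiK_le => // pq _.
by rewrite psum_trunc // subrr cabs0.
Qed.

(** Cauchy's estimates apply to the partial sum itself, whose coefficients are recovered by
    [ecoef_psum]. The two polysquares have half-side 2 rho to gain a factor 2^-(|P|+|Q|); one 2^d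
    comes from the estimate, the other from summing that factor. *)
Lemma rnorm_le_semiK (rho : R) : 0 < rho -> exists K : set pt, qcompact K /\
  exists M : R, forall N (c : mindex n -> mindex n -> C), rnorm rho N c <= M * semiK K (psum N c).
Proof.
move=> rho0; have r0 : 0 < 2 * rho by rewrite mulr_gt0.
pose K := Ksec (@gq R n) (2 * rho) `|` Ksec (@gp R n) (2 * rho).
have cK : qcompact K.
  by apply: qcompactU; apply: qcompact_Ksec; [exact: good_gq|exact: good_gp].
exists K; split => //; exists (2 ^+ d * 2 ^+ d) => N c.
have [rho' rho1 KR] := qcompact_Reg cK.
set M := semiK K _.
have HM pq : K pq -> cabs (psum N c pq) <= M.
  apply: (@le_semiK R n K (psum N c) (rnorm rho' N c)) => pq' Kpq.
  by apply: psum_le => //; exact: KR.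
have M0 : 0 <= M.
  have Kgq : K (gq n (fun=> 0)).
    left; apply: (Ksec_ga (good_gq R n)) => j _.
    by rewrite cabs0 ltW.
  exact: le_trans (cabs_ge0 _) (HM _ Kgq).
rewrite rnormE; apply: (@le_trans _ _ (\sum_(a <- box N d) 2 ^+ d * M * 2 ^- asize d a)).
  (* Widening from N to N only inserts the indicator of the box: c is arbitrary outside it, so the
     estimate is available only for indices inside. *)
  rewrite (box_widen _ _ (leqnn N)) [X in _ <= X](box_widen _ _ (leqnn N)); apply: ler_sum => a _; case: ifP => // ba.
  have h : cabs (c (lft a) (rgt a)) <= 2 ^+ d * M / (2 * rho) ^+ asize d a.
    rewrite -(@ecoef_psum N c (lft a) (rgt a)) ?ibox_jn // asize_split.
    by apply: (ecoef_le (Ohat_psum N c) _ _ r0) => pq h; apply: HM; [left|right].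
  have rk : 0 < rho ^+ asize d a by rewrite exprn_gt0.
  apply: (@le_trans _ _ (2 ^+ d * M / (2 * rho) ^+ asize d a * rho ^+ asize d a)).
    by rewrite ler_pM2r.
  by rewrite exprMn invfM -!mulrA mulVf ?gt_eqF // mulr1.
rewrite -mulr_sumr -mulrA [M * _]mulrC mulrA ler_wpM2r //.
by rewrite ler_wpM2l ?exprn_ge0 // box_geo_le.
Qed.

End Completion.

Theorem theorem3p16 (R : realType) (n : nat) (hn : (1 <= n)%N) :
  (* (1) the topology induced on P(D_n) by A(D_n) is the one of the norms ||.||_rho *)
  ((forall K : set (pt R n), qcompact K ->
      exists2 rho : R, 0 < rho & exists M : R, forall N (c : mindex n -> mindex n -> CC R),
        semiK K (psum N c) <= M * rnorm rho N c) /\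
   (forall rho : R, 0 < rho ->
      exists K : set (pt R n), qcompact K /\ exists M : R,
        forall N (c : mindex n -> mindex n -> CC R),
        rnorm rho N c <= M * semiK K (psum N c))) /\
  (* (2) P(D_n) is dense in A(D_n) *)
  (forall F : pt R n -> CC R, Ohat F ->
     forall K, qcompact K -> forall eps : R, 0 < eps ->
       exists N (c : mindex n -> mindex n -> CC R),
         semiK K (fun pq => F pq - psum N c pq) < eps) /\
  (* (3) absolute Schauder basis expansion with the integral coefficients, unique *)
  (forall (F : pt R n -> CC R), Ohat F ->
     forall r : R, 0 < r -> r < (Num.sqrt (n%:R))^-1 ->
       abs_conv (coef r F) /\ series_to (coef r F) F /\
       (forall d : mindex n -> mindex n -> CC R,
          abs_conv d -> series_to d F -> forall P Q, d P Q = coef r F P Q)).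
Proof.
split; last split.
- split=> [K /semiK_psum[rho rho1 H]|]; last exact: rnorm_le_semiK.
  exists rho; first exact: lt_le_trans rho1.
  by exists 1 => N c; rewrite mul1r.
- move=> F OF K cK eps eps0; have [N H] := series_ecoef OF cK eps0.
  by exists N, (ecoef F); exact: H.
- move=> F OF r r0 rlt.
  have rn : n%:R * r ^+ 2 < 1.
    have n0 : (0 : R) < n%:R by rewrite ltr0n.
    have h : Num.sqrt n%:R * r < 1 by rewrite mulrC -ltr_pdivlMr ?sqrtr_gt0 // mul1r.
    rewrite -[X in X * _](sqr_sqrtr (ltW n0)) -exprMn.
    by rewrite exprn_ilt1 // mulr_ge0 ?sqrtr_ge0 // ltW.
  rewrite (coef_ecoef r0 rn OF); split; first exact: abs_conv_ecoef.
  split=> [|c _ sc P Q]; first exact: series_ecoef.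
  by rewrite (coef_unique r0 rn OF sc) (coef_ecoef r0 rn OF).
Qed.
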